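(* Let $N\ge3$ and let $D\subset\mathbb{R}^N$ be a bounded domain with $0\in D$ and boundary $\partial D$ of class $C^{2,\alpha}$ for some $0<\alpha<1$. Let $\sigma_+,\sigma_-$ be positive constants with $\sigma_+\neq\sigma_-$ and set $\sigma(x)=\sigma_+$ for $x\in D$, $\sigma(x)=\sigma_-$ for $x\in\mathbb{R}^N\setminus D$. Let $\psi\in C^2(\bar D)\cap C(\mathbb{R}^N)$ satisfy: $\max\psi>0$, $\psi$ is radially symmetric with respect to the origin, and $\overline{\{x\in\mathbb{R}^N:\psi(x)>0\}}\subset D$. Let $u\in C^{1,1}(\bar D)\cap C^{0,1}(\mathbb{R}^N)$ be the solution of $$\min\{-\operatorname{div}(\sigma\nabla u),\,u-\psi\}=0\text{ in }\mathbb{R}^N,\qquad u(x)\to0\text{ as }|x|\to\infty,$$ and suppose that in addition $u=d$ on $\partial D$ for some constant $d>0$. Then $u$ is radially symmetric with respect to the origin and $D$ is a ball centered at the origin.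
   Context: The obstacle problem $\min\{-\operatorname{div}(\sigma\nabla u),u-\psi\}=0$ in $\mathbb{R}^N$ is understood as: $u\ge\psi$ in $\mathbb{R}^N$, $-\operatorname{div}(\sigma\nabla u)\ge0$ in the weak (distributional) sense in $\mathbb{R}^N$, and $-\operatorname{div}(\sigma\nabla u)=0$ in the weak sense in the open set $\{u>\psi\}$. *)

(* Defs.v *)
From HB Require Import structures.
From mathcomp Require Import all_boot all_order all_algebra.
From mathcomp Require Import all_classical all_reals all_analysis.
Set Implicit Arguments. Unset Strict Implicit. Unset Printing Implicit Defensive.
Import Order.TTheory GRing.Theory Num.Theory.
Import numFieldNormedType.Exports.
Local Open Scope classical_set_scope.
Local Open Scope ring_scope.

Section Defs.
Variable R : realType.

(* Euclidean norm |x| (the library norm on matrices is the max norm). *)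
Definition ob_enorm (n : nat) (x : 'rV[R]_n) : R :=
  Num.sqrt (\sum_(i < n) x ord0 i ^+ 2).

Definition ob_ebasis (n : nat) (i : 'I_n) : 'rV[R]_n := delta_mx ord0 i.
Definition ob_partial (n : nat) (i : 'I_n) (f : 'rV[R]_n -> R) : 'rV[R]_n -> R :=
  fun x => 'D_(ob_ebasis i) f x.

Definition ob_iter_partial (n : nat) (s : seq 'I_n) (f : 'rV[R]_n -> R) :=
  foldr (fun i g => ob_partial i g) f s.

(* Lebesgue integral over R^n, computed as the iterated one-dimensional
   Lebesgue integral (equal to the n-dimensional one by Fubini for the
   bounded, compactly supported integrands used below). *)
Fixpoint ob_iint (n : nat) : ('rV[R]_n -> R) -> R :=
  match n with
  | 0 => fun f => f 0
  | k.+1 => fun f =>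
      Rintegral (@lebesgue_measure R) setT
        (fun t : R => ob_iint (fun y : 'rV[R]_k => f (row_mx t%:M y)))
  end.

Definition ob_bounded_domain (n : nat) (D : set 'rV[R]_n) :=
  open D /\ connected D /\ D !=set0 /\ exists M : R, forall x, D x -> ob_enorm x <= M.

Definition ob_boundary (n : nat) (D : set 'rV[R]_n) := closure D `\` interior D.

Definition ob_C2alpha (n : nat) (alpha : R) (g : 'rV[R]_n -> R) :=
  (forall x i j, derivable g x (ob_ebasis i) /\
                 derivable (ob_partial i g) x (ob_ebasis j)) /\
  continuous g /\
  (forall i, continuous (ob_partial i g)) /\
  (forall i j, continuous (ob_partial j (ob_partial i g))) /\
  exists C : R, forall i j x y,
    `|ob_partial j (ob_partial i g) x - ob_partial j (ob_partial i g) y|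
      <= C * (ob_enorm (x - y)) `^ alpha.

(* The ob_boundary of D (in R^(n+1)) is of class C^{2,alpha}: near every
   ob_boundary point, after a rigid motion, D is the supergraph of a
   C^{2,alpha} function of n variables. *)
Definition ob_C2alpha_boundary (n : nat) (alpha : R) (D : set 'rV[R]_n.+1) :=
  forall x0, ob_boundary D x0 ->
  exists r : R, 0 < r /\
  exists Q : 'M[R]_n.+1, Q *m Q^T = 1%:M /\
  exists g : 'rV[R]_n -> R, ob_C2alpha alpha g /\
  forall (y : 'rV[R]_n) (t : R),
    let x := x0 + row_mx t%:M y *m Q in
    ob_enorm (x - x0) < r -> (D x <-> g y < t).

Definition ob_cont_ext (n : nat) (D : set 'rV[R]_n) (g : 'rV[R]_n -> R) :=
  exists h : 'rV[R]_n -> R,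
    {within closure D, continuous h} /\ forall x, D x -> g x = h x.

Definition ob_C2_closure (n : nat) (D : set 'rV[R]_n) (f : 'rV[R]_n -> R) :=
  (forall x, D x -> forall i j,
     derivable f x (ob_ebasis i) /\ derivable (ob_partial i f) x (ob_ebasis j)) /\
  ob_cont_ext D f /\ (forall i, ob_cont_ext D (ob_partial i f)) /\
  (forall i j, ob_cont_ext D (ob_partial j (ob_partial i f))).

Definition ob_lipschitz (n : nat) (A : set 'rV[R]_n) (f : 'rV[R]_n -> R) :=
  exists L : R, forall x y, A x -> A y -> `|f x - f y| <= L * ob_enorm (x - y).

Definition ob_C11_closure (n : nat) (D : set 'rV[R]_n) (f : 'rV[R]_n -> R) :=
  (forall x, D x -> forall i, derivable f x (ob_ebasis i)) /\
  {within closure D, continuous f} /\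
  (forall i, ob_lipschitz D (ob_partial i f)).

Definition ob_smooth (n : nat) (f : 'rV[R]_n -> R) :=
  forall s : seq 'I_n, continuous (ob_iter_partial s f) /\
    forall x i, derivable (ob_iter_partial s f) x (ob_ebasis i).

Definition ob_test_fun (n : nat) (O : set 'rV[R]_n) (phi : 'rV[R]_n -> R) :=
  ob_smooth phi /\ exists K, compact K /\ K `<=` O /\ forall x, ~ K x -> phi x = 0.

Definition ob_energy (n : nat) (sigma u phi : 'rV[R]_n -> R) : R :=
  ob_iint (fun x => sigma x * \sum_(i < n) ob_partial i u x * ob_partial i phi x).

Definition ob_weak_supersol (n : nat) (sigma u : 'rV[R]_n -> R) :=
  forall phi, ob_test_fun setT phi -> (forall x, 0 <= phi x) ->
    0 <= ob_energy sigma u phi.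

Definition ob_weak_sol_in (n : nat) (O : set 'rV[R]_n) (sigma u : 'rV[R]_n -> R) :=
  forall phi, ob_test_fun O phi -> ob_energy sigma u phi = 0.

Definition ob_obstacle_sol (n : nat) (sigma psi u : 'rV[R]_n -> R) :=
  (forall x, psi x <= u x) /\ ob_weak_supersol sigma u /\
  ob_weak_sol_in [set x | psi x < u x] sigma u.

Definition ob_radial (n : nat) (f : 'rV[R]_n -> R) :=
  forall x y, ob_enorm x = ob_enorm y -> f x = f y.

Definition ob_sigma_of (n : nat) (D : set 'rV[R]_n) (sp sm : R) : 'rV[R]_n -> R :=
  fun x => if x \in D then sp else sm.

End Defs.

(* Main.v *)
(* Put kappa = sm / sp and let w = u in D, w = d + kappa (u - d) outside D.
   Since u = d on the boundary, w is Lipschitz, and sigma grad u = sp grad w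
   almost everywhere: the interface disappears. Hence w is superharmonic in the
   whole space, harmonic off the contact set {u = psi}, and tends to
   c = d (1 - kappa) < d at infinity. The minimum principle in D and a Gaussian
   barrier outside D give u >= d in D and w > c, so that u > 0 outside D; thus
   the contact set lies in {psi > 0}, which is contained in D.

   For a reflection S through a hyperplane containing 0, w o S is a competitor
   for the same obstacle problem because psi is radial: where w > w o S there is
   no contact, so w is harmonic there and w o S - w is superharmonic, and the
   maximum principle yields w <= w o S. So w is radial, and it is radially
   nonincreasing by the minimum principle on balls. If the boundary of D, on
   which w = d, met a sphere inside the outermost sphere it touches, then
   comparing d - w with a multiple of |x|^2 - rho on an annulus free of contact
   would force w < d on the outermost sphere. Hence the boundary of D lies on
   one sphere and D is a ball. *)

Require Import Defs.
From HB Require Import structures.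
From mathcomp Require Import all_boot all_order all_algebra.
From mathcomp Require Import all_classical all_reals all_analysis.
From mathcomp Require Import measurable_realfun lebesgue_stieltjes_measure charge ftc.
From mathcomp Require Import ring lra.
Import Order.TTheory GRing.Theory Num.Theory.
Import numFieldNormedType.Exports.
Local Open Scope classical_set_scope.
Local Open Scope ring_scope.
Set Implicit Arguments. Unset Strict Implicit. Unset Printing Implicit Defensive.

(** * One-dimensional integrals modulo null sets *)

(** The energy is an iterated integral of products containing partial derivatives of a Lipschitz
    function, which exist only almost everywhere and carry no measurability. Integrals are therefore
    manipulated only for Lipschitz functions with bounded support, a class stable under slicing, and
    the energy enters once, as the limit of integrals of difference quotients. The null sets [Nul]
    and a Rademacher theorem in each coordinate direction serve that limit.

    The equation is tested only against translates of the bump exp(-1/(e^2 - |x|^2)). The energy is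
    then a multiple of the integral of [w] against the Laplacian of the bump, that is of the
    Laplacian of a mollification of [w]. So mollifications of [w] have nonpositive Laplacian, and
    sums such as [w o S - w] are handled at minima of their smooth approximants, which are uniformly
    close by the Lipschitz bound. Every comparison is an instance of one minimum argument on a
    compact set, made strict by a quadratic or a Gaussian. *)

Section OneDim.
Context {R : realType}.
Notation mu := (@lebesgue_measure R).

Import HBNNSimple.

(** The integral of a nonnegative function is a supremum over the simple functions below it, and a
    simple function below [f], cut off on [N], keeps its integral and lies below [g]. This covers
    nonmeasurable [f] and [g]. *)
Lemma nnintegral_le_ae (f g : R -> \bar R) (N : set R) :
  measurable N -> mu N = 0%E -> (forall x, 0 <= f x)%E -> (forall x, 0 <= g x)%E ->
  (forall x, ~ N x -> f x = g x) ->
  (\int[mu]_x f x <= \int[mu]_x g x)%E.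
Proof.
move=> mN N0 f0 g0 fg.
rewrite !ge0_integralTE//.
apply: ub_ereal_sup => _ [h hf <-].
pose h' := proj_nnsfun h (measurableC mN).
have h'E x : h' x = h x * \1_(~` N) x by [].
apply: (@le_trans _ _ (sintegral mu h')); last first.
  apply: ereal_sup_ubound; exists h' => // x.
  rewrite h'E indicE; case: (boolP (x \in ~` N)) => [|xN].
    by rewrite inE /= => nx; rewrite mulr1 -fg.
  by rewrite mulr0.
have sE (k : {nnsfun measurableTypeR R >-> R}) : sintegral mu k = (\int[mu]_x (k x)%:E)%E.
  by rewrite (integral_nnsfun mu measurableT k) patch_setT.
rewrite !sE le_eqVlt; apply/orP; left; apply/eqP.
apply: ae_eq_integral => //.
- by apply/measurable_EFinP; exact: measurable_funTS.
- by apply/measurable_EFinP; exact: measurable_funTS.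
- exists N; split => //.
  move=> x /=; apply: contra_notP => nx _; congr (_%:E).
  by rewrite mindicE mem_set ?mulr1.
Qed.

Lemma integral_eq_ae (f g : R -> \bar R) :
  mu.-negligible [set x | f x <> g x] -> (\int[mu]_x f x = \int[mu]_x g x)%E.
Proof.
move=> [N [mN N0 sN]].
have fg x : ~ N x -> f x = g x.
  by move=> nx; apply: contrapT => ne; apply: nx; apply: sN.
rewrite integralE [RHS]integralE; congr (_ - _)%E; apply/eqP; rewrite eq_le; apply/andP; split;
  apply: (nnintegral_le_ae mN N0) => // x nx; rewrite ?funeposE ?funenegE fg//.
Qed.

Lemma Rintegral_eq_ae (f g : R -> R) :
  mu.-negligible [set x | f x <> g x] -> Rintegral mu setT f = Rintegral mu setT g.
Proof.
move=> fg; rewrite /Rintegral; congr fine; apply: integral_eq_ae.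
by apply: negligibleS fg => x /= h e; apply: h; rewrite e.
Qed.

(** Dominated convergence for a limit of unknown measurability: setting all functions to 0 on a null
    set containing the bad points makes the limit an everywhere pointwise limit, hence
    measurable. *)
Lemma Rintegral_cvg_ae (F : nat -> R -> R) (f : R -> R) (M C : R) :
  (forall k, measurable_fun setT (F k)) ->
  (forall k t, M < `|t| -> F k t = 0) -> (forall k t, `|F k t| <= C) ->
  mu.-negligible [set t | ~ (F ^~ t @ \oo --> f t)] ->
  (fun k => Rintegral mu setT (F k)) @ \oo --> Rintegral mu setT f.
Proof.
move=> mF F0 FC [N [mN N0 sN]].
pose A : set R := ~` N.
have mA : measurable A by exact: measurableC.
pose F' k := (F k) \_ A.
pose f' := f \_ A.
have cF t : F' ^~ t @ \oo --> f' t.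
  rewrite /F' /f' /patch; case: ifPn => [|_]; last exact: cvg_cst.
  by rewrite inE => nt; apply: contrapT => h; apply: nt; exact: sN.
have mF' k : measurable_fun setT (F' k).
  by apply/(measurable_restrictT _ mA); exact: measurable_funTS.
have mf' : measurable_fun setT f'.
  by apply: (@measurable_fun_cvg _ _ _ setT F' f') => // t _; exact: cF.
have eqF k : Rintegral mu setT (F k) = Rintegral mu setT (F' k).
  apply: Rintegral_eq_ae; exists N; split => // t /=; apply: contra_notP => nt.
  by rewrite /F' patchE mem_set.
have -> : Rintegral mu setT f = Rintegral mu setT f'.
  apply: Rintegral_eq_ae; exists N; split => // t /=; apply: contra_notP => nt.
  by rewrite /f' patchE mem_set.
under eq_fun do rewrite eqF.
pose g := (cst `|C|) \_ (`[- M, M]%classic : set R).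
have ig : mu.-integrable setT (EFin \o g).
  rewrite /g -restrict_EFin; apply: ((@integrable_mkcond _ _ _ mu (`[- M, M]%classic : set R) (EFin \o cst `|C|) _).1) => //.
  apply/integrableP; split; first exact: (measurable_cst (`|C|%:E)).
  under eq_integral do rewrite /= normr_id.
  rewrite integral_cst//= lebesgue_measure_itv /=.
  by case: ifP => _; rewrite ?mule0// -EFinM ltry.
have [iF _ cI] : [/\ mu.-integrable setT (EFin \o f'),
   [sequence \int[mu]_(x in setT) (`|(EFin \o F' n) x - (EFin \o f') x|)]_n @ \oo --> 0 &
   [sequence \int[mu]_(x in setT) (EFin \o F' n) x]_n @ \oo --> \int[mu]_(x in setT) (EFin \o f') x]%E.
  apply: (@dominated_convergence _ _ _ mu setT _ _ _ (EFin \o g)) => //.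
  - by move=> k; apply/measurable_EFinP; exact: mF'.
  - by apply/measurable_EFinP; exact: mf'.
  - apply: aeW => t _ /=; apply: cvg_EFin; last exact: cF.
    by apply: nearW.
  - apply: aeW => t k _ /=; rewrite lee_fin /g /F' !patchE.
    case: (ifPn (t \in `[_, _]%classic)) => [_|].
      case: ifP => _; last by rewrite normr0.
      by rewrite (le_trans (FC _ _))// ler_norm.
    rewrite notin_setE /= in_itv /= => /negP h; rewrite F0 ?patchE; first by case: ifP; rewrite normr0.
    by rewrite ltNge ler_norml.
apply: fine_cvg; rewrite /Rintegral fineK; first exact: cI.
by apply: integrable_fin_num.
Qed.

Lemma integrable_bounded_support (f : R -> R) (M C : R) :
  measurable_fun setT f -> (forall t, M < `|t| -> f t = 0) ->
  (forall t, `|f t| <= C) -> mu.-integrable setT (EFin \o f).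
Proof.
move=> mf f0 fC.
pose I : set R := `[- M, M]%classic.
have -> : EFin \o f = (EFin \o f) \_ I.
  apply/funext => t; rewrite patchE; case: ifPn => // /negP.
  rewrite inE /I /= in_itv /= -ler_norml => /negP; rewrite -ltNge => h.
  by rewrite /= f0.
apply: ((@integrable_mkcond _ _ _ mu I (EFin \o f) _).1); first exact: measurable_itv.
apply: (@le_integrable _ _ _ mu I _ _ (cst (`|C|%:E))).
- exact: measurable_itv.
- by apply/measurable_EFinP; exact: measurable_funTS.
- by move=> t _ /=; rewrite lee_fin normr_id (le_trans (fC t))// ler_norm.
apply/integrableP; split; first exact: (measurable_cst (`|C|%:E)).
under eq_integral do rewrite /= normr_id.
rewrite /I integral_cst//= lebesgue_measure_itv /=.
by case: ifP => _; rewrite ?mule0// -EFinM ltry.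
Qed.

(** By uniqueness of Lebesgue measure: its image under the shift gives half-open intervals their
    length. *)
Lemma Rintegral_shift (f : R -> R) (a M C : R) : measurable_fun setT f ->
  (forall t, M < `|t| -> f t = 0) -> (forall t, `|f t| <= C) ->
  Rintegral mu setT (fun t => f (t + a)) = Rintegral mu setT f.
Proof.
move=> mf f0 fC.
pose phi (t : measurableTypeR R) : measurableTypeR R := t + a.
have mphi : measurable_fun setT phi by exact: measurable_funD.
have E X : measurable X -> lebesgue_measure X = pushforward mu phi X.
  apply: lebesgue_measure_unique => //= _ [[x y] _ <-].
  rewrite /pushforward /=.
  rewrite (_ : phi @^-1` _ = `]x - a, y - a]%classic); last first.
    by apply/seteqP; split => t; rewrite /phi /= !in_itv /= ltrBlDr lerBrDr.
  rewrite !lebesgue_measure_itv /= !lte_fin ltrD2r.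
  by case: ifP => // _; rewrite -!EFinB opprD opprK addrACA addNr addr0.
rewrite /Rintegral; congr fine; apply/esym.
rewrite (eq_measure_integral (pushforward mu phi)); last by move=> X mX _; exact: E.
rewrite integral_pushforward//.
  by apply/measurable_EFinP.
rewrite preimage_setT.
apply: (@integrable_bounded_support _ (M + `|a|) C).
- by apply: measurableT_comp.
- move=> t ht; apply: f0; rewrite /phi.
  rewrite -(ltrD2r `|a|); apply: lt_le_trans ht _.
  by rewrite -{1}(addrK a t) (le_trans (ler_normB _ _)).
- by move=> t; exact: fC.
Qed.

End OneDim.

(** * Differentiability of Lipschitz functions of one variable *)

Section Rademacher.
Context {R : realType}.
Notation mu := (@lebesgue_measure R).

Lemma lipschitz_continuousR (g : R -> R) (K : R) :
  (forall x y, `|g x - g y| <= K * `|x - y|) -> continuous g.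
Proof.
move=> Kg x; apply/cvgrPdist_le => e e0.
have K1 : 0 < `|K| + 1 by rewrite ltr_wpDl.
near=> y; apply: le_trans (Kg _ _) _.
apply: (@le_trans _ _ ((`|K| + 1) * `|x - y|)).
  by rewrite ler_wpM2r// (le_trans (ler_norm _))// lerDl.
rewrite mulrC -ler_pdivlMr//.
by near: y; apply: cvgr_dist_le => //; rewrite divr_gt0.
Unshelve. all: by end_near. Qed.

Lemma stieltjes_ocitv (f : cumulative R R) (a b : R) : a <= b ->
  lebesgue_stieltjes_measure f `]a, b]%classic = (f b - f a)%:E.
Proof.
move=> ab; rewrite /lebesgue_stieltjes_measure /measure_extension /=.
by rewrite measurable_mu_extE /=; [rewrite wlength_itv_bnd|exact: is_ocitv].
Qed.

(* With [h1 + h2 = id] both nondecreasing, the Stieltjes measure of [h1] is dominated by Lebesgue measure. *)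
Lemma complementary_ae_derivable (h1 h2 : cumulative R R) (m : nat) :
  (forall t, h1 t + h2 t = t) -> continuous h1 ->
  mu.-negligible [set t | - m%:R < t < m%:R /\ ~ derivable h1 t 1].
Proof.
move=> h12 ch1.
pose nu1 := lebesgue_stieltjes_measure h1.
pose nu2 := lebesgue_stieltjes_measure h2.
have sumE A : measurable A -> mu A = measure_add nu1 nu2 A.
  apply: lebesgue_measure_unique => // _ [[a b] _ <-]; rewrite [(_, _).1]/= [(_, _).2]/=.
  rewrite -[RHS]/(measure_add nu1 nu2 `]a, b]%classic) measure_addE /nu1 /nu2.
  have [ab|ba] := leP a b; last first.
    by rewrite set_itv_ge ?measure0 ?adde0// bnd_simp -leNgt ltW.
  apply: etrans (esym (f_equal2 adde (stieltjes_ocitv h1 ab) (stieltjes_ocitv h2 ab))).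
  rewrite lebesgue_measure_itv /= lte_fin.
  rewrite -?EFinD -?EFinB; case: ifPn => [_|].
    by congr (_%:E); rewrite addrACA h12 -opprD h12.
  rewrite -leNgt => ba; have <- : a = b by apply/eqP; rewrite eq_le ab.
  by rewrite !subrr; exact: esym (adde0 _).
have dom A : measurable A -> (nu1 A <= mu A)%E.
  by move=> mA; rewrite sumE// measure_addE leeDl.
(* Restricting [nu1] to a bounded interval makes it a finite measure, ready for Radon-Nikodym. *)
pose I : set (measurableTypeR R) := `]- m%:R, m%:R]%classic.
have mI : measurable I by exact: measurable_itv.
have mm : - m%:R <= m%:R :> R by rewrite ge0_cp// ler0n.
have Ioo : (nu1 I < +oo)%E.
  by rewrite /nu1 stieltjes_ocitv ?ltry.
pose nu : {finite_measure set _ -> \bar R} := mfrestr mI Ioo.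
have numu : nu `<< mu.
  apply/null_content_dominatesP => A mA A0.
  apply/eqP; rewrite eq_le measure_ge0 andbT /nu /mfrestr /= /mrestr.
  rewrite -A0; apply: (@le_trans _ _ (mu (A `&` I))).
    by apply: dom; exact: measurableI.
  by apply: le_measure; rewrite ?inE//; exact: measurableI.
have [f [f0 ffin fint fE]] := radon_nikodym_sigma_finite numu.
pose g (t : R) := fine (f t).
have gE : EFin \o g = f by apply/funext => t; rewrite /= fineK.
have gint : mu.-integrable setT (EFin \o g) by rewrite gE.
have gloc : locally_integrable setT g by apply: open_integrable_locally => //; exact: openT.
(* Lebesgue differentiation of the primitive of the density, which equals [h1] up to a constant on
   the interval. *)
have : {ae mu, forall x : R, derivable (fun x : R => Rintegral mu `]-oo, x]%classic g) x 1 /\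
   derive1 (fun x : R => Rintegral mu `]-oo, x]%classic g) x = g x}.
  by apply: FTC1Ny => // y; apply: integrableS gint.
apply: negligibleS => t [/andP[t1 t2] nd] /= [d _]; apply: nd.
have E x : - m%:R < x < m%:R ->
    Rintegral mu `]-oo, x]%classic g = h1 x - h1 (- m%:R).
  move=> /andP[x1 x2]; rewrite /Rintegral -[X in integral _ _ X]/(EFin \o g) gE -fE//.
  rewrite -[X in fine X = _]/(nu1 (`]-oo, x]%classic `&` I)).
  rewrite (_ : _ `&` _ = `]- m%:R, x]%classic).
    by rewrite (stieltjes_ocitv h1 (ltW x1) : nu1 _ = _).
  apply/seteqP; split => s; rewrite /I /= !in_itv /=; first by case=> ->/andP[->].
  by move=> /andP[s1 s2]; rewrite s1 s2 (le_trans s2 (ltW x2)).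
have d' : derivable (fun x => h1 x - h1 (- m%:R)) t 1.
  apply: near_eq_derivable d => //.
  near=> x; apply: E; apply/andP; split.
    by near: x; exact: lt_nbhsr.
  by near: x; exact: lt_nbhsl.
rewrite (_ : (h1 : R -> R) = (fun x => h1 x - h1 (- m%:R)) + cst (h1 (- m%:R))).
  by apply: derivableD => //; exact: derivable_cst.
by apply/funext => x; rewrite !fctE subrK.
Unshelve. all: by end_near. Qed.

(** Division by [c] makes [g0] 1/2-Lipschitz, so that t/2 + g0 and t/2 - g0 are both nondecreasing
    and add up to t. *)
Lemma lipschitz_ae_derivable (g : R -> R) (K : R) :
  (forall x y, `|g x - g y| <= K * `|x - y|) ->
  mu.-negligible [set t | ~ derivable g t 1].
Proof.
move=> Kg.
pose c := 2 * (`|K| + 1).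
have c0 : 0 < c by rewrite mulr_gt0// ltr_wpDl.
pose g0 t := g t / c.
have g0L x y : `|g0 x - g0 y| <= `|x - y| / 2.
  rewrite /g0 -mulrBl normrM (gtr0_norm (_ : 0 < c^-1)) ?invr_gt0//.
  rewrite ler_pdivrMr//.
  have -> : `|x - y| / 2 * c = (`|K| + 1) * `|x - y| by rewrite /c; field.
  rewrite (le_trans (Kg _ _))//.
  by rewrite ler_wpM2r// (le_trans (ler_norm _))// lerDl.
pose h1 t := t / 2 + g0 t.
pose h2 t := t / 2 - g0 t.
have nd1 : nondecreasing h1.
  move=> x y xy; rewrite /h1 -subr_ge0 opprD addrACA -mulrBl.
  have := g0L y x; rewrite (ger0_norm (_ : 0 <= y - x)) ?subr_ge0// ler_norml.
  by case/andP => + _; rewrite -subr_ge0 opprK addrC.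
have nd2 : nondecreasing h2.
  move=> x y xy; rewrite /h2 -subr_ge0 opprD addrACA -mulrBl -opprD opprB.
  have := g0L y x; rewrite (ger0_norm (_ : 0 <= y - x)) ?subr_ge0// ler_norml.
  by case/andP => _; rewrite -subr_ge0 opprB.
have cg0 : continuous g0.
  by apply: (@lipschitz_continuousR _ 2^-1) => x y; rewrite mulrC.
have c1 : continuous h1.
  by move=> x; apply: cvgD; [apply: cvgMl; exact: cvg_id|exact: cg0].
have c2 : continuous h2.
  by move=> x; apply: cvgB; [apply: cvgMl; exact: cvg_id|exact: cg0].
pose H1 : cumulative R R := HB.pack h1
  (isCumulative.Build R _ R h1 nd1 (right_continuousW c1)).
pose H2 : cumulative R R := HB.pack h2
  (isCumulative.Build R _ R h2 nd2 (right_continuousW c2)).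
have h12 t : H1 t + H2 t = t.
  by rewrite /= /h1 /h2 addrACA subrr addr0 -splitr.
have := negligible_bigcup (fun m => @complementary_ae_derivable H1 H2 m h12 c1).
apply: negligibleS => t nd /=.
exists (Num.bound `|t|).+1 => //=; split.
  rewrite -ltr_norml; apply: lt_le_trans (Num.Theory.archi_boundP _) _ => //.
  by rewrite ler_nat.
move=> d; apply: nd.
rewrite (_ : g = (fun t => c * (H1 t - t / 2))).
  apply: derivableM; first exact: derivable_cst.
  by apply: derivableB => //; apply: derivableM; rewrite ?derivable_id ?derivable_cst.
apply/funext => x; rewrite /= /h1 addrAC subrr add0r /g0.
by rewrite mulrC divfK// gt_eqF.
Qed.

End Rademacher.

(** * Iterated integrals of Lipschitz functions with bounded support *)

Section BoxLipschitz.
Context {R : realType}.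
Notation mu := (@lebesgue_measure R).
Notation rint := (Rintegral mu setT).

Lemma coord_le_norm n (x : 'rV[R]_n) i : `|x ord0 i| <= `|x|.
Proof.
have /mapP[j Hj ->] : `|x ord0 i| \in [seq `|x y.1 y.2| | y : 'I_1 * 'I_n].
  by apply/mapP; exists (ord0, i) => //=; rewrite mem_enum.
by rewrite [leRHS]/Num.norm /= mx_normrE; apply/bigmax_geP; right => /=; exists j.
Qed.

Lemma rV_norm_leP n (x : 'rV[R]_n) b : 0 <= b ->
  (forall i, `|x ord0 i| <= b) -> `|x| <= b.
Proof.
move=> b0 h; rewrite [leLHS]/Num.norm /= mx_normrE; apply/bigmax_leP; split => //=.
by move=> [i j] _; rewrite /= ord1.
Qed.

Lemma row_mx_head n (t : R) (y : 'rV[R]_n) : row_mx t%:M y ord0 (lshift n ord0) = t.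
Proof. by rewrite row_mxEl mxE eqxx mulr1n. Qed.

Lemma row_mx_tail n (t : R) (y : 'rV[R]_n) j : row_mx (t%:M : 'M[R]_1) y ord0 (rshift 1 j) = y ord0 j.
Proof. by rewrite row_mxEr. Qed.

Lemma norm_row_mx n (t : R) (y : 'rV[R]_n) :
  `|row_mx t%:M y : 'rV_(1 + n)| = Num.max `|t| `|y|.
Proof.
apply/eqP; rewrite eq_le; apply/andP; split.
  apply: rV_norm_leP; first by rewrite le_max normr_ge0.
  move=> i; case: (splitP i) => j ij.
    by rewrite (_ : i = lshift n ord0) ?row_mx_head ?le_max ?lexx//; apply: val_inj; rewrite /= ij ord1.
  rewrite (_ : i = rshift 1 j) ?row_mx_tail; last exact: val_inj.
  by rewrite le_max coord_le_norm orbT.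
rewrite ge_max; apply/andP; split.
  by rewrite -{1}(row_mx_head t y) coord_le_norm.
by apply: rV_norm_leP => // j; rewrite -(row_mx_tail t) coord_le_norm.
Qed.

Lemma row_mx_add n (t s : R) (y z : 'rV[R]_n) :
  (row_mx t%:M y : 'rV_n.+1) + (row_mx s%:M z : 'rV_n.+1) = row_mx (t + s)%:M (y + z).
Proof. by rewrite raddfD; exact: (add_row_mx t%:M y s%:M z). Qed.

Lemma row_mx_sub n (t s : R) (y z : 'rV[R]_n) :
  (row_mx t%:M y : 'rV_n.+1) - (row_mx s%:M z : 'rV_n.+1) = row_mx (t - s)%:M (y - z).
Proof.
rewrite -row_mx_add; congr (_ + _).
by rewrite raddfN; exact: (opp_row_mx s%:M z).
Qed.

Lemma row_mx_eta n (x : 'rV[R]_n.+1) : row_mx (x ord0 ord0)%:M (\row_j x ord0 (rshift 1 j)) = x.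
Proof.
apply/rowP => i; case: (@splitP 1 n i) => j ij.
  rewrite (_ : i = lshift n ord0); last by apply: val_inj; rewrite /= ij ord1.
  by rewrite row_mx_head; congr (x _ _); apply: val_inj.
by rewrite (_ : i = rshift 1 j) ?row_mx_tail ?mxE; last exact: val_inj.
Qed.

Lemma lip_continuous n (f : 'rV[R]_n -> R) (L : R) : (forall x y, `|f x - f y| <= L * `|x - y|) -> continuous f.
Proof.
move=> hL x; apply/(@cvgrPdist_le _ _ _ (nbhs x) (nbhs_filter x) f (f x)) => e e0.
have L1 : 0 < `|L| + 1 by rewrite ltr_wpDl.
apply/nbhs_ballP; exists (e / (`|L| + 1)); first by rewrite /= divr_gt0.
move=> y; rewrite -ball_normE /= => xy.
rewrite (le_trans (hL _ _))// (@le_trans _ _ ((`|L| + 1) * `|x - y|))//.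
  by rewrite ler_wpM2r// (le_trans (ler_norm _))// lerDl.
by rewrite mulrC -ler_pdivlMr// ltW.
Qed.

(** The working class of integrands. The support is measured in the max norm because slices of a
    function supported in a box are supported in a box with the same [M]. *)
Definition LB n (M : R) (f : 'rV[R]_n -> R) :=
  (exists L, forall x y, `|f x - f y| <= L * `|x - y|) /\
  (forall x, M < `|x| -> f x = 0).

Lemma LBP n M (f : 'rV[R]_n -> R) : LB M f ->
  exists2 L, 0 <= L & forall x y, `|f x - f y| <= L * `|x - y|.
Proof.
move=> [[L hL] _]; exists `|L| => // x y; apply: le_trans (hL x y) _.
by rewrite ler_wpM2r// ler_norm.
Qed.

Lemma LB_bounded n M (f : 'rV[R]_n -> R) : LB M f ->
  exists2 C, 0 <= C & forall x, `|f x| <= C.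
Proof.
move=> fL; have [L L0 hL] := LBP fL; have [_ f0] := fL.
exists (`|f 0| + L * `|M|); first by rewrite addr_ge0// mulr_ge0.
move=> x; have [xM|xM] := leP `|x| M; last first.
  by rewrite f0// normr0 addr_ge0// mulr_ge0.
rewrite -{1}(subrK (f 0) (f x)) addrC (le_trans (ler_normD _ _))// lerD2l.
rewrite (le_trans (hL _ _))// subr0 ler_wpM2l// (le_trans xM)//; exact: ler_norm.
Qed.

Lemma LB_add n M (f g : 'rV[R]_n -> R) : LB M f -> LB M g -> LB M (fun x => f x + g x).
Proof.
move=> fL gL; have [L1 _ h1] := LBP fL; have [L2 _ h2] := LBP gL; split.
  exists (L1 + L2) => x y; rewrite opprD addrACA (le_trans (ler_normD _ _))//.
  by rewrite mulrDl lerD.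
by move=> x xM; rewrite fL.2// gL.2// addr0.
Qed.

Lemma LB_scale n M (f : 'rV[R]_n -> R) a : LB M f -> LB M (fun x => a * f x).
Proof.
move=> fL; have [L _ h] := LBP fL; split.
  by exists (`|a| * L) => x y; rewrite -mulrBr normrM -mulrA ler_wpM2l.
by move=> x xM; rewrite fL.2// mulr0.
Qed.

Lemma LB_opp n M (f : 'rV[R]_n -> R) : LB M f -> LB M (fun x => - f x).
Proof.
move=> fL; rewrite (_ : (fun _ => _) = (fun x => -1 * f x)); first exact: LB_scale.
by apply/funext => x; rewrite mulN1r.
Qed.

Lemma LB_sub n M (f g : 'rV[R]_n -> R) : LB M f -> LB M g -> LB M (fun x => f x - g x).
Proof. by move=> fL gL; apply: LB_add => //; exact: LB_opp. Qed.

Lemma LB0 n M : LB M (fun _ : 'rV[R]_n => 0).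
Proof. by split=> //; exists 0 => x y; rewrite subrr normr0 mul0r. Qed.

Lemma LB_sum n M (I : Type) (r : seq I) (f : I -> 'rV[R]_n -> R) :
  (forall i, LB M (f i)) -> LB M (fun x => \sum_(i <- r) f i x).
Proof.
move=> fL; elim: r => [|i r IH].
  rewrite (_ : (fun _ => _) = (fun _ => 0)); first exact: LB0.
  by apply/funext => x; rewrite big_nil.
rewrite (_ : (fun _ => _) = (fun x => f i x + \sum_(j <- r) f j x)).
  exact: LB_add.
by apply/funext => x; rewrite big_cons.
Qed.

Lemma LB_widen n M M' (f : 'rV[R]_n -> R) : M <= M' -> LB M f -> LB M' f.
Proof. by move=> MM [fL f0]; split => // x xM; apply: f0; exact: le_lt_trans xM. Qed.

(* A compactly supported factor only needs the other one to be bounded and Lipschitz on its support. *)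
Lemma LB_mul n M (f g : 'rV[R]_n -> R) (B L : R) : LB M f ->
  (forall x, `|x| <= M -> `|g x| <= B) ->
  (forall x y, `|x| <= M -> `|y| <= M -> `|g x - g y| <= L * `|x - y|) ->
  LB M (fun x => f x * g x).
Proof.
move=> fL gB gL; have [K K0 fK] := LBP fL; have [C C0 fC] := LB_bounded fL; split; last first.
  by move=> x xM; rewrite fL.2// mul0r.
exists (K * `|B| + C * `|L|) => x y.
have aux (p q : 'rV[R]_n) : `|p| <= M -> M < `|q| ->
    `|f p * g p - f q * g q| <= (K * `|B| + C * `|L|) * `|p - q|.
  move=> pM qM; rewrite (fL.2 q qM) mul0r subr0 normrM.
  apply: (@le_trans _ _ (K * `|B| * `|p - q|)); last first.
    by rewrite ler_wpM2r// lerDl mulr_ge0.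
  rewrite mulrAC ler_pM//.
    by have := fK p q; rewrite (fL.2 q qM) subr0.
  by rewrite (le_trans (gB _ pM))// ler_norm.
have [xM|xM] := leP `|x| M; have [yM|yM] := leP `|y| M.
- have -> : f x * g x - f y * g y = (f x - f y) * g x + f y * (g x - g y) by ring.
  rewrite (le_trans (ler_normD _ _))// !normrM [leRHS]mulrDl lerD//.
    by rewrite mulrAC ler_pM// (le_trans (gB _ xM))// ler_norm.
  rewrite -mulrA ler_pM// (le_trans (gL _ _ xM yM))// ler_wpM2r// ler_norm//.
- exact: aux.
- by rewrite distrC (distrC x y); exact: aux.
- by rewrite !fL.2// !mul0r subrr normr0 mulr_ge0// addr_ge0// mulr_ge0.
Qed.

Lemma LB_shift n M (f : 'rV[R]_n -> R) a : LB M f -> LB (M + `|a|) (fun x => f (x + a)).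
Proof.
move=> fL; have [L _ h] := LBP fL; split.
  by exists L => x y; rewrite (le_trans (h _ _))// opprD addrACA subrr addr0.
move=> x xM; apply: fL.2; rewrite -(ltrD2r `|a|); apply: lt_le_trans xM _.
by rewrite -{1}(addrK a x) (le_trans (ler_normB _ _)).
Qed.

Definition slice n (f : 'rV[R]_n.+1 -> R) (t : R) : 'rV[R]_n -> R :=
  fun y => f (row_mx t%:M y).

Lemma LB_slice n M (f : 'rV[R]_n.+1 -> R) t : LB M f -> LB M (slice f t).
Proof.
move=> fL; have [L _ h] := LBP fL; split; last first.
  by move=> y yM; apply: fL.2; rewrite norm_row_mx lt_max yM orbT.
exists L => y z; rewrite (le_trans (h _ _))// row_mx_sub subrr norm_row_mx normr0.
by rewrite max_r.
Qed.

Lemma slice_lip n (f : 'rV[R]_n.+1 -> R) L : (forall x y, `|f x - f y| <= L * `|x - y|) ->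
  forall t s y, `|slice f t y - slice f s y| <= L * `|t - s|.
Proof.
move=> fL t s y; rewrite (le_trans (fL _ _))// row_mx_sub subrr norm_row_mx normr0.
by rewrite max_l.
Qed.

Definition LB1 (M : R) (h : R -> R) :=
  (exists L, forall x y, `|h x - h y| <= L * `|x - y|) /\
  (forall x, M < `|x| -> h x = 0).

Lemma LB1_measurable M h : LB1 M h -> measurable_fun setT h.
Proof.
by move=> [[L hL] _]; apply: continuous_measurable_fun; exact: lipschitz_continuousR hL.
Qed.

Lemma LB1_integrable M h : LB1 M h -> mu.-integrable setT (EFin \o h).
Proof.
move=> hh; have mh := LB1_measurable hh; have [[L hL] h0] := hh.
apply: (@integrable_bounded_support _ _ M (`|h 0| + `|L| * `|M|)) => // x.
have [xM|xM] := leP `|x| M; last by rewrite h0// normr0 addr_ge0// mulr_ge0.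
rewrite -{1}(subrK (h 0) (h x)) addrC (le_trans (ler_normD _ _))// lerD2l.
rewrite (le_trans (hL _ _))// subr0 (@le_trans _ _ (`|L| * `|x|))//.
  by rewrite ler_wpM2r// ler_norm.
by rewrite ler_wpM2l// (le_trans xM)// ler_norm.
Qed.

Lemma measure_segment (a b : R) : a <= b -> mu (`[a, b]%classic : set R) = (b - a)%:E.
Proof.
move=> ab; rewrite lebesgue_measure_itv /= lte_fin; case: ltP => // ba.
by rewrite (_ : a = b) ?subrr//; apply/eqP; rewrite eq_le ab.
Qed.

Lemma rint_bound M C h : 0 <= M -> LB1 M h -> (forall t, `|h t| <= C) ->
  `|rint h| <= C * (2 * M).
Proof.
move=> M0 hh hC.
have ih := LB1_integrable hh.
have C0 : 0 <= C by rewrite (le_trans _ (hC 0)).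
rewrite (le_trans (le_normr_Rintegral _ ih))//.
rewrite -[leRHS](_ : Rintegral mu `[- M, M]%classic (fun=> C) = _); last first.
  rewrite Rintegral_cst//; congr (_ * _).
  have MM : - M <= M by lra.
  by apply: etrans (congr1 fine (measure_segment MM)) _; rewrite /=; ring.
rewrite [leRHS]Rintegral_mkcond; apply: le_Rintegral => //.
- exact: integrable_norm.
- rewrite -restrict_EFin; apply: ((@integrable_mkcond _ _ _ mu (`[- M, M]%classic : set R) (EFin \o cst C) _).1) => //.
  apply/integrableP; split; first exact: (measurable_cst (C%:E)).
  under eq_integral do rewrite /=.
  rewrite integral_cst//= lebesgue_measure_itv /=.
  by case: ifP => _; rewrite ?mule0// -EFinM ltry.
- move=> t _; rewrite patchE; case: ifPn => // /negP.
  rewrite inE /= in_itv /= -ler_norml => /negP; rewrite -ltNge => tM.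
  by rewrite hh.2// normr0.
Qed.

Lemma rintD M h1 h2 : LB1 M h1 -> LB1 M h2 ->
  rint (fun t => h1 t + h2 t) = rint h1 + rint h2.
Proof. by move=> /LB1_integrable i1 /LB1_integrable i2; exact: RintegralD. Qed.

Lemma rintZ M h a : LB1 M h -> rint (fun t => a * h t) = a * rint h.
Proof. by move=> /LB1_integrable i1; exact: RintegralZl. Qed.

Lemma rint_le M h1 h2 : LB1 M h1 -> LB1 M h2 -> (forall t, h1 t <= h2 t) ->
  rint h1 <= rint h2.
Proof. by move=> /LB1_integrable i1 /LB1_integrable i2 h; exact: le_Rintegral. Qed.

Lemma rint_gt0 M h t0 : LB1 M h -> (forall t, 0 <= h t) -> 0 < h t0 -> 0 < rint h.
Proof.
move=> hh h0 ht0; have [[L0 hL0] _] := hh.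
pose L := `|L0| + 1.
have L1 : 0 < L by rewrite ltr_wpDl.
have hL x y : `|h x - h y| <= L * `|x - y|.
  by rewrite (le_trans (hL0 _ _))// ler_wpM2r// (le_trans (ler_norm _))// lerDl.
(* Within [r] of [t0] the Lipschitz bound keeps [h] above half of [h t0]. *)
pose r := h t0 / 2 / L.
have r0 : 0 < r by rewrite !divr_gt0.
have lo t : `|t - t0| <= r -> h t0 / 2 <= h t.
  move=> tr; have := hL t t0; rewrite ler_norml => /andP[h1 _].
  have : L * `|t - t0| <= h t0 / 2 by rewrite mulrC -ler_pdivlMr.
  move: h1; lra.
have ih := LB1_integrable hh.
apply: (@lt_le_trans _ _ (Rintegral mu `[t0 - r, t0 + r]%classic (fun=> h t0 / 2))).
  have rr : t0 - r <= t0 + r by lra.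
  rewrite Rintegral_cst// (congr1 fine (measure_segment rr) : fine (mu _) = _) /=.
  by rewrite mulr_gt0 ?divr_gt0//; lra.
rewrite [leLHS]Rintegral_mkcond; apply: le_Rintegral => //.
- rewrite -restrict_EFin; apply: ((@integrable_mkcond _ _ _ mu (`[t0 - r, t0 + r]%classic : set R) (EFin \o cst (h t0 / 2)) _).1) => //.
  apply/integrableP; split; first exact: (measurable_cst ((h t0 / 2)%:E)).
  under eq_integral do rewrite /=.
  rewrite integral_cst//= lebesgue_measure_itv /=.
  by case: ifP => _; rewrite ?mule0// -EFinM ltry.
- move=> t _; rewrite patchE; case: ifPn => // tt.
  apply: lo; move: tt; rewrite inE /= in_itv /= => /andP[t1 t2].
  by rewrite ler_norml; apply/andP; split; lra.
Qed.

End BoxLipschitz.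

(** * Linearity, translation invariance and convergence of the iterated integral *)

Section IteratedIntegral.
Context {R : realType}.
Notation mu := (@lebesgue_measure R).
Notation rint := (Rintegral mu setT).

Lemma slice_ext n (f : 'rV[R]_n.+1 -> R) :
  ob_iint f = rint (fun t => ob_iint (slice f t)).
Proof. by []. Qed.

(* One induction: the slice function is Lipschitz because the integral is additive and bounded in lower dimension. *)
Lemma iint_facts n (M : R) : 0 <= M ->
  [/\ forall (f : 'rV[R]_n -> R) C, LB M f -> (forall x, `|f x| <= C) ->
        `|ob_iint f| <= C * (2 * M) ^+ n,
      forall f g : 'rV[R]_n -> R, LB M f -> LB M g ->
        ob_iint (fun x => f x + g x) = ob_iint f + ob_iint g &
      forall (f : 'rV[R]_n -> R) a, LB M f -> ob_iint (fun x => a * f x) = a * ob_iint f].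
Proof.
move=> M0; elim: n => [|n [bd add scl]].
  by split=> //= f C _ fC; rewrite expr0 mulr1.
have sl (f : 'rV[R]_n.+1 -> R) : LB M f -> LB1 M (fun t => ob_iint (slice f t)).
  move=> fL; have [L L0 hL] := LBP fL; split; last first.
    move=> t tM; apply/eqP; rewrite -normr_le0.
    have := bd (slice f t) 0 (LB_slice t fL); rewrite mul0r; apply => y.
    by rewrite /slice fL.2 ?normr0// norm_row_mx lt_max tM.
  exists (L * (2 * M) ^+ n) => t s.
  have -> : ob_iint (slice f t) - ob_iint (slice f s) =
      ob_iint (fun y => slice f t y + -1 * slice f s y).
    rewrite add ?scl ?mulN1r//; try exact: LB_slice.
    by apply: LB_scale; exact: LB_slice.
  rewrite mulrAC; apply: bd.
    by apply: LB_add; [exact: LB_slice|apply: LB_scale; exact: LB_slice].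
  by move=> y; rewrite mulN1r; exact: slice_lip.
split.
- move=> f C fL fC; rewrite slice_ext exprSr [leRHS]mulrA.
  refine (rint_bound M0 (sl _ fL) _).
  by move=> t; apply: bd; [exact: LB_slice|move=> y; exact: fC].
- move=> f g fL gL; rewrite !slice_ext -(rintD (sl _ fL) (sl _ gL)).
  by congr rint; apply/funext => t; rewrite -add//; exact: LB_slice.
- move=> f a fL; rewrite !slice_ext -(rintZ _ (sl _ fL)).
  by congr rint; apply/funext => t; rewrite -scl//; exact: LB_slice.
Qed.

Lemma iint_bound n (M C : R) (f : 'rV[R]_n -> R) : 0 <= M -> LB M f -> (forall x, `|f x| <= C) ->
  `|ob_iint f| <= C * (2 * M) ^+ n.
Proof. by move=> M0; have [h _ _] := iint_facts n M0; exact: h. Qed.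

Lemma iintD n (M : R) (f g : 'rV[R]_n -> R) : 0 <= M -> LB M f -> LB M g ->
  ob_iint (fun x => f x + g x) = ob_iint f + ob_iint g.
Proof. by move=> M0; have [_ h _] := iint_facts n M0; exact: h. Qed.

Lemma iintZ n (M : R) (f : 'rV[R]_n -> R) a : 0 <= M -> LB M f ->
  ob_iint (fun x => a * f x) = a * ob_iint f.
Proof. by move=> M0; have [_ _ h] := iint_facts n M0; exact: h. Qed.

Lemma iintB n (M : R) (f g : 'rV[R]_n -> R) : 0 <= M -> LB M f -> LB M g ->
  ob_iint (fun x => f x - g x) = ob_iint f - ob_iint g.
Proof.
move=> M0 fL gL; rewrite -[in RHS]mulN1r -(iintZ _ M0 gL) -(iintD M0 fL); last exact: LB_scale.
by congr ob_iint; apply/funext => x; rewrite mulN1r.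
Qed.

Lemma iint0 n : ob_iint (fun _ : 'rV[R]_n => 0) = 0.
Proof.
apply/eqP; rewrite -normr_le0.
have := @iint_bound n 0 0 _ (lexx _) (LB0 _ _); rewrite mul0r; apply => x.
by rewrite normr0.
Qed.

Lemma iint_sum n (M : R) (I : Type) (r : seq I) (f : I -> 'rV[R]_n -> R) : 0 <= M ->
  (forall i, LB M (f i)) ->
  ob_iint (fun x => \sum_(i <- r) f i x) = \sum_(i <- r) ob_iint (f i).
Proof.
move=> M0 fL; elim: r => [|i r IH].
  by rewrite big_nil; under eq_fun do rewrite big_nil; exact: iint0.
rewrite big_cons -IH -(iintD M0 (fL i)); last exact: LB_sum.
by congr ob_iint; apply/funext => x; rewrite big_cons.
Qed.

Lemma LB1_iint_slice n (M : R) (f : 'rV[R]_n.+1 -> R) : 0 <= M -> LB M f ->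
  LB1 M (fun t => ob_iint (slice f t)).
Proof.
move=> M0 fL; have [L L0 hL] := LBP fL; split; last first.
  move=> t tM; rewrite (_ : slice f t = fun=> 0); first exact: iint0.
  by apply/funext => y; rewrite /slice fL.2 ?normr0// norm_row_mx lt_max tM.
exists (L * (2 * M) ^+ n) => t s.
rewrite -(iintB M0 (LB_slice t fL) (LB_slice s fL)) mulrAC; apply: iint_bound => //.
  exact: LB_sub (LB_slice t fL) (LB_slice s fL).
by move=> y; exact: slice_lip.
Qed.

Lemma iint_le n (M : R) (f g : 'rV[R]_n -> R) : 0 <= M -> LB M f -> LB M g ->
  (forall x, f x <= g x) -> ob_iint f <= ob_iint g.
Proof.
move=> M0; elim: n f g => [|n IH] f g fL gL fg /=; first exact: fg.
apply: (rint_le (LB1_iint_slice M0 fL) (LB1_iint_slice M0 gL)) => t.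
by apply: IH => //; [exact: LB_slice..|move=> y; exact: fg].
Qed.

Lemma iint_shift n (M : R) (f : 'rV[R]_n -> R) a : 0 <= M -> LB M f ->
  ob_iint (fun x => f (x + a)) = ob_iint f.
Proof.
move=> M0; elim: n f a => [|n IH] f a fL /=.
  by congr f; apply/rowP => -[].
rewrite -(row_mx_eta a); set a0 := a _ _; set a' := \row_j _.
have sl := LB1_iint_slice M0 fL.
have [C _ hC] := LB_bounded fL.
rewrite -(@Rintegral_shift _ _ a0 M (C * (2 * M) ^+ n) (LB1_measurable sl) sl.2); last first.
  by move=> t; apply: iint_bound => //; [exact: LB_slice|move=> y; exact: hC].
congr rint; apply/funext => t; rewrite -(IH (slice f (t + a0)) a' (LB_slice _ fL)).
by congr ob_iint; apply/funext => y; rewrite /slice -row_mx_add.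
Qed.

Lemma iint_gt0 n (M : R) (f : 'rV[R]_n -> R) x0 : 0 <= M -> LB M f ->
  (forall x, 0 <= f x) -> 0 < f x0 -> 0 < ob_iint f.
Proof.
move=> M0; elim: n f x0 => [|n IH] f x0 fL f0 fx0 /=.
  by rewrite (_ : 0 = x0)//; apply/rowP => -[].
apply: (@rint_gt0 _ M _ (x0 ord0 ord0)); first exact: LB1_iint_slice.
  move=> t; rewrite -[leLHS](iint0 n); apply: (@iint_le _ M) => //; first exact: LB0.
  exact: LB_slice.
apply: (IH _ (\row_j x0 ord0 (rshift 1 j))) => //; first exact: LB_slice.
by rewrite /slice row_mx_eta.
Qed.

(* Null sets for the iterated integral: almost every slice is null. *)
Fixpoint Nul n : set 'rV[R]_n -> Prop :=
  match n with
  | 0 => fun E => ~ E 0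
  | k.+1 => fun E => mu.-negligible [set t : R | ~ Nul [set y : 'rV[R]_k | E (row_mx t%:M y)]]
  end.

Lemma NulS n (A B : set 'rV[R]_n) : A `<=` B -> Nul B -> Nul A.
Proof.
elim: n A B => [|n IH] A B AB /=; first by move=> h /AB.
by apply: negligibleS => t /=; apply: contra_not; apply: IH => y; exact: AB.
Qed.

Lemma NulU n (A B : set 'rV[R]_n) : Nul A -> Nul B -> Nul (A `|` B).
Proof.
elim: n A B => [|n IH] A B /=; first by move=> h1 h2 [].
move=> hA hB; apply: negligibleS (negligibleU hA hB) => t /= h.
by apply: contrapT => /not_orP[/contrapT h1 /contrapT h2]; apply: h; exact: IH h1 h2.
Qed.

Lemma Nul0 n : Nul (set0 : set 'rV[R]_n).
Proof.
elim: n => [|n IH] //=.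
by apply: negligibleS (negligible_set0 _) => t /= h; apply: h; exact: NulS IH.
Qed.

(** Only the [F k] are Lipschitz; the limit is arbitrary. The integrals of the slices are bounded by
    C (2 M)^n and converge for almost every slice by induction, which reduces the claim to dimension
    one. *)
Lemma iint_cvg n (M C : R) (F : nat -> 'rV[R]_n -> R) f : 0 <= M -> (forall k, LB M (F k)) ->
  (forall k x, `|F k x| <= C) -> Nul [set x | ~ (F ^~ x @ \oo --> f x)] ->
  (fun k => ob_iint (F k)) @ \oo --> ob_iint f.
Proof.
move=> M0; elim: n F f => [|n IH] F f FL FC /= hN; first exact: contrapT.
apply: (@Rintegral_cvg_ae _ _ _ M (C * (2 * M) ^+ n)).
- by move=> k; exact: LB1_measurable (LB1_iint_slice M0 (FL k)).
- by move=> k; exact: (LB1_iint_slice M0 (FL k)).2.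
- by move=> k t; apply: iint_bound => //; exact: LB_slice.
- apply: negligibleS hN => t /=; apply: contra_not => hN.
  by apply: IH => // k; exact: LB_slice.
Qed.

End IteratedIntegral.

(** * Null sets and Fubini's theorem for iterated integrals *)

Section NullSets.
Context {R : realType}.
Notation mu := (@lebesgue_measure R).
Notation TR := (measurableTypeR R).

Lemma ordS_case n (i : 'I_n.+1) : i = ord0 \/ exists j : 'I_n, i = rshift 1 j.
Proof.
by case: (unliftP ord0 i) => [j|] ->; [right; exists j; apply: val_inj|left].
Qed.

Lemma row_mx0E n t (y : 'rV[R]_n) : (row_mx t%:M y : 'rV_n.+1) ord0 ord0 = t.
Proof. by rewrite -[RHS](row_mx_head t y); congr (_ _ _); apply: val_inj. Qed.

Lemma rshift1_eq0 n (j : 'I_n) : ((rshift 1 j : 'I_n.+1) == ord0) = false.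
Proof. by []. Qed.

Definition coord_measurable n d (T : measurableType d) (f : T -> 'rV[R]_n) :=
  forall i, measurable_fun setT (fun t => f t ord0 i).

(* Joint measurability of a parametrized set, tested along measurable curves, so that row vectors need no sigma-algebra. *)
Definition pborel n d (T : measurableType d) (A : T -> set 'rV[R]_n) :=
  forall d' (T' : measurableType d') (p : T' -> T) (f : T' -> 'rV[R]_n),
    measurable_fun setT p -> coord_measurable f -> measurable [set t | A (p t) (f t)].

Lemma coord_measurable_row_mx n d (T : measurableType d) (a : T -> R) (f : T -> 'rV[R]_n) :
  measurable_fun setT a -> coord_measurable f ->
  coord_measurable (fun t => row_mx (a t)%:M (f t) : 'rV_n.+1).
Proof.
move=> ma mf i; case: (ordS_case i) => [->|[j ->]].
  by rewrite (_ : (fun _ => _) = a)//; apply/funext => t; rewrite row_mx0E.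
rewrite (_ : (fun _ => _) = (fun t => f t ord0 j)); first exact: mf.
by apply/funext => t; rewrite row_mx_tail.
Qed.

Lemma pborel_slice n d (T : measurableType d) (A : T -> set 'rV[R]_n.+1) :
  pborel A -> pborel (fun (p : T * TR) => [set y | A p.1 (row_mx p.2%:M y)]).
Proof.
move=> bA d' T' p f mp mf.
apply: (bA _ _ (fun t => (p t).1) (fun t => row_mx (p t).2%:M (f t))).
  by apply: measurableT_comp.
by apply: coord_measurable_row_mx => //; apply: (measurableT_comp (f := snd)).
Qed.

Lemma pborel_comp n d (T : measurableType d) d1 (T1 : measurableType d1)
    (A : T -> set 'rV[R]_n) (g : T1 -> T) :
  measurable_fun setT g -> pborel A -> pborel (fun t => A (g t)).
Proof. by move=> mg bA d' T' p f mp mf; apply: bA => //; exact: measurableT_comp. Qed.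

(** Being null is a condition on the measure of a section, and that measure depends measurably on
    the parameter. The induction runs over all parameter spaces, since slicing turns one coordinate
    into a parameter. *)
Lemma Nul_measurable n d (T : measurableType d) (A : T -> set 'rV[R]_n) :
  pborel A -> measurable [set t | Nul (A t)].
Proof.
elim: n d T A => [|n IH] d T A bA /=.
  rewrite (_ : [set t | ~ _] = ~` [set t | A t 0])//; apply: measurableC.
  by apply: (bA _ _ id (cst 0)) => // i; exact: measurable_cst.
pose B := ~` [set p : T * TR | Nul [set y | A p.1 (row_mx p.2%:M y)]].
have mB : measurable B by apply: measurableC; apply: IH; exact: pborel_slice.
have xB t : xsection B t = [set s : R | ~ Nul [set y | A t (row_mx s%:M y)]].
  by apply/seteqP; split => s; rewrite /xsection /= inE.
have mf := measurable_fun_xsection mu mB.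
rewrite (_ : [set t | _] = (mu \o xsection B) @^-1` [set 0%E]).
  by rewrite -[X in measurable X]setTI; apply: mf.
apply/seteqP; split => t /=; rewrite -xB; first by move/negligibleP; apply; exact: measurable_xsection.
by move=> h; apply/negligibleP => //; exact: measurable_xsection.
Qed.

(** Fubini: the set [B] of pairs (t, s) whose remaining slice is not null has null sections at each
    fixed s by induction, hence product measure 0, hence null sections at almost every fixed t. *)
Lemma Nul_slices n (A : TR -> set 'rV[R]_n) : pborel A ->
  (forall y, mu.-negligible [set t | A t y]) -> mu.-negligible [set t | ~ Nul (A t)].
Proof.
elim: n A => [|n IH] A bA nA /=.
  by apply: negligibleS (nA 0) => t /=; exact: contrapT.
pose B := ~` [set p : TR * TR | Nul [set y | A p.1 (row_mx p.2%:M y)]].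
have mB : measurable B by apply: measurableC; apply: Nul_measurable; exact: pborel_slice.
have xB t : xsection B t = [set s : R | ~ Nul [set y | A t (row_mx s%:M y)]].
  by apply/seteqP; split => s; rewrite /xsection /= inE.
have yB s : mu (ysection B s) = 0%E.
  apply/negligibleP; first exact: measurable_ysection.
  have : mu.-negligible [set t | ~ Nul [set y | A t (row_mx s%:M y)]].
    apply: IH => [|y]; last exact: nA.
    apply: (@pborel_comp _ _ _ _ _ (fun p : TR * TR => [set y | A p.1 (row_mx p.2%:M y)]) (fun t => (t, s))).
      exact: measurable_fun_pair.
    exact: pborel_slice.
  by apply: negligibleS => t; rewrite /ysection /= inE.
have B0 : ((mu \x mu) B = 0)%E.
  rewrite (@product_measure_unique _ _ _ _ _ mu mu (mu \x^ mu)%E) => //.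
    by apply: integral0_eq => s _; exact: yB.
  by move=> A1 A2 m1 m2; apply: product_measure2E.
have mf := measurable_fun_xsection mu mB.
have : ae_eq mu setT (mu \o xsection B) (cst 0%E).
  apply/ae_eq_integral_abs => //.
  by under eq_integral do rewrite /= gee0_abs ?measure_ge0//.
apply: negligibleS => t /= h /(_ Logic.I) h0; apply: h.
by rewrite -xB; apply/negligibleP => //; exact: measurable_xsection.
Qed.

Lemma ebasis_head n t (y : 'rV[R]_n) :
  (row_mx 0%:M y : 'rV_n.+1) + t *: ob_ebasis R ord0 = row_mx t%:M y.
Proof.
apply/rowP => i; case: (ordS_case i) => [->|[j ->]].
  by rewrite [LHS]mxE !row_mx0E [in X in _ + X]mxE [X in _ * X]mxE !eqxx mulr1 add0r.
by rewrite [LHS]mxE !row_mx_tail [in X in _ + X]mxE [X in _ * X]mxE rshift1_eq0 andbF mulr0 addr0.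
Qed.

Lemma ebasis_tail n t s (y : 'rV[R]_n) j :
  (row_mx s%:M y : 'rV_n.+1) + t *: ob_ebasis R (rshift 1 j) = row_mx s%:M (y + t *: ob_ebasis R j).
Proof.
apply/rowP => i; case: (ordS_case i) => [->|[k ->]].
  by rewrite [LHS]mxE !row_mx0E [in X in _ + X]mxE [X in _ * X]mxE andbF mulr0 addr0.
by rewrite [LHS]mxE !row_mx_tail !mxE (inj_eq (@rshift_inj _ _)).
Qed.

(** If [i] is the head coordinate, the lines run across the slices and [Nul_slices] applies;
    otherwise they lie inside the slices, each of which is null by induction. *)
Lemma Nul_lines n (E : set 'rV[R]_n) i : pborel (fun _ : TR => E) ->
  (forall x, mu.-negligible [set t : R | E (x + t *: ob_ebasis R i)]) -> Nul E.
Proof.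
elim: n E i => [|n IH] E i bE lE; first by case: i lE.
case: (ordS_case i) lE => [->|[j ->]] lE.
  apply: (@Nul_slices n (fun t : TR => [set y | E (row_mx t%:M y)])).
    apply: (@pborel_comp _ _ _ _ _ (fun p : TR * TR => [set y | E (row_mx p.2%:M y)]) (fun t => (t, t))).
      exact: measurable_fun_pair.
    exact: (pborel_slice bE).
  move=> y; apply: negligibleS (lE (row_mx 0%:M y)) => t /=.
  by rewrite ebasis_head.
rewrite /= (_ : [set t | _] = set0); first exact: negligible_set0.
rewrite -subset0 => t /=; apply; apply: (IH _ j).
  apply: (@pborel_comp _ _ _ _ _ (fun p : TR * TR => [set y | E (row_mx p.2%:M y)]) (fun _ => (t, t))).
    exact: measurable_cst.
  exact: (pborel_slice bE).
move=> y; apply: negligibleS (lE (row_mx t%:M y)) => s /=.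
by rewrite ebasis_tail.
Qed.

End NullSets.

(** * Directional Rademacher theorem in several variables *)

Section DerivabilityNull.
Context {R : realType}.
Notation mu := (@lebesgue_measure R).
Notation TR := (measurableTypeR R).

Lemma measurable_countable_forall d (T : measurableType d) (I : countType) (P : I -> T -> Prop) :
  (forall i, measurable [set t | P i t]) -> measurable [set t | forall i, P i t].
Proof.
move=> mP; rewrite (_ : [set t | _] = ~` (\bigcup_i ~` [set t | P i t])).
  by apply/measurableC/countable_bigcupT_measurable => // i; exact: measurableC.
by rewrite setC_bigcup; apply/seteqP; split => t /= h i; [move=> _; rewrite setCK; exact: h|
  have := h i Logic.I; rewrite setCK].
Qed.

Lemma measurable_countable_exists d (T : measurableType d) (I : countType) (P : I -> T -> Prop) :
  (forall i, measurable [set t | P i t]) -> measurable [set t | exists i, P i t].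
Proof.
move=> mP; rewrite (_ : [set t | _] = \bigcup_i [set t | P i t]).
  by apply/countable_bigcupT_measurable => // i; exact: measurableC.
by apply/seteqP; split => t /= [i]; exists i.
Qed.

Lemma rat_row_approx n (x : 'rV[R]_n) e : 0 < e ->
  exists q : 'rV[rat]_n, forall i, `|x ord0 i - ratr (q ord0 i)| < e.
Proof.
move=> e0.
have h (i : 'I_n) : exists q : rat, `|x ord0 i - ratr q| < e.
  have /rat_in_itvoo[q] : x ord0 i < x ord0 i + e by rewrite ltrDl.
  rewrite in_itv /= => /andP[q1 q2]; exists q.
  by rewrite ltr_norml; apply/andP; split; lra.
have [f hf] := choice h.
by exists (\row_i f i) => i; rewrite mxE.
Qed.

Lemma norm_le_sum n (x : 'rV[R]_n) : `|x| <= \sum_i `|x ord0 i|.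
Proof.
apply: rV_norm_leP => [|i]; first exact: sumr_ge0.
by rewrite (bigD1 i)//= lerDl sumr_ge0.
Qed.

(** A Lipschitz function is the infimum of cones with rational vertices, so {u o f < a} is a
    countable union of sets described by the coordinates of [f]. *)
Lemma lipschitz_coord_measurable n d (T : measurableType d) (u : 'rV[R]_n -> R) L (f : T -> 'rV[R]_n) :
  (forall x y, `|u x - u y| <= L * `|x - y|) -> coord_measurable f ->
  measurable_fun setT (fun t => u (f t)).
Proof.
move=> uL mf.
pose K := `|L|.
have K0 : 0 <= K by exact: normr_ge0.
have uK x y : `|u x - u y| <= K * \sum_i `|x ord0 i - y ord0 i|.
  apply: (le_trans (uL _ _)); apply: (@le_trans _ _ (K * `|x - y|)).
    by rewrite ler_wpM2r// ler_norm.
  apply: ler_wpM2l => //. apply: le_trans (norm_le_sum _) _.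
  by apply: ler_sum => i _; rewrite !mxE.
apply: (measurability _ (RGenInftyO.measurableE R)) => // _ [_ [a ->] <-].
rewrite setTI.
pose g (q : 'rV[rat]_n) t := u (map_mx ratr q) + K * \sum_i `|f t ord0 i - ratr (q ord0 i)|.
rewrite (_ : _ @^-1` _ = [set t | exists q, g q t < a]).
  apply: measurable_countable_exists => q.
  rewrite (_ : [set t | _] = setT `&` (g q @^-1` `]-oo, a[%classic)); last first.
    by rewrite setTI; apply/seteqP; split => t /=; rewrite in_itv.
  have mg : measurable_fun setT (g q).
    apply: measurable_funD => //; apply: measurable_funM => //.
    apply: measurable_sum => i; apply: measurableT_comp => //.
    by apply: measurable_funB => //; exact: mf.
  exact: mg.
apply/seteqP; split => t /=; rewrite in_itv /=; last first.
  move=> [q]; apply: le_lt_trans; rewrite /g -lerBlDl.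
  apply: le_trans (ler_norm _) _; apply: le_trans (uK _ _) _.
  by apply: ler_wpM2l => //; apply: ler_sum => i _; rewrite mxE.
move=> ua.
(* A vertex within [e] of [f t] in each coordinate costs at most 2 K n e = (a - u (f t)) - e, so its
   cone is below [a] at [f t]. *)
pose e := (a - u (f t)) / (2 * K * n%:R + 1).
have D0 : 0 < 2 * K * n%:R + 1 by rewrite ltr_wpDl// mulr_ge0// mulr_ge0.
have e0 : 0 < e by rewrite divr_gt0// subr_gt0.
have [q hq] := rat_row_approx (f t) e0; exists q.
have S : \sum_i `|f t ord0 i - ratr (q ord0 i)| <= n%:R * e.
  have -> : n%:R * e = \sum_(i < n) e by rewrite sumr_const card_ord mulr_natl.
  by apply: ler_sum => i _; exact: ltW.
have h1 : u (map_mx ratr q) <= u (f t) + K * \sum_i `|f t ord0 i - ratr (q ord0 i)|.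
  rewrite -lerBlDl (le_trans (ler_norm _))// distrC (le_trans (uK _ _))//.
  by apply: ler_wpM2l => //; apply: ler_sum => i _; rewrite mxE.
have h2 : K * \sum_i `|f t ord0 i - ratr (q ord0 i)| <= K * (n%:R * e) by rewrite ler_wpM2l.
have h3 : e * (2 * K * n%:R + 1) = a - u (f t) by rewrite divfK// gt_eqF.
rewrite /g; move: h1 h2 h3 e0; set S' := K * \sum_i _; nra.
Qed.

Lemma inv_nat_lt (e : R) : 0 < e -> exists m : nat, m.+1%:R^-1 < e.
Proof.
move=> e0; exists (Num.bound e^-1); rewrite invf_plt ?posrE//.
apply: lt_le_trans (Num.Theory.archi_boundP _) _; first by rewrite invr_ge0 ltW.
by rewrite ler_nat.
Qed.

Lemma near_rat (P : R -> Prop) (h : R) : (\forall x \near h, P x) -> exists q : rat, P (ratr q).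
Proof.
move=> /nbhs_ballP[e /= e0 he].
have /rat_in_itvoo[q] : h < h + e by rewrite ltrDl.
rewrite in_itv /= => /andP[q1 q2]; exists q; apply: he.
by rewrite /ball /= ltr_norml; apply/andP; split; lra.
Qed.

Definition dquot n (u : 'rV[R]_n -> R) (v x : 'rV[R]_n) (h : R) := h^-1 * (u (h *: v + x) - u x).

(** Cauchy's criterion for difference quotients with countable quantifiers, which is what makes the
    set of differentiability points measurable. Continuity of the quotient away from step 0 extends
    the bound from rational to real steps. *)
Lemma derivable_ratP n (u : 'rV[R]_n -> R) L (v x : 'rV[R]_n) :
  (forall x y, `|u x - u y| <= L * `|x - y|) ->
  derivable u x v <->
  forall k : nat, exists m : nat, exists r : rat, forall q : rat,
    0 < `|ratr q : R| < m.+1%:R^-1 -> `|dquot u v x (ratr q) - ratr r| <= k.+1%:R^-1.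
Proof.
move=> uL; split.
  move=> /cvg_ex[d hd] k.
  pose e : R := k.+1%:R^-1 / 2.
  have e0 : 0 < e by rewrite divr_gt0.
  have /rat_in_itvoo[r] : d < d + e by rewrite ltrDl.
  rewrite in_itv /= => /andP[r1 r2].
  move/cvgrPdist_le: hd => /(_ e e0) [del /= del0 hdel].
  have [m hm] : exists m : nat, m.+1%:R^-1 < del by exact: inv_nat_lt.
  exists m, r => q /andP[q0 qm].
  have : `|d - dquot u v x (ratr q)| <= e.
    apply: hdel => /=; first by rewrite sub0r normrN (lt_trans qm).
    by rewrite -normr_gt0.
  rewrite !ler_norml => /andP[h1 h2]; apply/andP.
  have ek : k.+1%:R^-1 = e + e by rewrite /e -splitr.
  by rewrite ek; clearbody e; clear ek; split; lra.
move=> G; apply/cauchy_cvgP/cauchyP => e e0.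
have [k hk] : exists k : nat, k.+1%:R^-1 < e by exact: inv_nat_lt.
have [m [r hr]] := G k; exists (ratr r).
exists m.+1%:R^-1; first by rewrite /= invr_gt0.
move=> h /=; rewrite sub0r normrN => hm h0.
rewrite /ball /= distrC; apply: le_lt_trans hk.
rewrite leNgt; apply/negP => gt.
have [q] : exists q : rat, (0 < `|ratr q : R| < m.+1%:R^-1 /\ k.+1%:R^-1 < `|dquot u v x (ratr q) - ratr r|).
  apply: (@near_rat (fun y => 0 < `|y| < m.+1%:R^-1 /\ k.+1%:R^-1 < `|dquot u v x y - ratr r|) h).
  have c1 : {for h, continuous (fun y : R => `|y|)} by apply: cvg_norm; exact: cvg_id.
  have c2 : {for h, continuous (fun y : R => `|dquot u v x y - ratr r|)}.
    apply: cvg_norm; apply: cvgB; last exact: cvg_cst.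
    apply: cvgM; first by apply: cvgV => //; exact: cvg_id.
    apply: cvgB; last exact: cvg_cst.
    apply: (@lipschitz_continuousR _ (fun y => u (y *: v + x)) (L * `|v|)) => y z.
    rewrite (le_trans (uL _ _))// opprD addrACA subrr addr0 -scalerBl normrZ.
    by rewrite -mulrA [_ * `|y - z|]mulrC.
  near=> y; split; [apply/andP; split|].
  - by near: y; apply: (cvgr_gt _ c1); rewrite normr_gt0.
  - by near: y; apply: (cvgr_lt _ c1).
  - by near: y; apply: (cvgr_gt _ c2).
by case=> /hr; rewrite leNgt => /negP.
Unshelve. all: by end_near.
Qed.

Lemma pborel_nonderivable n (u : 'rV[R]_n -> R) L v :
  (forall x y, `|u x - u y| <= L * `|x - y|) ->
  pborel (fun _ : TR => [set x | ~ derivable u x v]).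
Proof.
move=> uL d' T' p f _ mf.
rewrite (_ : [set t | _] = ~` [set t | derivable u (f t) v])//; apply: measurableC.
rewrite (_ : [set t | _] = [set t | forall k : nat, exists m : nat, exists r : rat, forall q : rat,
    0 < `|ratr q : R| < m.+1%:R^-1 -> `|dquot u v (f t) (ratr q) - ratr r| <= k.+1%:R^-1]); last first.
  by apply/seteqP; split => t /= /(derivable_ratP _ _ uL).
apply: measurable_countable_forall => k.
apply: measurable_countable_exists => m.
apply: measurable_countable_exists => r.
apply: measurable_countable_forall => q.
have [hq|hq] := boolP (0 < `|ratr q : R| < m.+1%:R^-1); last first.
  by rewrite (_ : [set t | _] = setT)//; apply/seteqP; split.
rewrite (_ : [set t | _] = setT `&` (fun t => `|dquot u v (f t) (ratr q) - ratr r|) @^-1` `]-oo, k.+1%:R^-1]%classic).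
  have mg : measurable_fun setT (fun t => `|dquot u v (f t) (ratr q) - ratr r|).
    apply: measurableT_comp => //; apply: measurable_funB => //; apply: measurable_funM => //.
    apply: measurable_funB; last exact: lipschitz_coord_measurable uL mf.
    apply: (lipschitz_coord_measurable uL) => i.
    rewrite (_ : (fun _ => _) = (fun t => ratr q * v ord0 i + f t ord0 i)).
      by apply: measurable_funD => //; exact: mf.
    by apply/funext => t; rewrite !mxE.
  exact: mg.
rewrite setTI; apply/seteqP; split => t /=; rewrite in_itv /=; first exact.
by move=> h _.
Qed.

(** On each line parallel to the [i]-th axis the one-dimensional theorem applies, and [Nul_lines]
    collects the lines. *)
Lemma Nul_nonderivable n (u : 'rV[R]_n -> R) L i :
  (forall x y, `|u x - u y| <= L * `|x - y|) ->
  Nul [set x | ~ derivable u x (ob_ebasis R i)].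
Proof.
move=> uL; apply: (@Nul_lines _ _ _ i); first exact: pborel_nonderivable uL.
move=> x; set v := ob_ebasis R i.
pose g (t : R) := u (x + t *: v).
have gL s t : `|g s - g t| <= (L * `|v|) * `|s - t|.
  rewrite /g (le_trans (uL _ _))// opprD addrACA subrr add0r -scalerBl normrZ.
  by rewrite -mulrA [_ * `|s - t|]mulrC.
apply: negligibleS (lipschitz_ae_derivable gL) => t /=; apply: contra_not.
rewrite /derivable (_ : (fun h => _) = (fun h : R => h^-1 *: ((u \o shift (x + t *: v)) (h *: v) - u (x + t *: v))))//.
apply/funext => h; rewrite /= /g; congr (_ *: (u _ - _)).
by rewrite /= scalerDl addrCA [h *: 1]mulr1.
Qed.

End DerivabilityNull.

(** * Smooth radial bumps *)

Section Bump.
Context {R : realType}.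
Implicit Types (p : {poly R}) (s t : R).

(** The profile exp(-1/s) with a polynomial in 1/s in front: a family closed under differentiation,
    so that estimates proved for all [p] also bound the derivatives of the bump with [p] = 1. *)
Definition bumpf p s : R := if 0 < s then p.[s^-1] * expR (- s^-1) else 0.

(* [bumpf p] has derivative [bumpf (bumpd p)]. *)
Definition bumpd p : {poly R} := (p - deriv p) * 'X^2.

(** The exponential dominates the term x^k / k! of its series. *)
Lemma expn_expRN_bounded k (x : R) : 0 <= x -> x ^+ k * expR (- x) <= k`!%:R.
Proof.
move=> x0; rewrite expRN ler_pdivrMr ?expR_gt0//.
case: k => [|k]; first by rewrite expr0 mul1r -expR0 ler_expR.
rewrite mulrC -ler_pdivrMr ?ltr0n ?fact_gt0//.
by rewrite (le_trans _ (expR_ge1Dxn k x0))// lerDr.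
Qed.

Lemma horner_expRN_bounded p : exists2 C, 0 <= C & forall x, 0 <= x -> `|p.[x] * expR (- x)| <= C.
Proof.
exists (\sum_(i < size p) `|p`_i| * i`!%:R); first by apply: sumr_ge0 => i _; rewrite mulr_ge0.
move=> x x0; rewrite horner_coef mulr_suml (le_trans (ler_norm_sum _ _ _))//.
apply: ler_sum => i _; rewrite -mulrA normrM ler_wpM2l//.
by rewrite ger0_norm ?expn_expRN_bounded// mulr_ge0 ?exprn_ge0// expR_ge0.
Qed.

Lemma bumpf_bounded p : exists2 C, 0 <= C & forall s, `|bumpf p s| <= C.
Proof.
have [C C0 hC] := horner_expRN_bounded p; exists C => // s; rewrite /bumpf.
by case: ifP => [s0|_]; [rewrite hC// invr_ge0 ltW|rewrite normr0].
Qed.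

Lemma bumpf_le0 p s : s <= 0 -> bumpf p s = 0.
Proof. by move=> s0; rewrite /bumpf ltNge s0. Qed.

Lemma is_derive_bumpf p s : is_derive s 1 (bumpf p) (bumpf (bumpd p) s).
Proof.
have [s0|s0|->] := ltgtP s 0.
- rewrite bumpf_le0 ?(ltW s0)//; apply: (@near_eq_is_derive _ _ _ (cst 0)) => //.
  near=> y; rewrite /= bumpf_le0// ltW//; near: y; exact: lt_nbhsl.
- apply: (@near_eq_is_derive _ _ _ ((horner p \o @GRing.inv R) * (expR \o (fun x : R => - x^-1)))) => //.
    by near=> y; rewrite /bumpf ifT//; near: y; exact: lt_nbhsr.
  have sN : s != 0 by rewrite gt_eqF.
  have di : is_derive s 1 (@GRing.inv R) (- s ^- 2).
    by apply: is_derive_eq; [exact: (@is_deriveV _ id s 1 1)|rewrite /= [_ *: _]mulr1].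
  have d1 : is_derive s 1 (horner p \o @GRing.inv R) ((deriv p).[s^-1] * (- s ^- 2)).
    exact: is_derive1_comp.
  have d2 : is_derive s 1 (fun x : R => - x^-1) (s ^- 2).
    by rewrite -[s ^- 2]opprK; exact: is_deriveN.
  have d3 : is_derive s 1 (expR \o (fun x : R => - x^-1)) (expR (- s^-1) * s ^- 2).
    exact: is_derive1_comp.
  apply: (is_derive_eq (is_deriveM d1 d3)).
  rewrite /bumpf s0 /bumpd /= hornerM hornerXn hornerD hornerN.
  rewrite /GRing.scale /= exprVn; ring.
(* At 0 the difference quotient for a step h > 0 is h times [bumpf (p * 'X^2) h], whose second
   factor is bounded. *)
have [C C0 hC] := bumpf_bounded (p * 'X ^+ 2).
have h0 : bumpf p 0 = 0 by rewrite bumpf_le0.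
have lim0 : (fun h : R => h^-1 *: ((bumpf p \o shift (0 : R)) (h *: 1) - bumpf p 0)) @ 0^' --> (0 : R).
  apply/cvgrPdist_le => e e0; near=> h.
  rewrite /= h0 subr0 addr0 sub0r normrN [h *: 1]mulr1.
  have [hle|hgt] := leP h 0; first by rewrite bumpf_le0// scaler0 normr0 ltW.
  have -> : h^-1 *: bumpf p h = h * bumpf (p * 'X^2) h.
    rewrite /bumpf hgt hornerM hornerXn /GRing.scale /= exprVn; field.
    by rewrite gt_eqF.
  rewrite normrM (@le_trans _ _ (`|h| * (C + 1)))//.
    by rewrite ler_wpM2l// (le_trans (hC h))// lerDl.
  rewrite -ler_pdivlMr ?ltr_wpDl//; near: h; apply: dnbhs0_le. by rewrite divr_gt0// ltr_wpDl.
apply: DeriveDef; first by apply/cvg_ex; exists 0.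
by rewrite bumpf_le0//; apply: cvg_lim.
Unshelve. all: by end_near.
Qed.

Lemma is_derive_lip (f df : R -> R) (C : R) : (forall x : R, is_derive x 1 f (df x)) ->
  (forall x, `|df x| <= C) -> forall x y : R, `|f x - f y| <= C * `|x - y|.
Proof.
move=> fd dC x y.
wlog xy : x y / x <= y.
  by move=> W; have [/W//|/ltW/W] := leP x y; rewrite distrC (distrC x).
have cf : {within `[x, y], continuous f}.
  apply: continuous_subspaceT => z; apply/differentiable_continuous/derivable1_diffP.
  by case: (fd z).
have [c _ E] := MVT_segment xy (fun z _ => fd z) cf.
by rewrite distrC E normrM distrC ler_wpM2r.
Qed.

Lemma bumpf_lip p : exists2 L, 0 <= L & forall x y, `|bumpf p x - bumpf p y| <= L * `|x - y|.
Proof.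
have [C C0 hC] := bumpf_bounded (bumpd p); exists C => //.
by apply: is_derive_lip hC; exact: is_derive_bumpf.
Qed.

Lemma taylor1 (h h' : R -> R) (C t : R) : 0 <= t -> (forall s : R, is_derive s 1 h (h' s)) ->
  (forall s, 0 <= s <= t -> `|h' s - h' 0| <= C * s) -> `|h t - h 0 - t * h' 0| <= C * t ^+ 2.
Proof.
move=> t0 hd hC.
have [->|tN] := eqVneq t 0; first by rewrite subrr mul0r subr0 normr0 expr0n mulr0.
have tp : 0 < t by rewrite lt_def tN.
have ch : {within `[0, t], continuous h}.
  apply: continuous_subspaceT => z; apply/differentiable_continuous/derivable1_diffP.
  by case: (hd z).
have [c] := MVT tp (fun z _ => hd z) ch.
rewrite in_itv /= subr0 => /andP[c0 ct] ->.
have C0 : 0 <= C.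
  by have := hC t; rewrite t0 lexx => /(_ isT); move/(le_trans (normr_ge0 _)); rewrite pmulr_lge0.
rewrite [h' c * t]mulrC -mulrBr normrM (ger0_norm t0) expr2 mulrCA ler_wpM2l//.
by rewrite (le_trans (hC _ _))//; [rewrite !ltW|rewrite ler_wpM2l// ltW].
Qed.

(** The mean value theorem is used for [g] on [0, t] and then for [h1] on [-c, c]. The second use
    leaves [h2 xi - h2 0] with [xi] of either sign, whence the hypothesis for all |s| <= t. *)
Lemma taylor2 (h h1 h2 : R -> R) (C t : R) : 0 <= t -> 
  (forall s : R, is_derive s 1 h (h1 s)) -> (forall s : R, is_derive s 1 h1 (h2 s)) ->
  (forall s, `|s| <= t -> `|h2 s - h2 0| <= C * t) ->
  `|h t + h (- t) - 2 * h 0 - t ^+ 2 * h2 0| <= 2 * C * t ^+ 3.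
Proof.
move=> t0 d1 d2 hC.
pose g s := h s + h (- s) - 2 * h 0 - s ^+ 2 * h2 0.
pose g1 s := h1 s - h1 (- s) - 2 * s * h2 0.
have gd s : is_derive s 1 g (g1 s).
  have dm : is_derive s 1 (fun x : R => h (- x)) (h1 (- s) * - 1).
    exact: (@is_derive1_comp _ h (fun x : R => - x)).
  have dx : is_derive s 1 (fun x : R => x ^+ 2) (2 * s).
    by apply: is_derive_eq; rewrite /GRing.scale /=; ring.
  have dq : is_derive s 1 (fun x : R => x ^+ 2 * h2 0) (2 * s * h2 0).
    by apply: is_derive_eq; rewrite /GRing.scale /=; ring.
  rewrite /g /g1; apply: is_derive_eq.
  ring.
have [->|tN] := eqVneq t 0.
  by rewrite oppr0 !expr0n /= !mulr0 mul0r subr0 -mulr2n mulr_natl subrr normr0.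
have tp : 0 < t by rewrite lt_def tN.
have cg : {within `[0, t], continuous g}.
  apply: continuous_subspaceT => z; apply/differentiable_continuous/derivable1_diffP.
  by case: (gd z).
have [c] := MVT tp (fun z _ => gd z) cg.
rewrite in_itv /= subr0 => /andP[c0 ct].
have g0 : g 0 = 0 by rewrite /g oppr0 expr0n /= mul0r subr0 -mulr2n mulr_natl subrr.
rewrite g0 subr0 -/(g t) => ->.
have cc : - c < c by lra.
have ch1 : {within `[- c, c], continuous h1}.
  apply: continuous_subspaceT => z; apply/differentiable_continuous/derivable1_diffP.
  by case: (d2 z).
have [xi] := MVT cc (fun z _ => d2 z) ch1.
rewrite in_itv /= => /andP[x1 x2] E.
have -> : g1 c = 2 * c * (h2 xi - h2 0) by rewrite /g1 E; ring.
rewrite !normrM (gtr0_norm c0) (gtr0_norm tp) (_ : `|2| = 2)//.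
have DC : `|h2 xi - h2 0| <= C * t by apply: hC; rewrite ler_norml; apply/andP; split; lra.
move: DC; set D := `|_|; have D0 : 0 <= D by exact: normr_ge0.
move=> DC.
have h3 : c * D <= t * (C * t) by apply: ler_pM => //; exact: ltW.
rewrite exprS; nra.
by rewrite ger0_norm.
Qed.

End Bump.

(** * Radial bumps in several variables and their second-order expansions *)

Section BumpN.
Context {R : realType} {n : nat}.
Implicit Types (p : {poly R}) (x y z v : 'rV[R]_n) (e s t : R).

Definition dot x y : R := \sum_i x ord0 i * y ord0 i.
Definition sqn x : R := \sum_i x ord0 i ^+ 2.

Lemma dotxx x : dot x x = sqn x.
Proof. by apply: eq_bigr => i _; rewrite expr2. Qed.

Lemma dotC x y : dot x y = dot y x.
Proof. by apply: eq_bigr => i _; rewrite mulrC. Qed.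

Lemma dotDl x y z : dot (x + y) z = dot x z + dot y z.
Proof. by rewrite -big_split; apply: eq_bigr => i _; rewrite mxE mulrDl. Qed.

Lemma dotZl a x y : dot (a *: x) y = a * dot x y.
Proof. by rewrite mulr_sumr; apply: eq_bigr => i _; rewrite mxE mulrA. Qed.

Lemma dotDr x y z : dot x (y + z) = dot x y + dot x z.
Proof. by rewrite dotC dotDl !(dotC x). Qed.

Lemma dotZr a x y : dot x (a *: y) = a * dot x y.
Proof. by rewrite dotC dotZl dotC. Qed.

Lemma dotNl x y : dot (- x) y = - dot x y.
Proof. by rewrite -scaleN1r dotZl mulN1r. Qed.

Lemma dotNr x y : dot x (- y) = - dot x y.
Proof. by rewrite dotC dotNl dotC. Qed.

Lemma sqn_ge0 x : 0 <= sqn x.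
Proof. by apply: sumr_ge0 => i _; exact: sqr_ge0. Qed.

Lemma sqn_line z t v : sqn (z + t *: v) = sqn z + 2 * t * dot z v + t ^+ 2 * sqn v.
Proof. by rewrite -!dotxx !dotDl !dotDr !dotZl !dotZr (dotC v z); ring. Qed.

Lemma enorm_sqn x : ob_enorm x = Num.sqrt (sqn x).
Proof. by []. Qed.

Lemma sqr_coord_le_sqn x i : x ord0 i ^+ 2 <= sqn x.
Proof. by rewrite /sqn (bigD1 i)//= lerDl sumr_ge0// => j _; exact: sqr_ge0. Qed.

Lemma norm_gt_sqn x e : 0 <= e -> e < `|x| -> e ^+ 2 < sqn x.
Proof.
move=> e0; apply: contraTT; rewrite -!leNgt => h.
apply: rV_norm_leP => // i.
have := le_trans (sqr_coord_le_sqn x i) h.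
by rewrite -[x _ _ ^+ 2]real_normK ?num_real// ler_pXn2r ?nnegrE.
Qed.

Lemma is_derive_line (f : 'rV[R]_n -> R) z v t df :
  is_derive (z + t *: v) v f df <-> is_derive t 1 (fun s : R => f (z + s *: v)) df.
Proof.
have E : (fun h : R => h^-1 *: ((f \o shift (z + t *: v)) (h *: v) - f (z + t *: v))) =
  (fun h : R => h^-1 *: (((fun s : R => f (z + s *: v)) \o shift t) (h *: 1) - f (z + t *: v))).
  apply/funext => h /=; congr (_ *: (f _ - _)).
  by rewrite [h *: 1]mulr1 scalerDl addrCA.
split=> -[d1 d2]; apply: DeriveDef; rewrite /derivable /derive.
- by rewrite -E.
- by rewrite -E.
- by rewrite E.
- by rewrite E.
Qed.

Definition bumpN p e z := bumpf p (e ^+ 2 - sqn z).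

Lemma is_derive_bumpN_line p e z v t :
  is_derive t 1 (fun s : R => bumpN p e (z + s *: v))
    (- 2 * dot (z + t *: v) v * bumpN (bumpd p) e (z + t *: v)).
Proof.
pose q s := e ^+ 2 - (sqn z + 2 * s * dot z v + s ^+ 2 * sqn v).
have dq : is_derive t 1 q (- (2 * dot z v + 2 * t * sqn v)).
  rewrite /q; apply: is_derive_eq; rewrite /GRing.scale /=; ring.
have -> : (fun s : R => bumpN p e (z + s *: v)) = bumpf p \o q.
  by apply/funext => s /=; rewrite /bumpN sqn_line.
apply: (is_derive_eq (is_derive1_comp (is_derive_bumpf p (q t)) dq)).
rewrite /bumpN sqn_line -/(q t) dotDl dotZl dotxx; ring.
Qed.

Lemma is_derive_bumpN p e z v :
  is_derive z v (bumpN p e) (- 2 * dot z v * bumpN (bumpd p) e z).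
Proof.
have := is_derive_bumpN_line p e z v 0; rewrite -is_derive_line.
by rewrite scale0r addr0.
Qed.

(* The second derivative of [bumpN p e] in the direction [v]. *)
Definition theta p e v z :=
  4 * dot z v ^+ 2 * bumpN (bumpd (bumpd p)) e z - 2 * sqn v * bumpN (bumpd p) e z.

Lemma is_derive_theta_line p e z v t :
  is_derive t 1 (fun s : R => - 2 * dot (z + s *: v) v * bumpN (bumpd p) e (z + s *: v))
    (theta p e v (z + t *: v)).
Proof.
have d1 := is_derive_bumpN_line (bumpd p) e z v t.
have d2 : is_derive t 1 (fun s : R => - 2 * dot (z + s *: v) v) (- 2 * sqn v).
  rewrite (_ : (fun _ => _) = (fun s => -2 * (dot z v + s * sqn v))); last first.
    by apply/funext => s; rewrite dotDl dotZl dotxx.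
  by apply: is_derive_eq; rewrite /GRing.scale /=; ring.
apply: (is_derive_eq (is_deriveM d2 d1)).
by rewrite /theta /GRing.scale /=; ring.
Qed.

(* Clipping the coordinates at [e] makes the squared norm globally Lipschitz without changing the bump. *)
Lemma bumpN_LB p e : 0 < e -> LB e (bumpN p e).
Proof.
move=> e0; split; last first.
  by move=> x /(norm_gt_sqn (ltW e0)) xe; rewrite /bumpN bumpf_le0// subr_le0 ltW.
pose c (a : R) := Num.min `|a| e.
have cL a b : `|c a ^+ 2 - c b ^+ 2| <= 2 * e * `|a - b|.
  have c0 a' : 0 <= c a' by rewrite le_min normr_ge0 ltW.
  have ce a' : c a' <= e by rewrite ge_min lexx orbT.
  rewrite subr_sqr normrM mulrC ler_pM//.
    by rewrite ger0_norm ?addr_ge0//; have := ce a; have := ce b; lra.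
  apply: le_trans (ler_dist_dist a b).
  have h1 := ler_norm (`|a| - `|b|).
  have h2 := ler_norm (`|b| - `|a|); rewrite distrC in h2.
  rewrite /c /Num.min ler_norml.
  by case: ltP => h3; case: ltP => h4; apply/andP; split; lra.
pose Q x := \sum_i c (x ord0 i) ^+ 2.
have QE x : bumpN p e x = bumpf p (e ^+ 2 - Q x).
  rewrite /bumpN; have [xe|xe] := leP `|x| e.
    congr bumpf; congr (_ - _); apply: eq_bigr => i _.
    by rewrite /c min_l ?real_normK ?num_real// (le_trans (coord_le_norm _ _)).
  rewrite !bumpf_le0// subr_le0; last first.
    by rewrite ltW// norm_gt_sqn// ltW.
  have [i hi] : exists i, e < `|x ord0 i|.
    apply: contrapT => /forallNP h; move: xe; rewrite ltNge => /negP; apply.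
    by apply: rV_norm_leP => [|i]; [exact: ltW|rewrite leNgt; apply/negP].
  rewrite /Q (bigD1 i)//= /c (min_r (ltW hi)) lerDl sumr_ge0// => j _; exact: sqr_ge0.
have [L L0 hL] := bumpf_lip p.
exists (L * (n%:R * (2 * e))) => x y; rewrite !QE (le_trans (hL _ _))// -mulrA ler_wpM2l//.
rewrite opprB addrC addrA subrK /Q -sumrB (le_trans (ler_norm_sum _ _ _))//.
rewrite -mulrA -[n%:R * _](_ : \sum_(i < n) (2 * e * `|y - x|) = _); last first.
  by rewrite sumr_const card_ord -[LHS]mulr_natl distrC.
apply: ler_sum => i _; rewrite (le_trans (cL _ _))// ler_wpM2l//; first lra.
by rewrite distrC; have := coord_le_norm (y - x) i; rewrite !mxE distrC.
Qed.

Lemma dot_bound M z v : `|z| <= M -> `|dot z v| <= M * \sum_i `|v ord0 i|.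
Proof.
move=> zM; rewrite (le_trans (ler_norm_sum _ _ _))// mulr_sumr; apply: ler_sum => i _.
by rewrite normrM ler_wpM2r// (le_trans (coord_le_norm _ _)).
Qed.

Lemma LB_mul_dot M v (f : 'rV[R]_n -> R) : LB M f -> LB M (fun x => f x * dot x v).
Proof.
move=> fL; apply: (@LB_mul _ _ _ _ _ (M * \sum_i `|v ord0 i|) (\sum_i `|v ord0 i|) fL) => [x xM|x y _ _].
  exact: dot_bound xM.
by rewrite -[- dot y v]dotNl -dotDl mulrC; apply: dot_bound.
Qed.

Lemma theta_LB p e v : 0 < e -> LB e (theta p e v).
Proof.
move=> e0.
rewrite (_ : theta p e v = (fun z => 4 * (bumpN (bumpd (bumpd p)) e z * dot z v * dot z v)
   - 2 * sqn v * bumpN (bumpd p) e z)).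
  apply: LB_sub; apply: LB_scale; last exact: bumpN_LB.
  by do 2 apply: LB_mul_dot; exact: bumpN_LB.
by apply/funext => z; rewrite /theta; ring.
Qed.

Lemma grad_LB p e v : 0 < e -> LB e (fun z => - 2 * dot z v * bumpN (bumpd p) e z).
Proof.
move=> e0; rewrite (_ : (fun _ => _) = (fun z => - 2 * (bumpN (bumpd p) e z * dot z v))).
  by apply/LB_scale/LB_mul_dot/bumpN_LB.
by apply/funext => z; ring.
Qed.

Lemma bumpN_taylor2 p e v : 0 < e -> exists2 C, 0 <= C & forall z t, 0 <= t ->
  `|bumpN p e (z + t *: v) + bumpN p e (z - t *: v) - 2 * bumpN p e z
     - t ^+ 2 * theta p e v z| <= C * t ^+ 3.
Proof.
move=> e0; have [L L0 hL] := LBP (theta_LB p v e0).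
exists (2 * (L * `|v|)); first by rewrite !mulr_ge0.
move=> z t t0.
have := @taylor2 _ (fun s => bumpN p e (z + s *: v)) _ (fun s => theta p e v (z + s *: v)) (L * `|v|) t t0
  (is_derive_bumpN_line p e z v) (is_derive_theta_line p e z v).
rewrite !scale0r !addr0 scaleNr; apply => s st.
rewrite (le_trans (hL _ _))// addrAC subrr add0r normrZ -mulrA ler_wpM2l// mulrC ler_wpM2l//.
Qed.

(** The step is backwards because translation turns a forward difference of [w] into a backward one
    of the test function. Half of the constant is the Taylor error at [z'], half the cost of
    replacing [theta] at [z'] by [theta] at [z]. *)
Lemma grad_taylor1 p e v : 0 < e -> exists2 C, 0 <= C & forall z t, 0 <= t ->
  `|- 2 * dot (z - t *: v) v * bumpN (bumpd p) e (z - t *: v)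
    - (- 2 * dot z v * bumpN (bumpd p) e z) + t * theta p e v z| <= C * t ^+ 2.
Proof.
move=> e0; have [L L0 hL] := LBP (theta_LB p v e0).
exists (2 * (L * `|v|)); first by rewrite !mulr_ge0.
move=> z t t0; set z' := z - t *: v.
have zE : z' + t *: v = z by rewrite subrK.
have h1 : `|(- 2 * dot (z' + t *: v) v * bumpN (bumpd p) e (z' + t *: v))
   - (- 2 * dot (z' + 0 *: v) v * bumpN (bumpd p) e (z' + 0 *: v)) - t * theta p e v (z' + 0 *: v)|
    <= (L * `|v|) * t ^+ 2.
  apply: (@taylor1 _ (fun s => - 2 * dot (z' + s *: v) v * bumpN (bumpd p) e (z' + s *: v))
    (fun s => theta p e v (z' + s *: v)) (L * `|v|) t t0 (is_derive_theta_line p e z' v)).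
  move=> s /andP[s0 st]; rewrite scale0r addr0 (le_trans (hL _ _))// addrAC subrr add0r normrZ.
  by rewrite (ger0_norm s0) -mulrA (mulrC s).
rewrite zE scale0r addr0 in h1.
have h2 : `|theta p e v z - theta p e v z'| <= L * `|v| * t.
  by rewrite (le_trans (hL _ _))// /z' opprB addrCA subrr addr0 normrZ (ger0_norm t0) mulrAC mulrA.
have h3 : `|t * (theta p e v z - theta p e v z')| <= L * `|v| * t ^+ 2.
  rewrite normrM (ger0_norm t0) (le_trans (ler_wpM2l t0 h2))// expr2; lra.
move: h1 h3; rewrite !ler_norml => /andP[a1 a2] /andP[a3 a4]; apply/andP; split; lra.
Qed.

(* The Laplacian of [bumpN p e]. *)
Definition lapbump p e z :=
  4 * sqn z * bumpN (bumpd (bumpd p)) e z - 2 * n%:R * bumpN (bumpd p) e z.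

(** Unit length and Parseval's identity are the two facts that turn the sum of second derivatives
    along [V] into the Laplacian of a radial bump; both pass easily to reflected frames. *)
Definition orthoframe (V : 'I_n -> 'rV[R]_n) :=
  (forall i, sqn (V i) = 1) /\ (forall z, \sum_i dot z (V i) ^+ 2 = sqn z).

Lemma sum_theta p e V z : orthoframe V -> \sum_i theta p e (V i) z = lapbump p e z.
Proof.
move=> [V1 V2]; rewrite /theta sumrB /lapbump -V2; congr (_ - _).
  by rewrite mulr_sumr mulr_suml.
rewrite (eq_bigr (fun _ => 2 * bumpN (bumpd p) e z)).
  by rewrite sumr_const card_ord -[in LHS]mulr_natl; ring.
by move=> i _; rewrite V1 mulr1.
Qed.

Lemma dot_ebasis z i : dot z (ob_ebasis R i) = z ord0 i.
Proof.
rewrite /dot (bigD1 i)//= mxE !eqxx mulr1 big1 ?addr0// => j ji.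
by rewrite mxE (negbTE ji) andbF mulr0.
Qed.

Lemma ebasis_frame : orthoframe (@ob_ebasis R n).
Proof.
split=> [i|z]; first by rewrite -dotxx dot_ebasis mxE !eqxx.
by apply: eq_bigr => i _; rewrite dot_ebasis.
Qed.

End BumpN.

(** * Bumps are admissible test functions *)

Section BumpTest.
Context {R : realType} {n : nat}.
Implicit Types (p : {poly R}) (x y z v : 'rV[R]_n) (e s t : R).

Lemma LB_continuous M (f : 'rV[R]_n -> R) : LB M f -> continuous f.
Proof. by move=> [[L hL] _]; exact: lip_continuous hL. Qed.

Lemma is_derive_shift_arg (f : 'rV[R]_n -> R) x0 x v df :
  is_derive (x - x0) v f df -> is_derive x v (fun y => f (y - x0)) df.
Proof.
have E : (fun h : R => h^-1 *: (((fun y => f (y - x0)) \o shift x) (h *: v) - f (x - x0))) =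
  (fun h : R => h^-1 *: ((f \o shift (x - x0)) (h *: v) - f (x - x0))).
  by apply/funext => h /=; rewrite addrA.
by move=> [d1 d2]; apply: DeriveDef; rewrite /derivable /derive E.
Qed.

(** A class of continuous functions that contains the bumps and is closed under partial derivatives;
    smoothness follows by induction on the list of derivatives. *)
Inductive bump_alg e (x0 : 'rV[R]_n) : ('rV[R]_n -> R) -> Prop :=
| BA_bump p : bump_alg e x0 (fun x => bumpN p e (x - x0))
| BA_coord i f : bump_alg e x0 f -> bump_alg e x0 (fun x => (x - x0) ord0 i * f x)
| BA_scale a f : bump_alg e x0 f -> bump_alg e x0 (fun x => a * f x)
| BA_add f g : bump_alg e x0 f -> bump_alg e x0 g -> bump_alg e x0 (fun x => f x + g x).

Lemma coord_sub_continuous x0 i : continuous (fun y : 'rV[R]_n => (y - x0) ord0 i).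
Proof.
have -> : (fun y : 'rV[R]_n => (y - x0) ord0 i) = (fun y : 'rV_n => y ord0 i - x0 ord0 i).
  by apply/funext => y; rewrite !mxE.
move=> x; have h := @coord_continuous R 1 n ord0 i x.
by apply: (@cvgB _ _ _ (nbhs x)); [exact: h|exact: cvg_cst].
Qed.

Lemma bump_alg_continuous e x0 f : 0 < e -> bump_alg e x0 f -> continuous f.
Proof.
move=> e0; elim=> {f} [p|i f _ IH|a f _ IH|f g _ IHf _ IHg] x.
- by apply: LB_continuous; exact: (LB_shift (- x0) (bumpN_LB p e0)).
- by apply: (@cvgM _ _ (nbhs x)); [have h := @coord_sub_continuous x0 i x; exact: h|exact: IH].
- by apply: (@cvgM _ _ (nbhs x)); [exact: cvg_cst|exact: IH].
- by apply: (@cvgD _ _ _ (nbhs x)); [exact: IHf|exact: IHg].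
Qed.

Lemma is_derive_coord x0 x i j :
  is_derive x (ob_ebasis R j) (fun y : 'rV[R]_n => (y - x0) ord0 i) (i == j)%:R.
Proof.
apply: (@is_derive_shift_arg (fun y : 'rV[R]_n => y ord0 i)); rewrite -[x - x0](_ : (x - x0) + 0 *: ob_ebasis R j = _); last first.
  by rewrite scale0r addr0.
apply/is_derive_line.
rewrite (_ : (fun s : R => _) = (fun s : R => (x - x0) ord0 i + s * (i == j)%:R)).
  by apply: is_derive_eq; rewrite /GRing.scale /=; ring.
by apply/funext => s; rewrite !mxE.
Qed.

Lemma bump_alg_derive e x0 f j : bump_alg e x0 f ->
  exists2 g, bump_alg e x0 g & forall x, is_derive x (ob_ebasis R j) f (g x).
Proof.
elim=> {f} [p|i f fB [g gB gd]|a f fB [g gB gd]|f1 f2 _ [g1 g1B d1] _ [g2 g2B d2]].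
- exists (fun x => -2 * ((x - x0) ord0 j * bumpN (bumpd p) e (x - x0))).
    by apply/BA_scale/BA_coord/BA_bump.
  move=> x; have := is_derive_bumpN p e (x - x0) (ob_ebasis R j).
  by rewrite dot_ebasis -mulrA; exact: is_derive_shift_arg.
- exists (fun x => (i == j)%:R * f x + (x - x0) ord0 i * g x).
    by apply: BA_add; [exact: BA_scale|exact: BA_coord].
  move=> x; apply: (is_derive_eq (is_deriveM (is_derive_coord x0 x i j) (gd x))).
  by rewrite /GRing.scale /=; ring.
- exists (fun x => a * g x); first exact: BA_scale.
  by move=> x; apply: is_deriveZ.
- exists (fun x => g1 x + g2 x); first exact: BA_add.
  by move=> x; apply: is_deriveD.
Qed.

Lemma bump_alg_smooth e x0 f : 0 < e -> bump_alg e x0 f -> ob_smooth f.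
Proof.
move=> e0 fB s.
suff h : bump_alg e x0 (ob_iter_partial s f).
  split; first exact: bump_alg_continuous h.
  by move=> x i; have [g _ gd] := bump_alg_derive i h; case: (gd x).
elim: s => [|i s IH] //=.
have [g gB gd] := bump_alg_derive i IH.
rewrite (_ : ob_partial i _ = g)//.
by apply/funext => x; rewrite /ob_partial; case: (gd x).
Qed.

Lemma sqn_continuous : continuous (@sqn R n).
Proof.
suff h (r : seq 'I_n) : continuous (fun x : 'rV[R]_n => \sum_(i <- r) x ord0 i ^+ 2) by exact: h.
elim: r => [|i r IH].
  rewrite (_ : (fun _ => _) = cst 0); first by exact: cst_continuous.
  by apply/funext => x; rewrite big_nil.
rewrite (_ : (fun _ => _) = (fun x : 'rV[R]_n => x ord0 i * x ord0 i + \sum_(j <- r) x ord0 j ^+ 2)).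
  move=> x; have h := @coord_continuous R 1 n ord0 i x.
  by apply: (@cvgD _ _ _ (nbhs x)); [apply: (@cvgM _ _ (nbhs x)); exact: h|exact: IH].
by apply/funext => x; rewrite big_cons expr2.
Qed.

Definition eball x0 e := [set x | sqn (x - x0) <= e ^+ 2].

Lemma eball_norm x0 e x : 0 <= e -> eball x0 e x -> `|x - x0| <= e.
Proof.
move=> e0; rewrite /eball /= => h; rewrite leNgt; apply/negP => /(norm_gt_sqn e0).
by rewrite ltNge h.
Qed.

Lemma eball_compact x0 e : 0 <= e -> compact (eball x0 e).
Proof.
move=> e0; apply: bounded_closed_compact.
  exists (`|x0| + e); split; first exact: num_real.
  move=> M hM x /(eball_norm e0) h; apply: le_trans (ltW hM).
  by rewrite -[x](subrK x0) addrC (le_trans (ler_normD _ _))// lerD2l.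
rewrite (_ : eball x0 e = (fun x => sqn (x - x0)) @^-1` [set y | y <= e ^+ 2])//.
apply: closed_comp; last exact: closed_le.
move=> x _; apply: (@continuous_comp _ _ _ (fun y => y - x0) (@sqn R n)).
  by apply: (@cvgB _ _ _ (nbhs x)); [exact: cvg_id|exact: cst_continuous].
exact: sqn_continuous.
Qed.

Lemma bumpN_test_fun (O : set 'rV[R]_n) p e x0 : 0 < e -> eball x0 e `<=` O ->
  ob_test_fun O (fun x => bumpN p e (x - x0)).
Proof.
move=> e0 sub; split; first by apply: (bump_alg_smooth e0); exact: BA_bump.
exists (eball x0 e); split; [exact: eball_compact (ltW e0)|split => //].
move=> x /negP; rewrite -ltNge => h.
by rewrite /bumpN bumpf_le0// subr_le0 ltW.
Qed.

Lemma partial_bumpN p e x0 i : ob_partial i (fun x => bumpN p e (x - x0)) =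
  fun x => - 2 * dot (x - x0) (ob_ebasis R i) * bumpN (bumpd p) e (x - x0).
Proof.
apply/funext => x; rewrite /ob_partial.
by case: (is_derive_shift_arg (is_derive_bumpN p e (x - x0) (ob_ebasis R i))).
Qed.

End BumpTest.

(** * The energy tested against a bump *)

Section Energy.
Context {R : realType} {n : nat}.
Implicit Types (p : {poly R}) (x y z v : 'rV[R]_n) (e s t : R).

Lemma LB_mul_lip M L (f w : 'rV[R]_n -> R) : LB M f ->
  (forall x y, `|w x - w y| <= L * `|x - y|) -> LB M (fun x => f x * w x).
Proof.
move=> fL wL; apply: (@LB_mul _ _ _ _ _ (`|w 0| + `|L| * `|M|) L fL) => [x xM|x y _ _]; last exact: wL.
rewrite -{1}(subrK (w 0) (w x)) addrC (le_trans (ler_normD _ _))// lerD2l.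
rewrite (le_trans (wL _ _))// subr0 (@le_trans _ _ (`|L| * `|x|))//.
  by rewrite ler_wpM2r// ler_norm.
by rewrite ler_wpM2l// (le_trans xM)// ler_norm.
Qed.

(** [B] depends on [w] and the box but not on [f], so a uniform error in a test function keeps its
    order after integration against [w]. *)
Lemma iint_mul_lip_bound M L (w : 'rV[R]_n -> R) : 0 <= M ->
  (forall x y, `|w x - w y| <= L * `|x - y|) ->
  exists2 B, 0 <= B & forall (f : 'rV[R]_n -> R) C, LB M f -> (forall x, `|f x| <= C) ->
    `|ob_iint (fun x => f x * w x)| <= C * B.
Proof.
move=> M0 wL; exists ((`|w 0| + `|L| * M) * (2 * M) ^+ n).
  by rewrite mulr_ge0 ?exprn_ge0 ?addr_ge0 ?mulr_ge0.
move=> f C fL fC; rewrite mulrA; apply: iint_bound => //; first exact: LB_mul_lip wL.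
have C0 : 0 <= C by rewrite (le_trans _ (fC 0)).
move=> x; have [xM|xM] := leP `|x| M; last first.
  by rewrite fL.2// mul0r normr0 mulr_ge0// addr_ge0// mulr_ge0.
rewrite normrM ler_pM// -{1}(subrK (w 0) (w x)) addrC (le_trans (ler_normD _ _))// lerD2l.
rewrite (le_trans (wL _ _))// subr0 (@le_trans _ _ (`|L| * `|x|))//.
  by rewrite ler_wpM2r// ler_norm.
by rewrite ler_wpM2l.
Qed.

Lemma Nul_exists (A : 'I_n -> set 'rV[R]_n) : (forall i, Nul (A i)) -> Nul [set x | exists i, A i x].
Proof.
move=> hA.
suff h (r : seq 'I_n) : Nul [set x | exists2 i, i \in r & A i x].
  by apply: NulS (h (enum 'I_n)) => x /= [i Aix]; exists i => //; rewrite mem_enum.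
elim: r => [|i r IH]; first by apply: NulS (Nul0 n) => x /= [].
apply: NulS (NulU (hA i) IH) => x /= [j]; rewrite inE => /predU1P[->|jr] Aj; first by left.
by right; exists j.
Qed.

Lemma lip_diff_LB M L (f w : 'rV[R]_n -> R) a : LB M f ->
  (forall x y, `|w x - w y| <= L * `|x - y|) -> LB M (fun x => f x * (w (x + a) - w x)).
Proof.
move=> fL wL; rewrite (_ : (fun _ => _) = (fun x => f x * w (x + a) - f x * w x)).
  apply: LB_sub; last exact: LB_mul_lip wL.
  apply: (@LB_mul_lip _ L) => // x y; rewrite (le_trans (wL _ _))// opprD addrACA subrr addr0//.
by apply/funext => x; rewrite mulrBr.
Qed.

Lemma cvg_sum_seq (I : Type) (r : seq I) (f : I -> nat -> R) (l : I -> R) :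
  (forall i, f i @ \oo --> l i) -> (fun k => \sum_(i <- r) f i k) @ \oo --> \sum_(i <- r) l i.
Proof.
move=> h; elim: r => [|i r IH].
  by rewrite big_nil; under eq_fun do rewrite big_nil; exact: cvg_cst.
rewrite big_cons; under eq_fun do rewrite big_cons.
by apply: cvgD.
Qed.

(* Discrete integration by parts: difference quotients of [w] are moved to the bump by translation invariance, and only then is the limit taken. *)
Lemma energy_bump (u w sg : 'rV[R]_n -> R) (c L e : R) p x0 : 0 < e ->
  (forall x y, `|w x - w y| <= L * `|x - y|) ->
  (forall i, Nul [set x | ~ ((fun k : nat => c * (k.+1%:R * (w (x + k.+1%:R^-1 *: ob_ebasis R i) - w x)))
      @ \oo --> sg x * ob_partial i u x)]) ->
  ob_energy sg u (fun x => bumpN p e (x - x0)) =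
    - c * ob_iint (fun y => lapbump p e (y - x0) * w y).
Proof.
move=> e0 wL hN.
(* Room for the bump, its centre and all shifts by at most one basis vector: one box serves every
   [k]. *)
pose M := e + `|- x0| + \sum_i `|ob_ebasis R (i : 'I_n)|.
have S0 : 0 <= \sum_i `|ob_ebasis R (i : 'I_n)| by exact: sumr_ge0.
have M0 : 0 <= M by rewrite !addr_ge0// ltW.
pose G i x := - 2 * dot (x - x0) (ob_ebasis R i) * bumpN (bumpd p) e (x - x0).
pose T i x := theta p e (ob_ebasis R i) (x - x0).
have GL' i : LB (e + `|- x0|) (G i) by exact: (LB_shift (- x0) (grad_LB p (ob_ebasis R i) e0)).
have GL i : LB M (G i) by apply: LB_widen (GL' i); rewrite lerDl.
have TL i : LB M (T i).
  apply: LB_widen (LB_shift (- x0) (theta_LB p (ob_ebasis R i) e0)); by rewrite lerDl.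
pose a (k : nat) i : 'rV[R]_n := k.+1%:R^-1 *: ob_ebasis R i.
have k0 (k : nat) : 0 < k.+1%:R :> R by rewrite ltr0n.
have kV0 (k : nat) : 0 <= k.+1%:R^-1 :> R by rewrite invr_ge0 ltW.
have aM k i : e + `|- x0| + `|- a k i| <= M.
  rewrite lerD2l normrN normrZ (ger0_norm (kV0 k)).
  rewrite (bigD1 i)//=; apply: (@le_trans _ _ `|ob_ebasis R i|); last by rewrite lerDl sumr_ge0.
  by rewrite ler_piMl// invf_le1// ler1n.
have GaL k i : LB M (fun x => G i (x - a k i)).
  by apply: LB_widen (aM k i) (LB_shift (- a k i) (GL' i)).
pose F k x := \sum_i (c * k.+1%:R) * (G i x * (w (x + a k i) - w x)).
have FL k : LB M (F k).
  by apply: LB_sum => i; apply: LB_scale; exact: lip_diff_LB wL.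
have exCg i : exists C : R, 0 <= C /\ forall x, `|G i x| <= C.
  by have [C C0 hC] := LB_bounded (GL i); exists C.
have [Cg hCg] := choice exCg.
(* The Lipschitz functions [F k] converge almost everywhere to the energy integrand and are
   dominated through the Lipschitz constant of [w]. *)
have cvgF : (fun k => ob_iint (F k)) @ \oo --> ob_energy sg u (fun x => bumpN p e (x - x0)).
  rewrite /ob_energy.
  apply: (@iint_cvg _ _ M (\sum_i (`|c| * (Cg i * (`|L| * `|ob_ebasis R i|))))) => //.
    move=> k x; rewrite (le_trans (ler_norm_sum _ _ _))//; apply: ler_sum => i _.
    rewrite normrM [`|c * _|]normrM (ger0_norm (ltW (k0 k))) normrM -mulrA ler_wpM2l//.
    rewrite mulrCA; apply: ler_pM => //; first exact: (hCg i).2.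
    rewrite mulrC -ler_pdivlMr// (le_trans (wL _ _))// addrAC subrr add0r normrZ.
    rewrite (ger0_norm (kV0 k)) -mulrA [_^-1 * _]mulrC; apply: ler_wpM2r; last exact: ler_norm.
    by rewrite mulr_ge0.
  apply: NulS (Nul_exists hN) => x /= h; apply: contrapT => /forallNP nE; apply: h.
  rewrite mulr_sumr; under eq_bigr => i _ do rewrite partial_bumpN -/(G i x) mulrA mulrC.
  rewrite /F; apply: cvg_sum_seq => i.
  have /contrapT h := nE i.
  rewrite (_ : (fun k : nat => _) = (fun k : nat => G i x * (c * (k.+1%:R * (w (x + a k i) - w x))))).
    by apply: cvgMr; exact: h.
  by apply/funext => k; ring.
have [B B0 hB] := iint_mul_lip_bound M0 wL.
have exCt i : exists C : R, 0 <= C /\ forall z t, 0 <= t ->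
   `|- 2 * dot (z - t *: ob_ebasis R i) (ob_ebasis R i) * bumpN (bumpd p) e (z - t *: ob_ebasis R i)
    - (- 2 * dot z (ob_ebasis R i) * bumpN (bumpd p) e z) + t * theta p e (ob_ebasis R i) z| <= C * t ^+ 2.
  by have [C C0 hC] := grad_taylor1 p (ob_ebasis R i) e0; exists C.
have [Ct hCt] := choice exCt.
(* For fixed [k], translation by [a k i] moves the difference quotient from [w] to [G i] exactly. *)
have EF k : ob_iint (F k) = \sum_i c * ob_iint (fun x => (k.+1%:R * (G i (x - a k i) - G i x)) * w x).
  rewrite (iint_sum _ M0); last by move=> i; apply: LB_scale; exact: lip_diff_LB wL.
  apply: eq_bigr => i _.
  rewrite (iintZ _ M0); last exact: lip_diff_LB wL.
  rewrite -mulrA; congr (_ * _).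
  have L1 : LB M (fun x => G i (x - a k i) * w x) by exact: LB_mul_lip wL.
  have L2 : LB M (fun x => G i x * w x) by exact: LB_mul_lip wL.
  have L3 : LB M (fun x => G i x * w (x + a k i)).
    apply: (@LB_mul_lip _ L) => // x y; rewrite (le_trans (wL _ _))// opprD addrACA subrr addr0//.
  have -> : ob_iint (fun x => G i x * (w (x + a k i) - w x)) =
      ob_iint (fun x => G i x * w (x + a k i)) - ob_iint (fun x => G i x * w x).
    rewrite -(iintB M0 L3 L2); congr ob_iint; apply/funext => x; exact: mulrBr.
  have -> : ob_iint (fun x => G i x * w (x + a k i)) = ob_iint (fun x => G i (x - a k i) * w x).
    rewrite -(iint_shift (a k i) M0 L1); congr ob_iint; apply/funext => x; by rewrite addrK.
  rewrite -(iintB M0 L1 L2) -(iintZ _ M0); last exact: LB_sub.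
  by congr ob_iint; apply/funext => x; ring.
have EL : ob_iint (fun y => lapbump p e (y - x0) * w y) = \sum_i ob_iint (fun x => T i x * w x).
  rewrite -(iint_sum _ M0); last by move=> i; exact: LB_mul_lip wL.
  congr ob_iint; apply/funext => x; rewrite -(sum_theta p e (x - x0) ebasis_frame) mulr_suml//.
(* The Taylor error of order 1/(k+1)^2, multiplied by k+1, leaves 1/(k+1). *)
have bnd k : `|ob_iint (F k) - (- c * ob_iint (fun y => lapbump p e (y - x0) * w y))|
    <= (`|c| * \sum_i (Ct i * B)) * k.+1%:R^-1.
  rewrite EF EL mulr_sumr -sumrB (le_trans (ler_norm_sum _ _ _))//.
  rewrite -mulrA mulr_suml mulr_sumr; apply: ler_sum => i _.
  rewrite mulNr opprK -mulrDr normrM ler_wpM2l//.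
  have L1 : LB M (fun x => k.+1%:R * (G i (x - a k i) - G i x)) by apply/LB_scale/LB_sub.
  rewrite -(iintD M0 (LB_mul_lip L1 wL) (LB_mul_lip (TL i) wL)).
  rewrite (_ : (fun x => _) = (fun x => (k.+1%:R * (G i (x - a k i) - G i x) + T i x) * w x)); last first.
    by apply/funext => x; ring.
  rewrite mulrAC; apply: hB; first exact: LB_add.
  move=> x; have := (hCt i).2 (x - x0) k.+1%:R^-1.
  rewrite invr_ge0 (ltW (k0 k)) => /(_ isT).
  have e1 : x - x0 - k.+1%:R^-1 *: ob_ebasis R i = x - a k i - x0 by rewrite addrAC.
  rewrite e1 -/(G i (x - a k i)) -/(G i x) -/(T i x) => h.
  rewrite -(@ler_pM2r _ k.+1%:R^-1) ?invr_gt0// -[leRHS]mulrA -expr2.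
  apply: le_trans h; rewrite -[X in _ * X](ger0_norm (kV0 k)) -normrM.
  rewrite le_eqVlt; apply/orP; left; apply/eqP; congr (`| _ |).
  have kn : k.+1%:R != 0 :> R by rewrite lt0r_neq0.
  move: (G i (x - a k i)) (G i x) (T i x) (k.+1%:R : R) kn => g1 g2 t1 q qn.
  by field.
apply: (cvg_unique _ cvgF) => //.
apply/cvgrPdist_le => d d0.
set K := `|c| * \sum_i (Ct i * B).
have K0 : 0 <= K by rewrite mulr_ge0// sumr_ge0// => i _; rewrite mulr_ge0// (hCt i).1.
have dK0 : 0 < d / (K + 1) by rewrite divr_gt0// ltr_wpDl.
near=> k.
rewrite distrC (le_trans (bnd k))//.
rewrite (@le_trans _ _ ((K + 1) * k.+1%:R^-1))//.
  by rewrite ler_wpM2r ?invr_ge0 ?lerDl// ltW.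
rewrite mulrC -ler_pdivlMr ?ltr_wpDl// ltW//.
near: k; exact: (near_infty_natSinv_lt (PosNum dK0)).
Unshelve. all: by end_near. Qed.

End Energy.

(** * Mollification and the maximum principle *)

Section Mollify.
Context {R : realType} {n : nat}.
Implicit Types (x y z v : 'rV[R]_n) (e s t a : R) (f g w : 'rV[R]_n -> R).

Definition seclap (V : 'I_n -> 'rV[R]_n) g x t :=
  \sum_i (g (x + t *: V i) + g (x - t *: V i) - 2 * g x).

(** The limsup of [seclap V g x t] / t^2 as t decreases to 0 is at most [a]: a one-sided Laplacian
    that only sees values of [g]. *)
Definition upper_lap (V : 'I_n -> 'rV[R]_n) g x a :=
  forall e, 0 < e -> exists2 t0, 0 < t0 & forall t, 0 < t < t0 -> seclap V g x t <= t ^+ 2 * (a + e).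

Notation bump := (bumpN 1).

Section Mollifier.
Variables (w : 'rV[R]_n -> R) (L : R).
Hypothesis wL : forall x y, `|w x - w y| <= L * `|x - y|.
Variable e : R.
Hypothesis e0 : 0 < e.

Let bump_shift x M : e + `|x| <= M -> LB M (fun y => bump e (y - x)).
Proof. by rewrite -[`|x|]normrN => h; apply: LB_widen h (LB_shift (- x) (bumpN_LB 1 e0)). Qed.

Lemma bump_ge0 x : 0 <= bump e x.
Proof.
rewrite /bumpN /bumpf; case: ifP => // _.
by rewrite hornerE mul1r expR_ge0.
Qed.

Definition mass := ob_iint (bump e : 'rV[R]_n -> R).

Lemma mass_gt0 : 0 < mass.
Proof.
apply: (@iint_gt0 _ _ e _ 0 (ltW e0) (bumpN_LB 1 e0) bump_ge0).
rewrite /bumpN /bumpf /sqn big1 ?subr0; last by move=> i _; rewrite mxE expr0n.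
by rewrite ifT ?exprn_gt0// hornerE mul1r expR_gt0.
Qed.

Definition moll x := ob_iint (fun y => bump e (y - x) * w y) / mass.

Let L0 : 0 <= `|L|. Proof. exact: normr_ge0. Qed.

Let wL' x y : `|w x - w y| <= `|L| * `|x - y|.
Proof. by rewrite (le_trans (wL _ _))// ler_wpM2r// ler_norm. Qed.

(* Sandwich: a bump-weighted integral of a function bounded by [C] on the support is at most [C] times the mass. *)
Let sandwich (h : 'rV[R]_n -> R) M C : LB M (fun y => bump e y * h y) -> e <= M ->
  (forall y, `|y| <= e -> `|h y| <= C) -> `|ob_iint (fun y => bump e y * h y)| <= C * mass.
Proof.
move=> hL eM hC; have M0 : 0 <= M by rewrite (le_trans _ eM)// ltW.
have bL : LB M (bump e : 'rV[R]_n -> R) by exact: (LB_widen eM (bumpN_LB _ e0)).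
have pw y : `|bump e y * h y| <= C * bump e y.
  have [ye|ye] := leP `|y| e; last by rewrite (bumpN_LB 1 e0).2// mul0r normr0 mulr0.
  by rewrite normrM (ger0_norm (bump_ge0 _)) mulrC ler_wpM2r ?bump_ge0// hC.
rewrite /mass -(iintZ _ M0 bL) ler_norml; apply/andP; split.
  rewrite -mulN1r -(iintZ (-1) M0 (LB_scale C bL)); apply: (iint_le M0) => //.
    exact/LB_scale/LB_scale.
  by move=> y; rewrite mulN1r; have := pw y; rewrite ler_norml => /andP[].
apply: (iint_le M0) => //; first exact: LB_scale.
by move=> y; have := pw y; rewrite ler_norml => /andP[].
Qed.

Lemma moll_shiftE x : ob_iint (fun y => bump e (y - x) * w y) = ob_iint (fun y => bump e y * w (y + x)).
Proof.
have h : LB (e + `|x|) (fun y => bump e (y - x) * w y).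
  by apply: LB_mul_lip wL; exact: bump_shift.
have M0 : 0 <= e + `|x| by rewrite addr_ge0// ltW.
rewrite -(iint_shift x M0 h).
by congr ob_iint; apply/funext => y; rewrite addrK.
Qed.

Let bump_lip x : LB e (fun y => bump e y * w (y + x)).
Proof.
apply: (@LB_mul_lip _ _ _ L _ _ (bumpN_LB 1 e0)) => y z.
by rewrite (le_trans (wL _ _))// opprD addrACA subrr addr0.
Qed.

Lemma moll_close x : `|moll x - w x| <= `|L| * e.
Proof.
have m0 := mass_gt0.
have -> : moll x - w x = ob_iint (fun y => bump e y * (w (y + x) - w x)) / mass.
  rewrite /moll moll_shiftE -[X in _ - X](mulfK (lt0r_neq0 m0)) -mulrBl; congr (_ / _).
  rewrite -(iintZ _ (ltW e0) (bumpN_LB 1 e0)) -(iintB (ltW e0) (bump_lip x)); last first.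
    exact/LB_scale/bumpN_LB.
  by congr ob_iint; apply/funext => y; ring.
rewrite normrM (gtr0_norm (_ : 0 < mass^-1)) ?invr_gt0// ler_pdivrMr//.
apply: (@sandwich _ e) => //.
  rewrite (_ : (fun _ => _) = (fun y => bump e y * w (y + x) - w x * bump e y)).
    by apply: LB_sub; [exact: bump_lip|exact/LB_scale/bumpN_LB].
  by apply/funext => y; ring.
by move=> y ye; rewrite (le_trans (wL' _ _))// addrK ler_wpM2l.
Qed.

Lemma moll_lip x y : `|moll x - moll y| <= `|L| * `|x - y|.
Proof.
have m0 := mass_gt0.
rewrite /moll !moll_shiftE -mulrBl normrM (gtr0_norm (_ : 0 < mass^-1)) ?invr_gt0// ler_pdivrMr//.
rewrite -(iintB (ltW e0) (bump_lip x) (bump_lip y)).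
rewrite (_ : (fun _ => _) = (fun z => bump e z * (w (z + x) - w (z + y)))); last first.
  by apply/funext => z; ring.
apply: (@sandwich _ e) => //.
  rewrite (_ : (fun _ => _) = (fun z => bump e z * w (z + x) - bump e z * w (z + y))).
    by apply: LB_sub; exact: bump_lip.
  by apply/funext => z; ring.
by move=> z _; rewrite (le_trans (wL' _ _))// opprD addrACA subrr add0r.
Qed.

(** Second differences in [x] fall on the bump under the integral, where Taylor's formula has an
    error O(t^3) uniform in the integration variable. The limit is the same for every orthonormal
    frame. *)
Lemma moll_seclap V x d : orthoframe V -> 0 < d ->
  exists2 t0, 0 < t0 & forall t, 0 < t < t0 ->
  `|seclap V moll x t - t ^+ 2 * (ob_iint (fun y => lapbump 1 e (y - x) * w y) / mass)| <= t ^+ 2 * d.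
Proof.
move=> fV d0; have m0 := mass_gt0.
pose M := e + `|x| + \sum_i `|V i|.
have S0 : 0 <= \sum_i `|V i| by exact: sumr_ge0.
have M0 : 0 <= M by rewrite !addr_ge0// ltW.
have VM (i : 'I_n) : `|V i| <= \sum_i `|V i| by rewrite (bigD1 i)//= lerDl sumr_ge0.
have [B B0 hB] := iint_mul_lip_bound M0 wL.
have exC i : exists C : R, 0 <= C /\ forall z t, 0 <= t ->
  `|bump e (z + t *: V i) + bump e (z - t *: V i) - 2 * bump e z - t ^+ 2 * theta 1 e (V i) z| <= C * t ^+ 3.
  by have [C C0 hC] := bumpN_taylor2 1 (V i) e0; exists C.
have [C hC] := choice exC.
pose K := \sum_i C i * B.
have K0 : 0 <= K by apply: sumr_ge0 => i _; rewrite mulr_ge0// (hC i).1.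
(* Below [t0] the cubic error K t^3 is at most t^2 d mass, and the bound 1 keeps the shifted bumps
   in the box. *)
pose t0 := Num.min 1 (d * mass / (K + 1)).
have K1 : 0 < K + 1 by rewrite ltr_wpDl.
exists t0; first by rewrite lt_min ltr01 divr_gt0// mulr_gt0.
move=> t /andP[tp]; rewrite lt_min => /andP[t1 tK].
have bM s i : `|s| <= 1 -> LB M (fun y => bump e (y - (x + s *: V i))).
  move=> s1; apply: bump_shift; rewrite /M -addrA lerD2l (le_trans (ler_normD _ _))// lerD2l.
  by rewrite normrZ (le_trans _ (VM i))// ler_piMl.
have bM0 : LB M (fun y => bump e (y - x)) by apply: bump_shift; rewrite /M lerDl.
have tn : `|t| <= 1 by rewrite ger0_norm ltW.
have tn' : `|- t| <= 1 by rewrite normrN.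
have TM i : LB M (fun y => theta 1 e (V i) (y - x)).
  by apply: LB_widen (LB_shift (- x) (theta_LB 1 (V i) e0)); rewrite normrN lerDl.
pose r i y := bump e (y - (x + t *: V i)) + bump e (y - (x + (- t) *: V i)) - 2 * bump e (y - x)
   - t ^+ 2 * theta 1 e (V i) (y - x).
have rL i : LB M (r i).
  by apply: LB_sub; [apply: LB_sub; [apply: LB_add; exact: bM|exact: LB_scale]|exact: LB_scale].
have rC i y : `|r i y| <= C i * t ^+ 3.
  have := (hC i).2 (y - x) t (ltW tp); rewrite /r.
  have -> : y - (x + t *: V i) = y - x - t *: V i by rewrite opprD addrA.
  have -> : y - (x + - t *: V i) = y - x + t *: V i by rewrite opprD addrA scaleNr opprK.
  by rewrite [bump e (_ + _) + _]addrC.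
have EL : ob_iint (fun y => lapbump 1 e (y - x) * w y) = \sum_i ob_iint (fun y => theta 1 e (V i) (y - x) * w y).
  rewrite -(iint_sum _ M0); last by move=> i; exact: LB_mul_lip wL.
  by congr ob_iint; apply/funext => y; rewrite -(sum_theta 1 e (y - x) fV) mulr_suml.
have Er i : ob_iint (fun y => r i y * w y) =
   ob_iint (fun y => bump e (y - (x + t *: V i)) * w y) + ob_iint (fun y => bump e (y - (x + (- t) *: V i)) * w y)
   - 2 * ob_iint (fun y => bump e (y - x) * w y) - t ^+ 2 * ob_iint (fun y => theta 1 e (V i) (y - x) * w y).
  have l1 := LB_mul_lip (bM _ i tn) wL.
  have l2 := LB_mul_lip (bM _ i tn') wL.
  have l3 := LB_mul_lip bM0 wL.
  have l4 := LB_mul_lip (TM i) wL.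
  rewrite -(iintZ 2 M0 l3) -(iintZ (t ^+ 2) M0 l4) -(iintD M0 l1 l2).
  rewrite -(iintB M0 (LB_add l1 l2) (LB_scale 2 l3)) -(iintB M0 _ (LB_scale (t ^+ 2) l4)); last first.
    by apply: LB_sub; [exact: LB_add|exact: LB_scale].
  by congr ob_iint; apply/funext => y; rewrite /r; ring.
have -> : seclap V moll x t - t ^+ 2 * (ob_iint (fun y => lapbump 1 e (y - x) * w y) / mass) =
    (\sum_i ob_iint (fun y => r i y * w y)) / mass.
  rewrite EL /seclap mulr_suml mulr_suml mulr_sumr -sumrB; apply: eq_bigr => i _.
  by rewrite Er /moll scaleNr; ring.
rewrite normrM (gtr0_norm (_ : 0 < mass^-1)) ?invr_gt0// ler_pdivrMr//.
apply: (@le_trans _ _ (K * t ^+ 3)).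
  rewrite (le_trans (ler_norm_sum _ _ _))// mulr_suml; apply: ler_sum => i _.
  by rewrite mulrAC; apply: hB.
have h : K * t <= d * mass.
  apply: (@le_trans _ _ ((K + 1) * t)); first by rewrite ler_wpM2r ?lerDl// ltW.
  by rewrite mulrC -ler_pdivlMr// ltW.
have t2 : 0 <= t ^+ 2 by rewrite sqr_ge0.
have := ler_wpM2l t2 h; rewrite exprS; nra.
Qed.

End Mollifier.

End Mollify.

(** * Approximate superharmonicity, the maximum principle and barriers *)

Section MaxPrinciple.
Context {R : realType} {n : nat}.
Implicit Types (x y z v : 'rV[R]_n) (e s t a : R) (f g w : 'rV[R]_n -> R) (K : set 'rV[R]_n).

Notation E := (@ob_ebasis R n).

(* Plays the role of superharmonicity of [f] on [K]; unlike testing [f] itself with paraboloids, it passes to sums of two nonsmooth functions. *)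
Definition appsup K f := forall e, 0 < e -> exists g, [/\ continuous g,
  forall x, K x -> `|g x - f x| <= e & forall x, K x -> upper_lap E g x 0].

Lemma seclapD V f g x t : seclap V (fun x => f x + g x) x t = seclap V f x t + seclap V g x t.
Proof. by rewrite /seclap -big_split; apply: eq_bigr => i _ /=; ring. Qed.

Lemma upper_lapD V f g x a b : upper_lap V f x a -> upper_lap V g x b ->
  upper_lap V (fun x => f x + g x) x (a + b).
Proof.
move=> hf hg e e0; have e2 : 0 < e / 2 by rewrite divr_gt0.
have [t1 t10 h1] := hf _ e2; have [t2 t20 h2] := hg _ e2.
exists (Num.min t1 t2); first by rewrite lt_min t10.
move=> t /andP[t0]; rewrite lt_min => /andP[l1 l2].
have := h1 t; rewrite t0 l1 => /(_ isT) h3; have := h2 t; rewrite t0 l2 => /(_ isT) h4.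
rewrite seclapD (le_trans (lerD h3 h4))// -mulrDr ler_wpM2l ?sqr_ge0//; lra.
Qed.

Lemma norm_ebasis_le1 i : `|E i| <= 1.
Proof.
apply: rV_norm_leP => // j; rewrite mxE.
by case: (_ && _); rewrite ?normr1 ?normr0.
Qed.

(** At an interior minimum of the approximant [G] all second differences are nonnegative, against
    the negative bound supplied by [p]; a minimum off the interior is excluded by the gap. *)
Lemma max_principle K f1 f2 (p : 'rV[R]_n -> R) x0 gap : compact K -> continuous p ->
  appsup K f1 -> appsup K f2 ->
  (forall x, K x -> exists2 a, a < 0 & upper_lap E p x a) ->
  K x0 -> 0 < gap ->
  ~ (forall y, K y -> ~ K^° y -> f1 x0 + f2 x0 + p x0 + gap <= f1 y + f2 y + p y).
Proof.
move=> cK cp a1 a2 hp Kx0 gap0 hgap.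
(* Two functions approximated at two points cost four errors; the fifth part keeps the contradiction
   strict. *)
have e0 : 0 < gap / 5 by rewrite divr_gt0.
have [g1 [cg1 c1 u1]] := a1 _ e0; have [g2 [cg2 c2 u2]] := a2 _ e0.
pose G x := g1 x + g2 x + p x.
have cG : continuous G.
  move=> x; apply: (@cvgD _ _ _ (nbhs x)); last exact: cp.
  by apply: (@cvgD _ _ _ (nbhs x)); [exact: cg1|exact: cg2].
have [x1] : exists2 c, c \in K & forall y, y \in K -> G c <= G y.
  apply: EVT_min_rV => //; first by exists x0.
  exact: continuous_subspaceT.
rewrite inE => Kx1 minG.
have Gx0 : G x1 <= G x0 by apply: minG; rewrite inE.
have [x1i|x1b] := pselect (K^° x1); last first.
  have := hgap _ Kx1 x1b.
  have := c1 _ Kx1; have := c2 _ Kx1; have := c1 _ Kx0; have := c2 _ Kx0.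
  rewrite !ler_norml => /andP[b1 b2] /andP[b3 b4] /andP[b5 b6] /andP[b7 b8].
  rewrite /G in Gx0; move: gap0; lra.
have [a al0 ha] := hp _ Kx1.
have uG := upper_lapD (upper_lapD (u1 _ Kx1) (u2 _ Kx1)) ha.
have [r /= r0 hr] : exists2 r : R, 0 < r & ball x1 r `<=` K.
  by move: x1i; rewrite /interior /= => /nbhs_ballP[r r0 hr]; exists r.
have na : 0 < - a / 2 by rewrite divr_gt0// oppr_gt0.
have [t0 t00 ht] := uG _ na.
pose t := Num.min (t0 / 2) (r / 2).
have tp : 0 < t by rewrite lt_min !divr_gt0.
have tt0 : t < t0 by rewrite gt_min; apply/orP; left; lra.
have tr : t < r by rewrite gt_min; apply/orP; right; lra.
have := ht t; rewrite tp tt0 => /(_ isT); rewrite add0r add0r leNgt => /negP; apply.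
apply: (@lt_le_trans _ _ 0).
  by rewrite pmulr_rlt0 ?exprn_gt0//; lra.
apply: sumr_ge0 => i _.
have inK s : `|s| = t -> K (x1 + s *: E i).
  move=> st; apply: hr; rewrite -ball_normE /= opprD addrA subrr sub0r normrN normrZ st.
  by rewrite (le_lt_trans _ tr)//; apply: ler_piMr; [exact: ltW|exact: norm_ebasis_le1].
have h1 : G x1 <= G (x1 + t *: E i) by apply: minG; rewrite inE; apply: inK; rewrite gtr0_norm.
have h2 : G x1 <= G (x1 - t *: E i).
  by rewrite -scaleNr; apply: minG; rewrite inE; apply: inK; rewrite normrN gtr0_norm.
rewrite -/(G _) -/(G _) -/(G x1); lra.
Qed.

Lemma appsup0 K : appsup K (fun _ => 0).
Proof.
move=> e e0; exists (fun _ => 0); split; first exact: cst_continuous.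
  by move=> x _; rewrite subrr normr0 ltW.
move=> x _ d d0; exists 1 => // t _; rewrite /seclap big1; last by move=> i _; ring.
by rewrite add0r mulr_ge0 ?sqr_ge0// ltW.
Qed.

Section LipschitzFunction.
Variables (w : 'rV[R]_n -> R) (L : R).
Hypothesis wL : forall x y, `|w x - w y| <= L * `|x - y|.

Let pick_eps e (e1 : R) : 0 < e -> 0 < e1 -> exists d, [/\ 0 < d, d < e1 & `|L| * d <= e].
Proof.
move=> e0 e10; exists (Num.min (e1 / 2) (e / (`|L| + 1))).
have L1 : 0 < `|L| + 1 by rewrite ltr_wpDl.
split.
- by rewrite lt_min !divr_gt0.
- by rewrite gt_min; apply/orP; left; lra.
- apply: (@le_trans _ _ (`|L| * (e / (`|L| + 1)))).
    by rewrite ler_wpM2l// ge_min lexx orbT.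
  rewrite mulrA ler_pdivrMr// mulrC; apply: (ler_wpM2l (ltW e0)); by rewrite lerDl.
Qed.

(* Composition with a linear isometry turns the standard frame into another orthonormal frame. *)
Lemma appsup_isometry (S : 'rV[R]_n -> 'rV[R]_n) K :
  (forall x t v, S (x + t *: v) = S x + t *: S v) -> orthoframe (S \o E) -> continuous S ->
  (forall x e, 0 < e -> ob_iint (fun y => lapbump 1 e (y - x) * w y) <= 0) ->
  appsup K (w \o S).
Proof.
move=> Slin Sf cS sup e e0; have [d [d0 _ dL]] := pick_eps e0 ltr01.
exists (moll w d \o S); split.
- move=> x; apply: continuous_comp; first exact: cS.
  have cm := lip_continuous (moll_lip wL d0); exact: cm.
- by move=> x _; apply: le_trans (moll_close wL d0 (S x)) dL.
move=> x _ b b0.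
have [t0 t00 h] := moll_seclap wL d0 (S x) Sf b0.
exists t0 => // t ht.
have -> : seclap E (moll w d \o S) x t = seclap (S \o E) (moll w d) (S x) t.
  by apply: eq_bigr => i _; rewrite /= Slin -scaleNr Slin scaleNr.
have := h t ht; rewrite ler_norml => /andP[_].
have : t ^+ 2 * (ob_iint (fun y => lapbump 1 d (y - S x) * w y) / @mass R n d) <= 0.
  rewrite mulr_ge0_le0 ?sqr_ge0// pmulr_lle0 ?sup// invr_gt0.
  exact: mass_gt0 d0.
rewrite add0r; lra.
Qed.

Lemma appsup_super K :
  (forall x e, 0 < e -> ob_iint (fun y => lapbump 1 e (y - x) * w y) <= 0) -> appsup K w.
Proof.
move=> sup; apply: (@appsup_isometry id K _ _ _ sup) => //.
  by split=> [i|z]; [exact: ebasis_frame.1|exact: ebasis_frame.2].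
by move=> x; exact: cvg_id.
Qed.

(** Only radii below [e1] are tested, since the balls must stay clear of the contact set. *)
Lemma appsup_harmonic K e1 : 0 < e1 ->
  (forall x e, K x -> 0 < e < e1 -> ob_iint (fun y => lapbump 1 e (y - x) * w y) = 0) ->
  appsup K (fun x => - w x).
Proof.
move=> e10 har e e0; have [d [d0 de dL]] := pick_eps e0 e10.
have cm := lip_continuous (moll_lip wL d0).
exists (fun x => - moll w d x); split.
- by move=> x; apply: (@cvgN _ _ _ (nbhs x)); exact: cm.
- by move=> x _; rewrite -opprD normrN; apply: le_trans (moll_close wL d0 x) dL.
move=> x Kx b b0.
have [t0 t00 h] := moll_seclap wL d0 x ebasis_frame b0.
exists t0 => // t ht.
have -> : seclap E (fun x => - moll w d x) x t = - seclap E (moll w d) x t.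
  by rewrite /seclap -sumrN; apply: eq_bigr => i _; ring.
have := h t ht; rewrite har ?d0// mul0r mulr0 subr0 ler_norml => /andP[+ _].
rewrite add0r; lra.
Qed.

End LipschitzFunction.

Lemma seclap_sqn x t : seclap E (@sqn R n) x t = 2 * n%:R * t ^+ 2.
Proof.
rewrite /seclap (eq_bigr (fun _ => 2 * t ^+ 2)).
  by rewrite sumr_const card_ord -[LHS]mulr_natl; ring.
by move=> i _; rewrite -scaleNr !sqn_line (ebasis_frame.1 i); ring.
Qed.

Lemma upper_lap_sqn d c x : upper_lap E (fun y => d * sqn y + c) x (d * (2 * n%:R)).
Proof.
move=> e e0; exists 1 => // t _.
have -> : seclap E (fun y => d * sqn y + c) x t = d * seclap E (@sqn R n) x t.
  by rewrite /seclap [RHS]mulr_sumr; apply: eq_bigr => i _; ring.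
have h : 0 <= t ^+ 2 * e by rewrite mulr_ge0 ?sqr_ge0// ltW.
rewrite seclap_sqn; move: h; set q := t ^+ 2; set m := n%:R; nra.
Qed.

(** With A = exp(s/2) and B = exp(-s/2) the right side is A^2 + B^2 = 2 + (A - B)^2, and A - B >=
    s/2 for s >= 0. *)
Lemma expR_cosh_ge s : 2 + s ^+ 2 / 4 <= expR s + expR (- s).
Proof.
wlog s0 : s / 0 <= s.
  move=> W; have [/W//|s0] := leP 0 s.
  by have := W (- s); rewrite sqrrN opprK [X in _ -> _ <= X]addrC; apply; rewrite oppr_ge0 ltW.
have h1 : 1 + s / 2 <= expR (s / 2) by exact: expR_ge1Dx.
have h2 : expR (- (s / 2)) <= 1 by rewrite -expR0 ler_expR oppr_le0 divr_ge0.
have h3 : expR s = expR (s / 2) ^+ 2 by rewrite -expRM_natl mulrC divfK.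
have h4 : expR (- s) = expR (- (s / 2)) ^+ 2.
  by rewrite -expRM_natl mulrN mulrC divfK.
have h5 : expR (s / 2) * expR (- (s / 2)) = 1 by rewrite -expRD subrr expR0.
rewrite h3 h4; move: h1 h2 h5; set A := expR _; set B := expR _ => h1 h2 h5.
have h6 : (s / 2) ^+ 2 <= (A - B) ^+ 2.
  rewrite ler_pXn2r ?nnegrE ?divr_ge0//; lra.
nra.
Qed.

Definition barrier a x := expR (- (a * sqn x)).

(** The Laplacian of exp(-a |x|^2) is (4 a^2 |x|^2 - 2 a n) times it. The constant of [expR_cosh_ge]
    turns 4 into 1, whence the threshold 2 n < a |x|^2. *)
Lemma upper_lap_barrier a th x : 0 < a -> 0 < th -> 2 * n%:R < a * sqn x ->
  exists2 b, b < 0 & upper_lap E (fun y => - th * barrier a y) x b.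
Proof.
move=> a0 th0 ax.
pose c := th * barrier a x * a.
have B0 y : 0 < barrier a y by exact: expR_gt0.
have c0 : 0 < c by rewrite !mulr_gt0.
exists (- c * (a * sqn x - 2 * n%:R)).
  by rewrite mulNr oppr_lt0 mulr_gt0// subr_gt0.
move=> e e0.
(* [D] majorizes the coefficient of t^4 in the expansion of (1 - a t^2) (2 n + a^2 t^2 |x|^2), after
   multiplication by th and the barrier. *)
pose D := c * a * a * sqn x + 1.
have D0 : 0 < D by rewrite ltr_wpDl// !mulr_ge0 ?sqn_ge0// ltW.
pose t0 := Num.min 1 (e / D).
exists t0; first by rewrite lt_min ltr01 divr_gt0.
move=> t /andP[tp]; rewrite lt_min => /andP[t1 tD].
have tE i s : s ^+ 2 = t ^+ 2 -> barrier a (x + s *: E i) = barrier a x * expR (- (a * t ^+ 2)) * expR (- (2 * a * s * x ord0 i)).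
  move=> st; rewrite /barrier -!expRD; congr expR.
  by rewrite sqn_line (ebasis_frame.1 i) dot_ebasis st; ring.
have lo i : barrier a x * ((1 - a * t ^+ 2) * (2 + a ^+ 2 * t ^+ 2 * x ord0 i ^+ 2))
    <= barrier a (x + t *: E i) + barrier a (x - t *: E i).
  have -> : x - t *: E i = x + (- t) *: E i by rewrite scaleNr.
  rewrite (tE i t)// (tE i (- t)) ?sqrrN// -[leRHS]mulrDr -[leRHS]mulrA; apply: (ler_wpM2l (ltW (B0 x))).
  have h1 := expR_cosh_ge (2 * a * t * x ord0 i).
  have h2 : 1 - a * t ^+ 2 <= expR (- (a * t ^+ 2)) by exact: expR_ge1Dx.
  have h3 : 0 < expR (- (a * t ^+ 2)) by exact: expR_gt0.
  have -> : - (2 * a * - t * x ord0 i) = 2 * a * t * x ord0 i by ring.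
  apply: (@le_trans _ _ (expR (- (a * t ^+ 2)) * (2 + a ^+ 2 * t ^+ 2 * x ord0 i ^+ 2))).
    have sq : 0 <= a ^+ 2 * t ^+ 2 * x ord0 i ^+ 2 by rewrite -!exprMn sqr_ge0.
    by rewrite ler_wpM2r// addr_ge0.
  apply: (ler_wpM2l (ltW h3)); rewrite [leRHS]addrC; apply: le_trans h1.
  rewrite le_eqVlt; apply/orP; left; apply/eqP; by field.
have : seclap E (fun y => - th * barrier a y) x t <=
   - th * (\sum_i (barrier a x * ((1 - a * t ^+ 2) * (2 + a ^+ 2 * t ^+ 2 * x ord0 i ^+ 2)) - 2 * barrier a x)).
  rewrite /seclap mulr_sumr; apply: ler_sum => i _.
  have := lo i; set u1 := barrier a (_ + _); set u2 := barrier a (_ - _); set u3 := _ * (_ * _).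
  by move=> lo'; have := ler_wpM2l (ltW th0) lo'; lra.
move/le_trans; apply.
have -> : \sum_i (barrier a x * ((1 - a * t ^+ 2) * (2 + a ^+ 2 * t ^+ 2 * x ord0 i ^+ 2)) - 2 * barrier a x)
  = barrier a x * ((1 - a * t ^+ 2) * (2 * n%:R + a ^+ 2 * t ^+ 2 * sqn x) - 2 * n%:R).
  rewrite (eq_bigr (fun i => (barrier a x * (1 - a * t ^+ 2) * (a ^+ 2 * t ^+ 2)) * x ord0 i ^+ 2
     + barrier a x * ((1 - a * t ^+ 2) * 2 - 2))); last by move=> i _; ring.
  by rewrite big_split /= -mulr_sumr -/(sqn x) sumr_const card_ord -[_ *+ n]mulr_natl; ring.
have h : c * a * a * sqn x * t ^+ 2 <= e.
  have s1 : c * a * a * sqn x <= D by rewrite lerDl.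
  have s2 : t * D <= e by rewrite -ler_pdivlMr// ltW.
  have s3 : t ^+ 2 <= t by rewrite expr2 ler_piMl// ltW.
  have s0 : 0 <= c * a * a * sqn x by rewrite !mulr_ge0 ?sqn_ge0// ltW.
  apply: le_trans s2; rewrite mulrC; apply: ler_pM => //; exact: sqr_ge0.
have := ler_wpM2l (sqr_ge0 t) h.
by rewrite /c; set b := barrier a x; nra.
Qed.

End MaxPrinciple.

(** * Segments, sublevel sets and reflections *)

Section Geometry.
Context {R : realType} {n : nat}.
Implicit Types (x y z v : 'rV[R]_n) (e s t a : R).

Lemma norm_le_enorm x : `|x| <= ob_enorm x.
Proof.
rewrite enorm_sqn; apply: rV_norm_leP => [|i]; first exact: sqrtr_ge0.
rewrite -sqrtr_sqr; apply: ler_wsqrtr; exact: sqr_coord_le_sqn.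
Qed.

Lemma sqn_le_norm x : sqn x <= n%:R * `|x| ^+ 2.
Proof.
have -> : n%:R * `|x| ^+ 2 = \sum_(i < n) `|x| ^+ 2 by rewrite sumr_const card_ord mulr_natl.
apply: ler_sum => i _; rewrite -[x _ _ ^+ 2]real_normK ?num_real//.
by rewrite ler_pXn2r ?nnegrE// coord_le_norm.
Qed.

Lemma enorm_le_norm x : ob_enorm x <= n%:R * `|x|.
Proof.
rewrite enorm_sqn -[leRHS]ger0_norm ?mulr_ge0// -sqrtr_sqr; apply: ler_wsqrtr.
apply: le_trans (sqn_le_norm x) _; rewrite exprMn ler_wpM2r ?sqr_ge0//.
by case: n => [|m]; rewrite ?expr0n// expr2 ler_peMl// ler1n.
Qed.

Lemma enorm_sqr x : ob_enorm x ^+ 2 = sqn x.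
Proof. by rewrite enorm_sqn sqr_sqrtr ?sqn_ge0. Qed.

Lemma enorm_ge0 x : 0 <= ob_enorm x. Proof. exact: sqrtr_ge0. Qed.

Lemma sqn0 : sqn (0 : 'rV[R]_n) = 0.
Proof. by rewrite /sqn big1// => i _; rewrite mxE expr0n. Qed.

Lemma sqnZ a x : sqn (a *: x) = a ^+ 2 * sqn x.
Proof. by rewrite -!dotxx dotZl dotZr mulrA expr2. Qed.

Lemma sqn_eq0 x : sqn x = 0 -> x = 0.
Proof.
move=> h; apply/rowP => i; rewrite mxE; apply/eqP; rewrite -sqrf_eq0 eq_le sqr_ge0 andbT.
by rewrite -h sqr_coord_le_sqn.
Qed.

Lemma continuous_line x v : continuous (fun s : R => x + s *: v).
Proof.
move=> s; apply: cvgD; first exact: cvg_cst.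
by apply: cvgZr_tmp; exact: cvg_id.
Qed.

(** The crossing is at the supremum of the parameters with point in [D]: openness would push it
    further if its point were in [D], and that point is a limit of points of [D]. *)
Lemma segment_crosses_boundary (D : set 'rV[R]_n) x y : open D -> D x -> ~ D y ->
  exists2 s, 0 <= s <= 1 & ob_boundary D (x + s *: (y - x)).
Proof.
move=> oD Dx nDy.
pose g (s : R) := x + s *: (y - x).
have cg : continuous g by exact: continuous_line.
have g0 : g 0 = x by rewrite /g scale0r addr0.
have g1 : g 1 = y by rewrite /g scale1r addrCA subrr addr0.
pose A := [set s : R | 0 <= s <= 1 /\ D (g s)].
have A0 : A 0 by split; rewrite ?lexx ?ler01 ?g0.
have hsup : has_sup A.
  by split; [exists 0|exists 1 => s [/andP[_ ]]].
pose c := sup A.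
have c0 : 0 <= c by apply: ub_le_sup => //; exact: hsup.2.
have c1 : c <= 1 by apply: ge_sup; [exists 0|move=> s [/andP[_ ]]].
exists c; first by rewrite c0 c1.
have nDc : ~ D (g c).
  move=> Dc; have c1' : c < 1.
    by rewrite lt_neqAle c1 andbT; apply/eqP => ce; apply: nDy; rewrite -g1 -ce.
  have : \forall s \near c, D (g s) by apply: (cg c); exact: open_nbhs_nbhs.
  move=> /nbhs_ballP[r /= r0 hr].
  pose s := Num.min (c + r / 2) 1.
  have cs : c < s by rewrite lt_min c1' andbT ltrDl divr_gt0.
  have sA : A s.
    split; first by rewrite (le_trans c0 (ltW cs)) /s ge_min lexx orbT.
    apply: hr; rewrite /ball /= distrC gtr0_norm ?subr_gt0// ltrBlDl.
    by rewrite gt_min; apply/orP; left; lra.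
  have : s <= c by apply: ub_le_sup => //; exact: hsup.2.
  by rewrite leNgt cs.
split; last by move=> /interior_subset.
move=> B Bc.
have : \forall s \near c, B (g s) by apply: (cg c).
move=> /nbhs_ballP[r /= r0 hr].
have [s [sA1 sA2] cs] := sup_adherent r0 hsup.
exists (g s); split => //; apply: hr; rewrite /ball /=.
have sc : s <= c by apply: ub_le_sup => //; exact: hsup.2.
rewrite ger0_norm ?subr_ge0//; move: cs; rewrite -/c; lra.
Qed.

(** Comparison sets are taken as sublevel sets, so that the function has a known value off the
    interior. *)
Lemma sublevel_boundary (f : 'rV[R]_n -> R) b y : continuous f -> f y <= b ->
  ~ [set x | f x <= b]^° y -> f y = b.
Proof.
move=> cf fy nint; apply: contrapT => fb; apply: nint.
have fy' : f y < b by rewrite lt_neqAle fy andbT; apply/eqP.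
have : \forall x \near y, f x < b by exact: (cvgr_lt _ (cf y)).
by apply: filterS => x /ltW.
Qed.

Lemma closed_sublevel (f : 'rV[R]_n -> R) b : continuous f -> closed [set x | f x <= b].
Proof.
move=> cf; rewrite (_ : [set x | _] = f @^-1` [set y | y <= b])//.
by apply: closed_comp; [move=> x _; exact: cf|exact: closed_le].
Qed.

Lemma bounded_enorm (A : set 'rV[R]_n) M : (forall x, A x -> ob_enorm x <= M) -> bounded_set A.
Proof.
move=> h; exists M; split; first exact: num_real.
by move=> M' MM x /h xM; rewrite /= (le_trans (norm_le_enorm x))// (le_trans xM)// ltW.
Qed.

Lemma compact_sublevel (f : 'rV[R]_n -> R) b M : continuous f ->
  (forall x, M < ob_enorm x -> b < f x) -> compact [set x | f x <= b].
Proof.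
move=> cf h; apply: bounded_closed_compact; last exact: closed_sublevel.
apply: (@bounded_enorm _ M) => x /= fx; rewrite leNgt; apply/negP => /h.
by rewrite ltNge fx.
Qed.

Definition reflect_along v x := x - (2 * dot x v / sqn v) *: v.

Lemma reflect_lin v x t y : reflect_along v (x + t *: y) = reflect_along v x + t *: reflect_along v y.
Proof.
rewrite /reflect_along dotDl dotZl scalerBr scalerA.
have -> : 2 * (dot x v + t * dot y v) / sqn v = 2 * dot x v / sqn v + t * (2 * dot y v / sqn v) by ring.
by rewrite scalerDl opprD addrACA.
Qed.

Lemma dot_reflect v x y : dot (reflect_along v x) y = dot x (reflect_along v y).
Proof.
rewrite /reflect_along dotDl dotDr dotNl dotNr dotZl dotZr (dotC v y); congr (_ - _); ring.
Qed.

Lemma sqn_reflect v x : sqn (reflect_along v x) = sqn x.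
Proof.
(* For v = 0 the inverse of 0 is 0, and the reflection is the identity. *)
have [v0|v0] := eqVneq (sqn v) 0; first by rewrite /reflect_along v0 invr0 mulr0 scale0r subr0.
rewrite -dotxx dot_reflect /reflect_along !dotDr !dotNr !dotDl !dotNl !dotZr !dotZl !dotxx.
by rewrite -(dotxx v); field; rewrite dotxx.
Qed.

(** For equal lengths |x - y|^2 = 2 <x, x - y>, so the coefficient in the reflection is 1. *)
Lemma reflect_swap x y : sqn x = sqn y -> x != y -> reflect_along (x - y) x = y.
Proof.
move=> xy nxy.
have v0 : sqn (x - y) != 0 by apply/eqP => /sqn_eq0/eqP; rewrite subr_eq0 (negbTE nxy).
rewrite /reflect_along (_ : 2 * dot x (x - y) / sqn (x - y) = 1).
  by rewrite scale1r opprB addrCA subrr addr0.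
have -> : sqn (x - y) = 2 * dot x (x - y).
  by rewrite -dotxx !dotDl !dotDr !dotNl !dotNr !dotxx -xy (dotC y x); ring.
have v1 : 2 * dot x (x - y) != 0.
  by move: v0; rewrite -dotxx !dotDl !dotDr !dotNl !dotNr !dotxx -xy (dotC y x); apply: contra => /eqP h; apply/eqP; lra.
by rewrite divff.
Qed.

Lemma reflect_sub v x y : reflect_along v x - reflect_along v y = reflect_along v (x - y).
Proof. by rewrite -[x - y](_ : x + (-1) *: y = _) ?reflect_lin scaleN1r. Qed.

Lemma reflect_norm v x y : `|reflect_along v x - reflect_along v y| <= ob_enorm (x - y).
Proof.
by rewrite reflect_sub (le_trans (norm_le_enorm _))// !enorm_sqn sqn_reflect.
Qed.

Lemma reflect_continuous v : continuous (reflect_along v).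
Proof.
move=> x; apply/(@cvgrPdist_le _ _ _ (nbhs x) (nbhs_filter x)) => e e0.
have n1 : 0 < n%:R + 1 :> R by rewrite ltr_wpDl.
apply/nbhs_ballP; exists (e / (n%:R + 1)); first by rewrite /= divr_gt0.
move=> y; rewrite -ball_normE /= => xy.
rewrite (le_trans (reflect_norm _ _ _))// (le_trans (enorm_le_norm _))//.
rewrite (@le_trans _ _ ((n%:R + 1) * `|x - y|))//.
  by rewrite ler_wpM2r// lerDl.
by rewrite mulrC -ler_pdivlMr// ltW.
Qed.

(** Reflections are self-adjoint, so Parseval for the reflected frame at [z] is Parseval for the
    basis at the reflected [z]. *)
Lemma reflect_frame v : orthoframe (reflect_along v \o @ob_ebasis R n).
Proof.
split=> [i|z] /=; first by rewrite sqn_reflect (ebasis_frame.1 i).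
by under eq_bigr do rewrite -dot_reflect; rewrite (ebasis_frame.2 _) sqn_reflect.
Qed.

End Geometry.

(** * Straightening the two-phase solution *)

Section Glue.
Context {R : realType} {n : nat}.
Implicit Types (x y z v : 'rV[R]_n) (e s t a : R).

Lemma derive_seq (f : 'rV[R]_n -> R) x v (h : nat -> R) : derivable f x v ->
  h @ \oo --> 0 -> (forall k, h k != 0) ->
  (fun k => (h k)^-1 * (f (x + h k *: v) - f x)) @ \oo --> 'D_v f x.
Proof.
move=> df h0 hn.
have hl : h @ \oo --> 0^'.
  move=> A hA; have H : \forall k \near \oo, (h k != 0 -> A (h k)) := h0 _ hA.
  have : \forall k \near \oo, A (h k) by apply: filterS H => k; apply.
  by [].
have H := cvg_comp _ _ hl df.
rewrite (_ : (fun k : nat => _) = (fun k => (h k)^-1 *: (f (h k *: v + x) - f x))); first exact: H.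
by apply/funext => k; rewrite (addrC x).
Qed.

Lemma cvg_invS : (fun k : nat => k.+1%:R^-1 : R) @ \oo --> 0.
Proof. exact: cvg_harmonic. Qed.

(* The two-phase solution is straightened into a function harmonic across the interface. *)
Definition glue (D : set 'rV[R]_n) (u : 'rV[R]_n -> R) (d kappa : R) x :=
  if x \in D then u x else d + kappa * (u x - d).

Variables (D : set 'rV[R]_n) (u : 'rV[R]_n -> R) (d L : R).
Hypothesis oD : open D.
Hypothesis uL : forall x y, `|u x - u y| <= L * `|x - y|.
Hypothesis ud : forall x, ob_boundary D x -> u x = d.
Variable kappa : R.
Hypothesis k0 : 0 < kappa.

Notation w := (glue D u d kappa).

Lemma glue_in x : D x -> w x = u x.
Proof. by move=> Dx; rewrite /glue mem_set. Qed.

Lemma glue_out x : ~ D x -> w x = d + kappa * (u x - d).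
Proof. by move=> Dx; rewrite /glue memNset. Qed.

Lemma glue_boundary x : ob_boundary D x -> w x = d.
Proof.
by move=> bx; rewrite /glue (ud bx) subrr mulr0 addr0; case: ifP.
Qed.

Lemma glue_dist x : `|w x - d| <= (1 + kappa) * `|u x - d|.
Proof.
have n0 : 0 <= `|u x - d| by [].
rewrite /glue; case: ifP => _; first by rewrite ler_peMl// lerDl ltW.
by rewrite addrAC subrr add0r normrM (gtr0_norm k0) ler_wpM2r// lerDr.
Qed.

(** A segment leaving [D] meets the boundary, where both branches equal [d]; its two pieces
    contribute slopes |L| and kappa |L|. *)
Lemma glue_lip x y : `|w x - w y| <= (1 + kappa) * `|L| * `|x - y|.
Proof.
have uL' z1 z2 : `|u z1 - u z2| <= `|L| * `|z1 - z2|.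
  by rewrite (le_trans (uL _ _))// ler_wpM2r// ler_norm.
have k1 : 0 <= 1 + kappa by rewrite addr_ge0// ltW.
wlog Dx : x y / D x \/ ~ D y.
  move=> W; have [Dx|nDx] := pselect (D x); first by apply: W; left.
  by rewrite distrC (distrC x); apply: W; right.
have LL : 0 <= `|L| * `|x - y| by rewrite mulr_ge0.
have [Dx'|nDx] := pselect (D x); have [Dy|nDy] := pselect (D y).
- rewrite !glue_in// (le_trans (uL' _ _))// -mulrA ler_peMl// lerDl ltW//.
- have [s /andP[s0 s1] bz] := segment_crosses_boundary oD Dx' nDy.
  set z := x + _ in bz.
  rewrite glue_in// glue_out//.
  have -> : u x - (d + kappa * (u y - d)) = (u x - u z) - kappa * (u y - u z).
    by rewrite (ud bz); ring.
  rewrite (le_trans (ler_normB _ _))// -mulrA mulrDl mul1r lerD//.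
    rewrite (le_trans (uL' _ _))// ler_wpM2l// /z opprD addrA subrr sub0r normrN normrZ.
    by rewrite (ger0_norm s0) distrC ler_piMl.
  rewrite normrM (gtr0_norm k0) ler_pM2l// (le_trans (uL' _ _))// ler_wpM2l//.
  have -> : y - z = (1 - s) *: (y - x) by rewrite /z scalerBl scale1r opprD addrA.
  rewrite normrZ ger0_norm ?subr_ge0// distrC ler_piMl//; lra.
- by case: Dx.
- rewrite !glue_out// opprD addrACA subrr add0r -mulrBr opprB addrA subrK.
  rewrite normrM (gtr0_norm k0) -mulrA; apply: ler_pM => //; first exact: ltW.
  by rewrite lerDr.
Qed.

(* At an interface point where both [u] and [|u - d|] are differentiable the derivative vanishes, so the interface needs not be a null set. *)
Lemma flux_null (sp sm : R) i : 0 < sp -> kappa = sm / sp ->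
  Nul [set x | ~ ((fun k : nat => sp * (k.+1%:R * (w (x + k.+1%:R^-1 *: ob_ebasis R i) - w x)))
      @ \oo --> ob_sigma_of D sp sm x * ob_partial i u x)].
Proof.
move=> sp0 kE; set v := ob_ebasis R i.
pose g x := `|u x - d|.
have gL x y : `|g x - g y| <= L * `|x - y|.
  rewrite /g (le_trans (ler_dist_dist _ _))// opprB addrA subrK; exact: uL.
apply: NulS (NulU (Nul_nonderivable i uL) (Nul_nonderivable i gL)) => x /=.
apply: contra_notP => /not_orP[/contrapT du /contrapT dg].
have hk (k : nat) : k.+1%:R^-1 != 0 :> R by [].
have cu := derive_seq du cvg_invS hk.
have cline : (fun k : nat => x + k.+1%:R^-1 *: v) @ \oo --> x.
  have H := cvg_comp _ _ cvg_invS (@continuous_line R n x v 0).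
  by rewrite scale0r addr0 in H; exact: H.
have cu' : (fun k : nat => k.+1%:R * (u (x + k.+1%:R^-1 *: v) - u x)) @ \oo --> 'D_v u x.
  by move: cu; under eq_fun do rewrite invrK.
rewrite /ob_partial /ob_sigma_of.
have [Dx|nDx] := pselect (D x).
  rewrite mem_set//.
  have nearD : \forall k \near \oo, D (x + k.+1%:R^-1 *: v).
    by apply: cline; exact: open_nbhs_nbhs.
  have h : (fun k : nat => sp * (k.+1%:R * (u (x + k.+1%:R^-1 *: v) - u x))) @ \oo --> sp * 'D_v u x.
    by apply: cvgMr.
  apply: cvg_trans h; apply: near_eq_cvg.
  by apply: filterS nearD => k Dk; rewrite !glue_in.
rewrite memNset//.
have [cDx|ncDx] := pselect (closure D x); last first.
  have nearD : \forall k \near \oo, (~` closure D) (x + k.+1%:R^-1 *: v).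
    by apply: cline; apply: open_nbhs_nbhs; split => //; exact/closed_openC/closed_closure.
  have h : (fun k : nat => sm * (k.+1%:R * (u (x + k.+1%:R^-1 *: v) - u x))) @ \oo --> sm * 'D_v u x.
    by apply: cvgMr.
  apply: cvg_trans h; apply: near_eq_cvg.
  apply: filterS nearD => k nDk; rewrite !glue_out//; last by move=> /subset_closure.
  by rewrite kE; field; rewrite gt_eqF.
have bx : ob_boundary D x by split => // /interior_subset.
have gx : g x = 0 by rewrite /g (ud bx) subrr normr0.
(* [g] has its minimum 0 at [x]: quotients along negative steps are at most 0, along positive steps
   at least 0. *)
have b0 : 'D_v g x = 0.
  have h1 := derive_seq dg cvg_invS hk.
  have hk' (k : nat) : - k.+1%:R^-1 != 0 :> R by rewrite oppr_eq0.
  have c' : (fun k : nat => - k.+1%:R^-1 : R) @ \oo --> 0 by rewrite -oppr0; apply: cvgN; exact: cvg_invS.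
  have h2 := derive_seq dg c' hk'.
  apply/eqP; rewrite eq_le; apply/andP; split.
    apply: (cvgr_to_le h2); apply: nearW => k.
    by rewrite gx subr0 invrN mulNr oppr_le0 invrK mulr_ge0// normr_ge0.
  apply: (cvgr_to_ge h1); apply: nearW => k.
  by rewrite gx subr0 invrK mulr_ge0// normr_ge0.
(* Along positive steps the quotients of [g] are the absolute values of those of [u]. *)
have a0 : 'D_v u x = 0.
  have h1 := derive_seq dg cvg_invS hk; rewrite b0 in h1.
  have h2 : (fun k : nat => `|k.+1%:R * (u (x + k.+1%:R^-1 *: v) - u x)|) @ \oo --> `|'D_v u x|.
    by apply: cvg_norm.
  apply/eqP; rewrite -normr_eq0; apply/eqP.
  apply: (cvg_unique _ h2) => //.
  apply: cvg_trans h1; apply: near_eq_cvg; apply: nearW => k /=.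
  by rewrite gx subr0 invrK normrM (ud bx) ger0_norm.
rewrite a0 mulr0 in cu' *.
(* The quotients of [w] are at most 1 + kappa times those of [u], whichever phase the nearby points
   lie in. *)
have h : (fun k : nat => (sp * (1 + kappa)) * `|k.+1%:R * (u (x + k.+1%:R^-1 *: v) - u x)|) @ \oo --> (sp * (1 + kappa)) * `|0 : R|.
  by apply: cvgMr; apply: cvg_norm.
rewrite normr0 mulr0 in h.
apply/norm_cvg0P; apply: (squeeze_cvgr _ _ h) => //; last exact: (@cvg_cst _ 0).
apply: nearW => k; rewrite normr_ge0 /= (glue_boundary bx) (ud bx) !normrM (gtr0_norm sp0).
by rewrite -[leRHS]mulrA ler_pM2l// mulrCA ler_wpM2l// glue_dist.
Qed.

End Glue.

(** * Symmetry of the solution and of the domain *)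

Section TwoPhase.
Context {R : realType} {n : nat}.
Variables (D : set 'rV[R]_n.+1) (sp sm d L MD : R) (psi u : 'rV[R]_n.+1 -> R).
Hypotheses (oD : open D) (D0 : D 0) (bD : forall x, D x -> ob_enorm x <= MD).
Hypotheses (sp0 : 0 < sp) (sm0 : 0 < sm) (d0 : 0 < d).
Hypotheses (psi_cont : continuous psi) (psi_rad : ob_radial psi).
Hypothesis psi_supp : forall x, 0 < psi x -> D x.
Hypothesis uL : forall x y, `|u x - u y| <= L * `|x - y|.
Hypothesis obs : ob_obstacle_sol (ob_sigma_of D sp sm) psi u.
Hypothesis decay : forall e : R, 0 < e -> exists M : R, forall x, M < ob_enorm x -> `|u x| < e.
Hypothesis ud : forall x, ob_boundary D x -> u x = d.
Implicit Types (x y z : 'rV[R]_n.+1) (e t : R).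

Let kappa := sm / sp.
Let k0 : 0 < kappa. Proof. exact: divr_gt0. Qed.
Let w := glue D u d kappa.
Let c := d - kappa * d.
Let cd : c < d. Proof. by rewrite /c ltrBlDr ltrDl mulr_gt0. Qed.
Let Lw := (1 + kappa) * `|L|.
Let wL x y : `|w x - w y| <= Lw * `|x - y|. Proof. exact: glue_lip. Qed.
Let w_cont : continuous w. Proof. exact: lip_continuous wL. Qed.

Let energyE x0 e : 0 < e ->
  ob_energy (ob_sigma_of D sp sm) u (fun x => bumpN 1 e (x - x0)) =
  - sp * ob_iint (fun y => lapbump 1 e (y - x0) * w y).
Proof. by move=> e0; apply: (@energy_bump _ _ u w _ sp Lw e 1 x0 e0 wL) => i; exact: flux_null. Qed.

Lemma glue_super x e : 0 < e -> ob_iint (fun y => lapbump 1 e (y - x) * w y) <= 0.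
Proof.
move=> e0; have [_ [sup _]] := obs.
have tf : ob_test_fun setT (fun y => bumpN 1 e (y - x)) by exact: bumpN_test_fun.
have := sup _ tf (fun y => bump_ge0 e (y - x)).
by rewrite energyE// mulNr oppr_ge0 pmulr_rle0.
Qed.

Lemma glue_harm x e : 0 < e -> eball x e `<=` [set y | psi y < u y] ->
  ob_iint (fun y => lapbump 1 e (y - x) * w y) = 0.
Proof.
move=> e0 sub; have [_ [_ sol]] := obs.
have := sol _ (bumpN_test_fun 1 e0 sub); rewrite energyE// => /eqP.
by rewrite mulf_eq0 oppr_eq0 (gt_eqF sp0) => /eqP.
Qed.

Lemma glue_lim e : 0 < e -> exists M, forall x, M < ob_enorm x -> `|w x - c| < e.
Proof.
move=> e0; have [M hM] := decay (divr_gt0 e0 k0).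
exists (Num.max M MD) => x; rewrite gt_max => /andP[xM xD].
have nDx : ~ D x by move=> /bD; rewrite leNgt xD.
rewrite /w glue_out// (_ : _ - c = kappa * u x); last by rewrite /c; ring.
by rewrite normrM (gtr0_norm k0) mulrC -ltr_pdivlMr// hM.
Qed.

Let closure_sqn x : closure D x -> sqn x <= MD ^+ 2.
Proof.
have : closed [set y : 'rV[R]_n.+1 | sqn y <= MD ^+ 2] by exact: closed_sublevel (@sqn_continuous R n.+1).
move=> /closure_id; have sub : D `<=` [set y | sqn y <= MD ^+ 2].
  move=> y /bD yM; rewrite /= -enorm_sqr ler_pXn2r ?nnegrE ?enorm_ge0//.
  exact: le_trans (enorm_ge0 y) yM.
by move=> E /(closureS sub); rewrite -E.
Qed.

Let compact_closure : compact (closure D).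
Proof.
apply: bounded_closed_compact; last exact: closed_closure.
apply: (@bounded_enorm _ _ _ `|MD|) => x /closure_sqn.
by rewrite -enorm_sqr -[MD ^+ 2]real_normK ?num_real// ler_pXn2r ?nnegrE ?enorm_ge0.
Qed.

Let quad_cont (a : R) : continuous (fun x => - a * sqn x + 0).
Proof.
move=> x; apply: (@cvgD _ _ _ (nbhs x)); last exact: cst_continuous.
apply: (@cvgM _ _ (nbhs x)); first exact: cst_continuous.
exact: (@sqn_continuous R n.+1 x).
Qed.

Let quad_lap (a : R) x : 0 < a ->
  exists2 b, b < 0 & upper_lap (@ob_ebasis R n.+1) (fun y => - a * sqn y + 0) x b.
Proof.
move=> a0; exists (- a * (2 * n.+1%:R)); last exact: upper_lap_sqn.
by rewrite mulNr oppr_lt0 mulr_gt0// mulr_gt0.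
Qed.

(* The quadratic perturbation turns superharmonicity into the strict inequality [max_principle] needs. *)
Let min_principle (K : set 'rV[R]_n.+1) f1 f2 Q x0 m : compact K ->
  appsup K f1 -> appsup K f2 -> (forall x, K x -> sqn x <= Q) -> K x0 ->
  (forall y, K y -> ~ K^° y -> m <= f1 y + f2 y) -> m <= f1 x0 + f2 x0.
Proof.
move=> cK a1 a2 KQ Kx0 hb; rewrite leNgt; apply/negP => lt.
have Q0 : 0 <= Q by rewrite (le_trans (sqn_ge0 x0))// KQ.
pose g := m - (f1 x0 + f2 x0).
have g0 : 0 < g by rewrite subr_gt0.
have Q1 : 0 < 2 * (Q + 1) by rewrite mulr_gt0// ltr_wpDl.
(* The quadratic then uses at most half of the gap on [K]. *)
pose a := g / (2 * (Q + 1)).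
have a0 : 0 < a by rewrite divr_gt0.
have aQ : a * Q <= g / 2.
  have E : a * (Q + 1) = g / 2 by rewrite /a; field; apply/eqP; lra.
  by rewrite -E ler_wpM2l ?lerDl// ltW.
apply: (@max_principle _ _ K f1 f2 (fun x => - a * sqn x + 0) x0 (g / 2)) => //.
- by move=> x _; exact: quad_lap.
- by rewrite divr_gt0.
move=> y Ky nKy; have h1 := hb y Ky nKy.
have h2 : a * sqn y <= a * Q by rewrite ler_wpM2l ?KQ// ltW.
have h3 : 0 <= a * sqn x0 by rewrite mulr_ge0 ?sqn_ge0// ltW.
rewrite /g in aQ *; lra.
Qed.

Lemma u_ge_inside x : D x -> d <= u x.
Proof.
move=> Dx; rewrite -(glue_in u d kappa Dx) -/w -[w x]addr0.
apply: (min_principle (K := closure D) (f2 := fun=> 0) (Q := MD ^+ 2)) => //.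
- exact: (appsup_super wL _ glue_super).
- exact: appsup0.
- exact: subset_closure.
move=> y Ky nKy; rewrite addr0 /w (glue_boundary ud)//; split => // iy; apply: nKy.
by move: iy; apply: interiorS; exact: subset_closure.
Qed.

Lemma glue_gt x : c < w x.
Proof.
have [r0 r00 hr] : exists2 r : R, 0 < r & forall y, `|y| < r -> D y.
  have /nbhs_ballP[r r0 hr] : nbhs (0 : 'rV[R]_n.+1) D by exact: open_nbhs_nbhs.
  by exists r => // y yr; apply: hr; rewrite -ball_normE /= sub0r normrN.
pose r := r0 / 2.
have rp : 0 < r by rewrite divr_gt0.
have outr y : ~ D y -> r ^+ 2 < sqn y.
  move=> nD; apply: norm_gt_sqn; first exact: ltW.
  rewrite ltNge; apply/negP => yr; apply: nD; apply: hr; rewrite (le_lt_trans yr)//.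
  by rewrite /r; lra.
(* The ball of radius [r] lies in [D], so every point outside [D] meets the threshold of
   [upper_lap_barrier]. *)
pose a := (2 * n.+1%:R + 1) / r ^+ 2.
have a0 : 0 < a by rewrite divr_gt0 ?exprn_gt0// ltr_wpDl// mulr_ge0.
have aout y : ~ D y -> 2 * n.+1%:R < a * sqn y.
  move=> /outr h; apply: (@lt_le_trans _ _ (a * r ^+ 2)); last by rewrite ler_wpM2l// ltW.
  by rewrite /a divfK ?ltrDl// gt_eqF// exprn_gt0.
(* As the barrier is at most 1, F >= d - th = c in [D], which forces the sublevel set [K] out of
   [D]. *)
pose th := d - c.
have th0 : 0 < th by rewrite subr_gt0.
have B0 y : 0 < barrier a y by exact: expR_gt0.
have B1 y : barrier a y <= 1.
  by rewrite /barrier -expR0 ler_expR oppr_le0 mulr_ge0 ?sqn_ge0// ltW.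
pose F y := w y + - th * barrier a y.
suff h : c <= F x.
  have hb : 0 < th * barrier a x by rewrite mulr_gt0.
  by rewrite /F in h; lra.
rewrite leNgt; apply/negP => Fx.
pose m := c - F x.
have m0 : 0 < m by rewrite subr_gt0.
have cB : continuous (fun y => - th * barrier a y).
  move=> y; apply: (@cvgM _ _ (nbhs y)); first exact: cst_continuous.
  apply: (@continuous_comp _ _ _ (fun y => - (a * sqn y)) expR); last exact: continuous_expR.
  apply: (@cvgN _ _ _ (nbhs y)); apply: (@cvgM _ _ (nbhs y)); first exact: cst_continuous.
  exact: (@sqn_continuous R n.+1 y).
have cF : continuous F.
  by move=> y; apply: (@cvgD _ _ _ (nbhs y)); [exact: w_cont|exact: cB].
pose K := [set y | F y <= c - m / 2].
have KnD y : K y -> ~ D y.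
  move=> Ky Dy; have := u_ge_inside Dy; rewrite -(glue_in u d kappa Dy) -/w.
  have : th * barrier a y <= th * 1 by rewrite ler_wpM2l// ltW.
  by move: Ky; rewrite /K /F /= /th; lra.
have cK : compact K.
  have m8 : 0 < m / 8 by rewrite divr_gt0.
  have [M hM] := glue_lim m8.
  (* |y| > q >= 1 gives |y|^2 >= q, and exp(-s) <= 1/s then makes the barrier term at most m/8. *)
  pose q := 8 * th / (m * a) + 1.
  have qq : 0 < 8 * th / (m * a) by rewrite divr_gt0// mulr_gt0.
  have q0 : 0 < q by rewrite ltr_wpDl// ltW.
  apply: (@compact_sublevel _ _ _ _ (Num.max M q)) => // y; rewrite gt_max => /andP[yM yq].
  have h1 := hM y yM.
  have sq : q <= sqn y.
    have q1 : 1 <= q by rewrite lerDr ltW.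
    rewrite -enorm_sqr; apply: (le_trans (ltW yq)).
    by rewrite expr2 ler_peMl ?enorm_ge0// (le_trans q1)// ltW.
  have as0 : 0 < a * sqn y by rewrite mulr_gt0// (lt_le_trans q0).
  have hb : barrier a y <= (a * sqn y)^-1.
    rewrite /barrier expRN lef_pV2 ?posrE ?expR_gt0//.
    by apply: le_trans (expR_ge1Dx _); rewrite lerDr.
  have hb2 : th * barrier a y <= m / 8.
    apply: (@le_trans _ _ (th * (a * sqn y)^-1)); first by rewrite ler_wpM2l// ltW.
    rewrite ler_pdivrMr//.
    have : 8 * th / (m * a) <= sqn y by apply: le_trans sq; rewrite lerDl.
    rewrite (ler_pdivrMr _ _ (mulr_gt0 m0 a0)) => h.
    have -> : m / 8 * (a * sqn y) = sqn y * (m * a) / 8 by ring.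
    by rewrite ler_pdivlMr// mulrC.
  move: h1; rewrite ltr_norml => /andP[h1 _]; rewrite /F; lra.
have Kx : K x by rewrite /K /= /m; lra.
apply: (@max_principle _ _ K w (fun=> 0) (fun y => - th * barrier a y) x (m / 2)) => //.
- exact: (appsup_super wL _ glue_super).
- exact: appsup0.
- by move=> y /KnD /aout h; exact: upper_lap_barrier.
- by rewrite divr_gt0.
move=> y Ky nKy; have Fy := sublevel_boundary cF Ky nKy.
rewrite !addr0 -/(F y) -/(F x) Fy /m; lra.
Qed.

Lemma u_gt0_outside x : ~ D x -> 0 < u x.
Proof.
move=> nDx; have := glue_gt x; rewrite /w glue_out// /c => h.
have : 0 < kappa * u x by lra.
by rewrite pmulr_rgt0.
Qed.

Lemma contactP x : ~ psi x < u x -> [/\ D x, 0 < psi x & u x = psi x].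
Proof.
move=> nc; have [pu _] := obs.
have E : u x = psi x.
  by apply/eqP; rewrite eq_le pu andbT leNgt; apply/negP.
have Dx : D x.
  apply: contrapT => nDx; have := u_gt0_outside nDx; rewrite E => /psi_supp; exact: nDx.
by split => //; rewrite -E (lt_le_trans d0)// u_ge_inside.
Qed.

Let Lw0 : 0 <= Lw. Proof. by rewrite mulr_ge0// addr_ge0// ltW. Qed.

Let glue_radial_le x1 x2 : sqn x1 = sqn x2 -> w x1 <= w x2.
Proof.
move=> sx; have [->//|nx] := eqVneq x1 x2.
pose S := reflect_along (x1 - x2).
have Sx1 : S x1 = x2 by exact: reflect_swap.
have sS y : sqn (S y) = sqn y by exact: sqn_reflect.
rewrite -Sx1 leNgt; apply/negP => lt.
pose m := w x1 - w (S x1).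
have m0 : 0 < m by rewrite subr_gt0.
pose F y := w (S y) + - w y.
have cS : continuous S by exact: reflect_continuous.
have cF : continuous F.
  move=> y; apply: (@cvgD _ _ _ (nbhs y)).
    by apply: (@continuous_comp _ _ _ S w); [exact: cS|exact: w_cont].
  by apply: (@cvgN _ _ _ (nbhs y)); exact: w_cont.
(* Halfway between 0 and F x1 = -m: [K] keeps a distance from {F >= 0}, hence from contact, and [F]
   on its boundary exceeds F x1. *)
pose K := [set y | F y <= - (m / 2)].
have m8 : 0 < m / 8 by rewrite divr_gt0.
have [M hM] := glue_lim m8.
have farK y : M < ob_enorm y -> - (m / 2) < F y.
  move=> yM; have h1 := hM y yM.
  have h2 : `|w (S y) - c| < m / 8 by apply: hM; rewrite enorm_sqn sS.
  move: h1 h2; rewrite !ltr_norml => /andP[a1 a2] /andP[a3 a4]; rewrite /F; lra.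
have cK : compact K by exact: compact_sublevel cF farK.
have KQ y : K y -> sqn y <= M ^+ 2.
  move=> Ky; have yM : ob_enorm y <= M.
    by rewrite leNgt; apply/negP => /farK; rewrite ltNge Ky.
  by rewrite -enorm_sqr ler_pXn2r ?nnegrE ?enorm_ge0// (le_trans (enorm_ge0 y)).
have Kx1 : K x1 by rewrite /K /= /F /m; lra.
(* At a contact point, u (S y) >= psi (S y) = psi y = u y with both points in [D], so F y >= 0. *)
have nopos y : F y < 0 -> psi y < u y.
  move=> Fy; apply: contrapT => /contactP[Dy py E].
  have pS : psi (S y) = psi y by apply: psi_rad; rewrite !enorm_sqn sS.
  have DSy : D (S y) by apply: psi_supp; rewrite pS.
  have [pu _] := obs.
  move: Fy; rewrite /F /w !glue_in// E -pS; have := pu (S y); lra.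
have L1 : 0 < 8 * (Lw + 1) by rewrite mulr_gt0// ltr_wpDl.
(* Within this radius [w] and [w o S] each vary by at most m/8, so [F] stays negative. *)
pose e1 := m / (8 * (Lw + 1)).
have e10 : 0 < e1 by rewrite divr_gt0.
have har : appsup K (fun y => - w y).
  apply: (appsup_harmonic wL e10) => y e Ky /andP[e0 ee]; apply: glue_harm => // z yz.
  apply: nopos.
  have h1 : `|z - y| <= e by apply: eball_norm yz; exact: ltW.
  have h2 : `|S z - S y| <= e.
    rewrite (le_trans (reflect_norm _ _ _))// enorm_sqn -[leRHS](ger0_norm (ltW e0)) -sqrtr_sqr.
    exact: ler_wsqrtr.
  have h3 : Lw * e <= m / 8.
    have E : (Lw + 1) * e1 = m / 8 by rewrite /e1; field; apply/eqP; lra.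
    rewrite -E; apply: ler_pM => //; [exact: ltW|by rewrite lerDl|exact: ltW].
  have h4 := le_trans (wL z y) (ler_wpM2l Lw0 h1).
  have h5 := le_trans (wL (S z) (S y)) (ler_wpM2l Lw0 h2).
  move: h4 h5 Ky; rewrite !ler_norml /K /F /= => /andP[a1 a2] /andP[a3 a4] Ky; lra.
have supS : appsup K (w \o S).
  apply: (appsup_isometry wL) glue_super => //; [exact: reflect_lin|exact: reflect_frame].
have h : - (m / 2) <= (w \o S) x1 + - w x1.
  apply: (min_principle cK supS har KQ Kx1) => y Ky nKy.
  by rewrite /= -/(F y) (sublevel_boundary cF Ky nKy).
rewrite /= in h; rewrite /m in h m0; lra.
Qed.

Lemma glue_radial x1 x2 : sqn x1 = sqn x2 -> w x1 = w x2.
Proof. by move=> h; apply/eqP; rewrite eq_le !glue_radial_le. Qed.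

Lemma glue_mono x y : sqn x <= sqn y -> w y <= w x.
Proof.
rewrite le_eqVlt => /orP[/eqP/glue_radial->//|xy].
pose K := [set z : 'rV[R]_n.+1 | sqn z <= sqn y].
have cq := @sqn_continuous R n.+1.
have cK : compact K.
  apply: (@compact_sublevel _ _ _ _ (ob_enorm y)) => // z zy.
  by rewrite -!enorm_sqr ltr_pXn2r ?nnegrE ?enorm_ge0.
rewrite -[w x]addr0.
apply: (min_principle (f2 := fun=> 0) cK _ _ (fun z Kz => Kz)).
- exact: (appsup_super wL _ glue_super).
- exact: appsup0.
- exact: ltW.
move=> z Kz nKz; have sz := sublevel_boundary cq Kz nKz.
by rewrite addr0 (glue_radial sz).
Qed.

Lemma boundary_notin x : ob_boundary D x -> ~ D x.
Proof. by move=> [_ nix] Dx; apply: nix; exact: open_nbhs_nbhs. Qed.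

Lemma boundary_compact : compact (ob_boundary D).
Proof.
rewrite /ob_boundary setDE; apply: compact_closedI; first exact: compact_closure.
by apply: open_closedC; exact: open_interior.
Qed.

Lemma ray_exit x : D x -> x != 0 -> exists2 s : R, 1 <= s & ob_boundary D (s *: x).
Proof.
move=> Dx nx.
have ex : 0 < ob_enorm x.
  rewrite lt_def enorm_ge0 andbT; apply: contra nx => /eqP h; apply/eqP/sqn_eq0.
  by rewrite -enorm_sqr h expr0n.
(* Makes the length of T x equal to |x| + |MD| + 1, beyond the bound on [D]. *)
pose T := 1 + (`|MD| + 1) / ob_enorm x.
have T1 : 0 <= T - 1.
  by rewrite /T addrAC subrr add0r divr_ge0 ?enorm_ge0// addr_ge0.
have nDT : ~ D (T *: x).
  move=> /bD; rewrite enorm_sqn sqnZ -enorm_sqr -exprMn sqrtr_sqr ger0_norm; last first.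
    by rewrite mulr_ge0 ?enorm_ge0//; lra.
  rewrite /T mulrDl mul1r divfK ?gt_eqF//; have := ler_norm MD; lra.
have [s /andP[s0 s1] bs] := segment_crosses_boundary oD Dx nDT.
exists (1 + s * (T - 1)); first by rewrite lerDl mulr_ge0.
by rewrite scalerDl scale1r -scalerA scalerBl scale1r.
Qed.

Lemma domain_is_ball : exists r : R, 0 < r /\ D = [set x | ob_enorm x < r].
Proof.
have nb : ob_boundary D !=set0.
  pose y : 'rV[R]_n.+1 := (`|MD| + 1) *: ob_ebasis R ord0.
  have M1 : 0 <= `|MD| + 1 by rewrite addr_ge0.
  have nDy : ~ D y.
    move=> /bD; rewrite enorm_sqn sqnZ (ebasis_frame.1 ord0) mulr1 sqrtr_sqr ger0_norm//.
    have := ler_norm MD; lra.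
  by have [s _ bs] := segment_crosses_boundary oD D0 nDy; exists (0 + s *: (y - 0)).
have [xs] : exists2 c, c \in ob_boundary D & forall y, y \in ob_boundary D -> sqn y <= sqn c.
  apply: EVT_max_rV => //; first exact: boundary_compact.
  by apply: continuous_subspaceT; exact: sqn_continuous.
rewrite inE => bxs maxs; set rho := sqn xs in maxs.
have bmax y : ob_boundary D y -> sqn y <= rho by move=> by'; apply: maxs; rewrite inE.
have rho0 : 0 < rho.
  rewrite lt_def sqn_ge0 andbT; apply/eqP => /sqn_eq0 xs0.
  by apply: (boundary_notin bxs); rewrite xs0.
(* The ray through [x] meets the boundary strictly beyond [x], as points of [D] are not boundary
   points. *)
have Din x : D x -> sqn x < rho.
  move=> Dx; have [->|nx] := eqVneq x 0; first by rewrite sqn0.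
  have [s s1 bs] := ray_exit Dx nx.
  have sx0 : 0 < sqn x.
    rewrite lt_def sqn_ge0 andbT; apply: contra nx => /eqP h; exact/eqP/sqn_eq0.
  have s1' : 1 < s.
    rewrite lt_neqAle s1 andbT; apply/eqP => s1e; apply: (boundary_notin bs).
    by rewrite -s1e scale1r.
  apply: lt_le_trans (bmax _ bs); rewrite sqnZ ltr_pMl//.
  by rewrite expr2; nra.
have cq := @sqn_continuous R n.+1.
pose C := [set x | u x - psi x <= 0].
have u_cont : continuous u := lip_continuous uL.
have cC : compact C.
  apply: (@compact_sublevel _ _ _ _ MD).
    move=> x; apply: (@cvgB _ _ _ (nbhs x)); [exact: u_cont|exact: psi_cont].
  move=> x xM; rewrite subr_gt0; apply: contrapT => /contactP[/bD].
  by rewrite leNgt xM.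
have CP x : ~ psi x < u x -> C x by move=> h; rewrite /C /= subr_le0 leNgt; apply/negP.
have CD x : C x -> D x.
  by rewrite /C /= subr_le0 leNgt => /negP/contactP[].
(* The contact set is compact in [D], so it stays strictly inside the outermost sphere; [rho / 2]
   serves if it is empty. *)
have [rc rcr hrc] : exists2 rc : R, rc < rho & forall x, C x -> sqn x <= rc.
  have [[x0 Cx0]|C0] := pselect (C !=set0); last first.
    by exists (rho / 2) => [|x Cx]; [lra|exfalso; apply: C0; exists x].
  have [x1] : exists2 c, c \in C & forall y, y \in C -> sqn y <= sqn c.
    apply: EVT_max_rV => //; first by exists x0.
    exact: continuous_subspaceT.
  rewrite inE => Cx1 h; exists (sqn x1); first exact/Din/CD.
  by move=> x Cx; apply: h; rewrite inE.
have bsphere y : ob_boundary D y -> sqn y = rho.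
  move=> by'; apply/eqP; rewrite eq_le bmax//= leNgt; apply/negP => yr.
  (* Past both the supposed inner boundary point and the contact set. The annulus starts halfway
     from there to [rho], which leaves a margin for the test balls. *)
  pose rho1 := Num.max (sqn y) rc.
  have r1 : rho1 < rho by rewrite gt_max yr.
  pose rho1' := (rho1 + rho) / 2.
  have r1' : rho1 < rho1' < rho by rewrite /rho1'; apply/andP; split; lra.
  have rho1'0 : 0 <= rho1' by rewrite /rho1' divr_ge0// addr_ge0// ?(ltW rho0)// le_max sqn_ge0.
  have dc2 : 0 < (d - c) / 2 by rewrite divr_gt0// subr_gt0.
  have [M hM] := glue_lim dc2.
  pose rM := `|M| + 1 + rho.
  have rM0 : 0 < rM by rewrite addr_gt0// ltr_wpDl.
  pose rho2 := rM ^+ 2 + rho.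
  have r2 : rho < rho2 by rewrite /rho2 ltrDr exprn_gt0.
  have far z : rho2 <= sqn z -> w z <= d - (d - c) / 2.
    move=> zr; have zM : M < ob_enorm z.
      rewrite ltNge; apply/negP => zM.
      have : sqn z <= `|M| ^+ 2.
        by rewrite -enorm_sqr ler_pXn2r ?nnegrE ?enorm_ge0// (le_trans zM)// ler_norm.
      have : `|M| ^+ 2 <= rM ^+ 2.
        rewrite ler_pXn2r ?nnegrE ?(ltW rM0)// /rM -addrA lerDl addr_ge0// ltW//.
      move: zr; rewrite /rho2; lra.
    have := hM z zM; rewrite ltr_norml => /andP[_]; lra.
  pose K := [set z : 'rV[R]_n.+1 | sqn z <= rho2] `&` [set z | - sqn z <= - rho1'].
  have cNq : continuous (fun z : 'rV[R]_n.+1 => - sqn z).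
    by move=> z; apply: (@cvgN _ _ _ (nbhs z)); exact: cq.
  have cK : compact K.
    apply: compact_closedI; last exact: closed_sublevel.
    apply: (@compact_sublevel _ _ _ _ (Num.sqrt rho2)) => // z zr.
    rewrite -enorm_sqr -[rho2]sqr_sqrtr; last by rewrite ltW// (lt_trans rho0).
    by rewrite ltr_pXn2r ?nnegrE ?sqrtr_ge0 ?enorm_ge0.
  (* The slope at which the quadratic gains (d - c)/2 across the annulus, the amount by which [w] is
     below [d] on the outer sphere. *)
  pose th := (d - c) / 2 / (rho2 - rho1').
  have r21 : 0 < rho2 - rho1' by move/andP: r1' => [_ h]; lra.
  have th0 : 0 < th by rewrite divr_gt0.
  pose S := Num.sqrt rho2.
  (* A move of length e lowers |z|^2 by at most 2 S (n + 1) e, so smaller balls centred in [K] stay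
     beyond [rho1]. *)
  pose e1 := (rho1' - rho1) / (2 * (S * n.+1%:R) + 1).
  have S0 : 0 <= S by exact: sqrtr_ge0.
  have den0 : 0 < 2 * (S * n.+1%:R) + 1 by rewrite ltr_wpDl// mulr_ge0// mulr_ge0.
  have e10 : 0 < e1 by rewrite divr_gt0// subr_gt0; case/andP: r1'.
  have har : appsup K (fun z => - w z).
    apply: (appsup_harmonic wL e10) => z e [Kz1 Kz2] /andP[e0 ee]; apply: glue_harm => // z' zz'.
    apply: contrapT => /CP/hrc; apply/negP; rewrite -ltNge.
    have zS : `|z| <= S by rewrite (le_trans (norm_le_enorm _))// enorm_sqn; exact: ler_wsqrtr.
    have zn : `|z' - z| <= e by apply: eball_norm zz'; exact: ltW.
    have db : `|dot z (z' - z)| <= S * (n.+1%:R * e).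
      rewrite (le_trans (dot_bound (z' - z) zS))// ler_wpM2l//.
      have -> : n.+1%:R * e = \sum_(i < n.+1) e by rewrite sumr_const card_ord mulr_natl.
      by apply: ler_sum => i _; rewrite (le_trans (coord_le_norm _ _)).
    have E : sqn z' = sqn z + 2 * dot z (z' - z) + sqn (z' - z).
      by rewrite -[in LHS](subrKC z z') -[X in z + X]scale1r sqn_line expr1n mul1r mulr1.
    have h1 := sqn_ge0 (z' - z).
    have h2 : rho1' - rho1 = e1 * (2 * (S * n.+1%:R) + 1) by rewrite /e1 divfK// gt_eqF.
    have h3 : e * (2 * (S * n.+1%:R) + 1) < rho1' - rho1 by rewrite h2 ltr_pM2r.
    have h4 : rc <= rho1 by rewrite le_max lexx orbT.
    move: db Kz2; rewrite /= ler_norml => /andP[db _] Kz2.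
    rewrite E; nra.
  (* On both spheres d - w >= th (|z|^2 - rho1'), while at [xs] the left side is 0 and the right
     side is th (rho - rho1'): this is the gap. *)
  apply: (@max_principle _ _ K (fun z => - w z) (fun=> 0) (fun z => - th * sqn z + 0) xs (th * (rho - rho1'))) => //.
  - exact: appsup0.
  - by move=> z _; exact: quad_lap.
  - by rewrite /K /= lerN2 -/rho; case/andP: r1' => _ h; rewrite !ltW.
  - by rewrite mulr_gt0// subr_gt0; case/andP: r1'.
  move=> z Kz nKz; rewrite !addr0 /w (glue_boundary ud kappa bxs) -/w -/rho.
  have [z1|z1] := eqVneq (sqn z) rho1'.
    have h : w z <= d.
      rewrite -(glue_boundary ud kappa by') -/w; apply: glue_mono.
      by rewrite z1 (@le_trans _ _ rho1) ?le_max ?lexx//; case/andP: r1' => /ltW.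
    rewrite z1; lra.
  have z2 : sqn z = rho2.
    apply: contrapT => /eqP z2; apply: nKz; case: Kz => /= k1 k2.
    have k3 : sqn z < rho2 by rewrite lt_neqAle z2.
    have k4 : - sqn z < - rho1' by rewrite lt_neqAle k2 andbT eqr_opp.
    have n3 : \forall z' \near z, sqn z' < rho2 by exact: (cvgr_lt _ (cq z)).
    have n4 : \forall z' \near z, - sqn z' < - rho1' by exact: (cvgr_lt _ (cNq z)).
    by apply: filterS2 n3 n4 => z' /ltW a1 /ltW a2.
  have h : w z <= d - (d - c) / 2 by apply: far; rewrite z2.
  have E : th * (rho2 - rho1') = (d - c) / 2 by rewrite /th divfK// gt_eqF.
  rewrite z2; lra.
exists (Num.sqrt rho); split; first by rewrite sqrtr_gt0.
apply/seteqP; split => x /=; first by move=> /Din xr; rewrite enorm_sqn ltr_sqrt.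
rewrite enorm_sqn ltr_sqrt// => xr; apply: contrapT => nDx.
(* A missing point inside the sphere would yield a boundary point on its segment from 0, too close
   to 0. *)
have [s /andP[s0 s1] bs] := segment_crosses_boundary oD D0 nDx.
have := bsphere _ bs; rewrite add0r subr0 sqnZ => E.
have : s ^+ 2 * sqn x <= sqn x by rewrite ler_piMl ?sqn_ge0// expr2 mulr_ile1.
by rewrite E leNgt xr.
Qed.

(** In a ball, points of equal norm belong to the same phase, and in each phase [w] determines
    [u]. *)
Lemma solution_radial : ob_radial u.
Proof.
have [r [r0 DE]] := domain_is_ball.
move=> x y xy.
have sxy : sqn x = sqn y by rewrite -!enorm_sqr xy.
have wxy := glue_radial sxy.
have Dxy : D x <-> D y by rewrite DE /= xy.
have [Dx|nDx] := pselect (D x).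
  by move: wxy; rewrite /w !glue_in//; exact/Dxy.
move: wxy; rewrite /w !glue_out//; last by move=> /Dxy.
move=> h; have : kappa * (u x - u y) = 0 by move: h; rewrite /=; lra.
by move/eqP; rewrite mulf_eq0 (gt_eqF k0) /= subr_eq0 => /eqP.
Qed.

End TwoPhase.

(* R^N with N = n.+1, so "N >= 3" reads 3 <= n.+1. *)
Theorem theorem1p4 (R : realType) (n : nat) (hN : (3 <= n.+1)%N)
  (D : set 'rV[R]_n.+1) (alpha : R) (sp sm d : R)
  (psi u : 'rV[R]_n.+1 -> R) :
  ob_bounded_domain D -> D 0 ->
  0 < alpha -> alpha < 1 -> ob_C2alpha_boundary alpha D ->
  0 < sp -> 0 < sm -> sp != sm ->
  ob_C2_closure D psi -> continuous psi ->
  (exists x, 0 < psi x) -> ob_radial psi ->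
  closure [set x | 0 < psi x] `<=` D ->
  ob_C11_closure D u -> ob_lipschitz setT u ->
  ob_obstacle_sol (ob_sigma_of D sp sm) psi u ->
  (forall e : R, 0 < e -> exists M : R, forall x, M < ob_enorm x -> `|u x| < e) ->
  0 < d -> (forall x, ob_boundary D x -> u x = d) ->
  ob_radial u /\ exists r : R, 0 < r /\ D = [set x | ob_enorm x < r].
Proof.
move=> [oD [_ [_ [MD bD]]]] D0 _ _ _ sp0 sm0 _ _ cpsi _ rpsi supp _ [Lu hLu] obs decay d0 ud.
have psi_supp x : 0 < psi x -> D x.
  by move=> px; apply: supp; exact: subset_closure.
(* Passing from the Euclidean to the max norm costs the factor n + 1. *)
have uL x y : `|u x - u y| <= (`|Lu| * n.+1%:R) * `|x - y|.
  rewrite (le_trans (hLu x y _ _))// (@le_trans _ _ (`|Lu| * ob_enorm (x - y)))//.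
    by rewrite ler_wpM2r ?enorm_ge0// ler_norm.
  by rewrite -mulrA ler_wpM2l// enorm_le_norm.
split.
  exact: (solution_radial oD D0 bD sp0 sm0 d0 cpsi rpsi psi_supp uL obs decay ud).
exact: (domain_is_ball oD D0 bD sp0 sm0 d0 cpsi rpsi psi_supp uL obs decay ud).
Qed.
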